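(* The discontinuous bond-volume based coupled energy $\mathcal{E}^D_{bv}\{y\}=\sum_{\eta\in R}\mathcal{E}^D_\eta\{y\}$ (defined in the context) is free of ghost forces, in the sense that, for $y_F(x)=\mathsf F x$ with $\mathsf F$ a constant $3\times3$ matrix, $\det\mathsf F>0$, $$\langle D\mathcal{E}^D_{bv}(y_F),v\rangle=0\qquad\text{for all } v\in\mathscr V .$$
   Context: Lattice and domain. $\varepsilon=1/k$ with $k$ a positive integer; $x_\ell=\varepsilon\ell$ for $\ell\in\mathbb{Z}^3$; $e_1,e_2,e_3$ is the standard basis of $\mathbb R^3$. For positive integers $M_1,M_2,M_3$, $\Omega=\prod_{i=1}^3[-M_i+1,M_i]$ and $\mathfrak L=\mathbb{Z}^3\cap\frac1\varepsilon\Omega$. $\mathscr V$ is the space of lattice functions $v:\mathfrak L\to\mathbb{R}^3$, $v_\ell=v(x_\ell)$, that are periodic with respect to $\mathfrak L$ (basic period $\Omega$) and have zero average. Deformations are $y_\ell=\mathsf F x_\ell+v_\ell$ with $v\in\mathscr V$. For $\eta\in\mathbb Z^3$, $\overline D_\eta y_\ell=(y_{\ell+\eta}-y_\ell)/\varepsilon$. Potentials. $R\subset\mathbb{Z}^3$ is a given finite set of interaction vectors $\eta=(\eta_1,\eta_2,\eta_3)$ with $\eta_1\eta_2\eta_3\neq0$; for each $\eta\in R$, $\phi_\eta$ is a sufficiently smooth real-valued interatomic potential on $\mathbb R^3$, with gradient $\phi_\eta'$. Bond volumes and type A decompositions. For $\eta_1\eta_2\eta_3\ne0$, the bond volume $B_{\ell,\eta}$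 is the interior of the rectangular parallelepiped with edges parallel to the $e_i$ and main diagonal from $x_\ell$ to $x_{\ell+\eta}$. Its type A decomposition is the decomposition into six tetrahedra whose edges are the edges of $B_{\ell,\eta}$, the main diagonal from $x_\ell$ to $x_{\ell+\eta}$, and the face diagonals starting at $x_\ell$ or at $x_{\ell+\eta}$. The lattice cells are $K_\ell=x_\ell+(0,\varepsilon)^3$, and the type A decomposition of $K_\ell$ is that of $B_{\ell,(1,1,1)}=K_\ell$. $\mathcal T_T$ is the set of all tetrahedra $T\subset\Omega$ of the type A decompositions of the lattice cells. A lattice tetrahedron is a tetrahedron whose vertices are points of $\varepsilon\mathbb{Z}^3$. Regions. $\Omega_a$ (atomistic region) and $\Omega_*$ (atomistic Cauchy–Born region) are disjoint, connected, and each is the interior of the closure of a union of tetrahedra of $\mathcal T_T$; $\Omega=\overline\Omega_a\cup\overline\Omega_*$, and the interface is $\Gamma=\overline\Omega_a\cap\overline\Omega_*$. $\overline\Omega_a$ lies in the interior of $\Omega$ at sufficient distance from $\partial\Omega$ (so that bond volumes whose closure meets $\overline\Omega_a$ stay inside $\Omega$). For each $\eta\in R$ every bond volume is of one of three types: (a) $\overline B_{\ell,\eta}\subset\Omega_a$; (b) $B_{\ell,\eta}\subset\Omega_*$ (a bond volume intersecting $\partial\Omega$ is regarded as being of this type, by periodic extension); (c) $B_{\ell,\eta}\in B_\Gamma$, where $B_\Gamma$ is the set of bond volumes satisfying neither (a) nor (b), i.e. those with $B_{\ell,\eta}\cap\Gamma\ne\emptyset$, or with $B_{\ell,\eta}\subset\Omega_a$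 and $\overline B_{\ell,\eta}\cap\Gamma\ne\emptyset$. Interpolants. For a lattice function $y$, $\overline y$ is the continuous function on $\overline\Omega_*$ that is affine on each $T\in\mathcal T_T$, $T\subset\Omega_*$, and interpolates $\{y_\ell\}$ at the vertices. For each $B_{\ell,\eta}\in B_\Gamma$, $y^{\ell,\eta}$ is a piecewise polynomial function on $B_{\ell,\eta}$, associated with a decomposition $\mathcal T(B_{\ell,\eta})$ of $B_{\ell,\eta}$ into tetrahedra, such that: (i) $y^{\ell,\eta}\in C(\overline B_{\ell,\eta}\setminus\Gamma)$ (so $y^{\ell,\eta}$ may be discontinuous across $\Gamma$, and arbitrary hanging nodes on $\Gamma$ are allowed); (ii) if $T\in\mathcal T(B_{\ell,\eta})$ and $T\subset\Omega_*$, then $T$ is a tetrahedron resulting from the type A decomposition of a lattice cell; if $T\in\mathcal T(B_{\ell,\eta})$ and $T\subset\Omega_a$, then $T$ is a lattice tetrahedron; (iii) if $T\in\mathcal T(B_{\ell,\eta})$, $T\subset\Omega_a$, has a face on $\partial(B_{\ell,\eta}\cap\Omega_a)\setminus\Gamma$, then it allows for a compatible conforming decomposition with respect to the attached bond volumes (those sharing a face with $B_{\ell,\eta}$); if such an attached bond volume is included in $\Omega_a$, it is assumed to be type A decomposed into tetrahedra; (iv) for each $T\in\mathcal T(B_{\ell,\eta})$, $y^{\ell,\eta}$ is affine on $T$ and interpolates $\{y_\ell\}$ at the vertices of $T$. The decompositions are independent of $y$. Jumps and averages on $\Gamma$. For a possibly discontinuous function $w$, $[\![w\eta]\!]=(\nu_{\Omega_a}\cdot\eta)\,w^-+(\nu_{\Omega_*}\cdot\eta)\,w^+$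 and $\{\!\!\{w\}\!\!\}=\frac12(w^-+w^+)$, where $w^-$ and $w^+$ are the limits taken from $\Omega_a$ and from $\Omega_*$ respectively, and $\nu_{\Omega_a}$, $\nu_{\Omega_*}$ are the corresponding exterior unit normals, $\nu_{\Omega_a}=-\nu_{\Omega_*}$ on $\Gamma$. Energy. $\mathcal E^D_{\eta}\{y\}=E^a_{\Omega_a,\eta}\{y\}+E^{a,cb}_{\Omega_*,\eta}\{y\}+E^D_{\Gamma,\eta}\{y\}$, where $$E^a_{\Omega_a,\eta}\{y\}=\varepsilon^3\sum_{\ell\in\mathfrak L,\ \overline B_{\ell,\eta}\subset\Omega_a}\phi_\eta(\overline D_\eta y_\ell),\qquad E^{a,cb}_{\Omega_*,\eta}\{y\}=\int_{\Omega_*}\phi_\eta(\nabla\overline y(x)\eta)\,dx=\frac{\varepsilon^3}{6}\sum_{T\in\mathcal T_T,\ T\subset\Omega_*}\phi_\eta(\nabla\overline y|_T\,\eta),$$ $$E^D_{\Gamma,\eta}\{y\}=\sum_{\ell\in\mathfrak L,\ B_{\ell,\eta}\in B_\Gamma}\frac{1}{|\eta_1\eta_2\eta_3|}\Big[\int_{B_{\ell,\eta}}\chi_{\Omega_a}\,\phi_\eta(\nabla y^{\ell,\eta}\eta)\,dx-\int_{B_{\ell,\eta}\cap\Gamma}\phi_\eta'(\{\!\!\{\nabla y^{\ell,\eta}\eta\}\!\!\})\cdot[\![y^{\ell,\eta}\eta]\!]\,dS\Big],$$ with $\chi_{\Omega_a}$ the characteristic function of $\Omega_a$. Finally, $\langle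 D\mathcal E^D_{bv}(y),v\rangle=\frac{d}{dt}\mathcal E^D_{bv}\{y+tv\}\big|_{t=0}$, and $y_F$ is identified with its lattice values $\mathsf F x_\ell$.
   Formalization: In the interface energy, the surface integral over B∩Γ (B open) is taken over the part of Γ in the closure of B∩Ω_a, so faces of B lying on Γ count, with y^{ℓ,η} extended by ȳ outside B for the trace from Ω_*; with the open B ghost forces can remain. *)

(* Defs.v *)
From HB Require Import structures.
From mathcomp Require Import all_boot all_order all_algebra all_fingroup.
From mathcomp Require Import all_classical all_reals all_analysis.

Set Implicit Arguments.
Unset Strict Implicit.
Unset Printing Implicit Defensive.

Import Order.TTheory GRing.Theory Num.Theory.
Import numFieldNormedType.Exports.

Local Open Scope classical_set_scope.
Local Open Scope ring_scope.

(* Points and vectors of R^3 are columns, and a tetrahedron is the 3 x 4 matrix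
   whose columns are its vertices. The norm that the library puts on matrices
   is the sup norm (with the usual topology); Euclidean lengths are given by
   [enorm]. *)

Section Euclidean.
Variable R : realType.
Implicit Types (u v w x nu : 'cV[R]_3) (T : 'M[R]_(3, 4)) (j : 'I_4).

Definition dot u v : R := \sum_i u i 0 * v i 0.

Definition enorm u : R := Num.sqrt (dot u u).

Definition cross u v : 'cV[R]_3 :=
  \col_i (u (i + 1) 0 * v (i + 2%:R) 0 - u (i + 2%:R) 0 * v (i + 1) 0).

Definition gradient (f : 'cV[R]_3 -> R) x : 'cV[R]_3 :=
  \col_i 'D_(delta_mx i 0) f x.

Definition C1 (f : 'cV[R]_3 -> R) : Prop :=
  (forall x, differentiable f x) /\ continuous (gradient f).

Definition boundary (A : set 'cV[R]_3) : set 'cV[R]_3 :=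
  closure A `\` interior A.

Definition point3 (p : R * R * R) : 'cV[R]_3 :=
  \col_(i < 3) nth 0 [:: p.1.1; p.1.2; p.2] i.

Definition integral3 (D : set 'cV[R]_3) (f : 'cV[R]_3 -> R) : R :=
  \int[(@lebesgue_measure R \x @lebesgue_measure R \x @lebesgue_measure R)%E]_(p
    in point3 @^-1` D) f (point3 p).

Definition vertices T : set 'cV[R]_3 := range (fun i => col i T).

Definition nondegenerate_tetra T : Prop :=
  \rank (col_mx T (const_mx 1 : 'rV[R]_4)) = 4.

(* Open tetrahedron, in barycentric coordinates. *)
Definition tetra T : set 'cV[R]_3 :=
  [set x | exists a : 'cV[R]_4,
     [/\ forall i, 0 < a i 0, \sum_i a i 0 = 1 & x = T *m a]].

(* Closed face of T opposite to its vertex j. *)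
Definition face T j : set 'cV[R]_3 :=
  [set x | exists a : 'cV[R]_4,
     [/\ forall i, 0 <= a i 0, a j 0 = 0, \sum_i a i 0 = 1 & x = T *m a]].

Definition face_vertices T j : set 'cV[R]_3 :=
  [set x | exists2 i, i != j & x = col i T].

Definition same_face T j (T' : 'M[R]_(3, 4)) (j' : 'I_4) : Prop :=
  face_vertices T j = face_vertices T' j'.

(* The face opposite to j is x0 + s p + t q (s, t >= 0, s + t <= 1), where
   x0 = face_point j 0 0, p = face_edge j 1, q = face_edge j 2; its normal
   p x q has length |p x q| = dS / (ds dt). *)
Definition face_edge T j (i : 'I_3) : 'cV[R]_3 :=
  col (lift j i) T - col (lift j 0) T.

Definition face_point T j (st : R * R) : 'cV[R]_3 :=
  col (lift j 0) T + st.1 *: face_edge T j 1 + st.2 *: face_edge T j 2%:R.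

Definition face_cross T j : 'cV[R]_3 :=
  cross (face_edge T j 1) (face_edge T j 2%:R).

(* Unit normal pointing away from the vertex j. *)
Definition exterior_normal T j : 'cV[R]_3 :=
  let n := face_cross T j in
  - (Num.sg (dot n (col j T - col (lift j 0) T)) / enorm n) *: n.

(* Surface integral of g over the part of the face lying in S. *)
Definition face_integral T j (S : set 'cV[R]_3) (g : 'cV[R]_3 -> R) : R :=
  enorm (face_cross T j) *
  \int[(@lebesgue_measure R \x @lebesgue_measure R)%E]_(st in
      [set st : R * R | [/\ 0 <= st.1, 0 <= st.2, st.1 + st.2 <= 1
                          & S (face_point T j st)]])
    g (face_point T j st).

(* Limit of w at x taken from A. *)
Definition trace (A : set 'cV[R]_3) (w : 'cV[R]_3 -> 'cV[R]_3) x : 'cV[R]_3 :=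
  lim (w @ within A (nbhs x)).

(* D is a decomposition of the open set B into open tetrahedra; no conformity
   is required. *)
Definition tetra_decomposition (B : set 'cV[R]_3) (D : seq 'M[R]_(3, 4)) :
    Prop :=
  [/\ forall T, T \in D -> nondegenerate_tetra T,
      forall T T', T \in D -> T' \in D -> T != T' ->
        tetra T `&` tetra T' = set0
    & closure B = \bigcup_(T in [set T | T \in D]) closure (tetra T)].

End Euclidean.

Section Lattice.
Variables (R : realType) (k : nat).
Implicit Types (l eta : 'cV[int]_3) (s : 'S_3) (M : 'I_3 -> nat).

Definition toR (eta : 'cV[int]_3) : 'cV[R]_3 := map_mx intr eta.

Definition eps : R := k%:R^-1.

Definition node l : 'cV[R]_3 := eps *: toR l.

Definition Omega M : set 'cV[R]_3 :=
  [set x | forall i, 1 - (M i)%:R <= x i 0 <= (M i)%:R].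

Definition lattice M : set 'cV[int]_3 := [set l | Omega M (node l)].

(* Omega has side 2 M_i - 1 in direction i, that is k (2 M_i - 1) lattice
   steps; opposite faces of Omega are identified. *)
Definition period M (i : 'I_3) : int := k%:Z * ((M i)%:Z *+ 2 - 1).

(* Periodic lattice functions are given on all of Z^3. The average is taken
   over one period, so that identified boundary nodes are counted once. *)
Definition periodic_zero_average M (v : 'cV[int]_3 -> 'cV[R]_3) : Prop :=
  (forall l i, v (l + period M i *: delta_mx i 0) = v l) /\
  \sum_(l \in [set l : 'cV[int]_3 | forall i,
      k%:Z * (1 - (M i)%:Z) <= l i 0 < k%:Z * (M i)%:Z]) v l = 0.

Definition Dbar eta (y : 'cV[int]_3 -> 'cV[R]_3) l : 'cV[R]_3 :=
  eps^-1 *: (y (l + eta) - y l).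

Definition bond_volume l eta : set 'cV[R]_3 :=
  [set x | forall i, Num.min (node l i 0) (node (l + eta) i 0) < x i 0
                     < Num.max (node l i 0) (node (l + eta) i 0)].

(* The six type A tetrahedra are indexed by permutations: the vertices form a
   path from x_l to x_(l+eta) along edges of the bond volume, and the edge in
   direction i is the (s i)-th step of the path. *)
Definition typeA l eta s : 'M[R]_(3, 4) :=
  \matrix_(i < 3, j < 4)
    (eps * (l i 0 + (if (s i < j)%N then eta i 0 else 0))%:~R).

Definition cell_tetra (c : 'cV[int]_3 * 'S_3) : 'M[R]_(3, 4) :=
  typeA c.1 (const_mx 1) c.2.

Definition lattice_tetra (T : 'M[R]_(3, 4)) : Prop :=
  forall i, exists l, col i T = node l.

Definition is_typeA l eta (D : seq 'M[R]_(3, 4)) : Prop :=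
  (forall T, T \in D -> exists s, vertices T = vertices (typeA l eta s)) /\
  (forall s, exists2 T, T \in D & vertices T = vertices (typeA l eta s)).

(* Bond volumes with the same eta sharing a two-dimensional face. *)
Definition attached eta l l' : Prop :=
  exists i, l' = l + eta i 0 *: delta_mx i 0 \/
            l' = l - eta i 0 *: delta_mx i 0.

Definition affine_interpolant (y : 'cV[int]_3 -> 'cV[R]_3)
    (T : 'M[R]_(3, 4)) (w : 'cV[R]_3 -> 'cV[R]_3) : Prop :=
  exists (G : 'M[R]_3) (c : 'cV[R]_3),
    (forall x, tetra T x -> w x = G *m x + c) /\
    (forall i l, col i T = node l -> G *m node l + c = y l).

End Lattice.

Arguments toR : clear implicits.
Arguments eps : clear implicits.
Arguments node : clear implicits.
Arguments Omega : clear implicits.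
Arguments lattice : clear implicits.
Arguments bond_volume : clear implicits.
Arguments typeA : clear implicits.
Arguments cell_tetra : clear implicits.

Section Coupling.
Variables (R : realType) (k : nat) (M : 'I_3 -> nat).
(* Oa : atomistic region; Os : atomistic Cauchy-Born region *)
Variables Oa Os : set 'cV[R]_3.
Implicit Types (l eta : 'cV[int]_3) (y : 'cV[int]_3 -> 'cV[R]_3).

Definition Gamma : set 'cV[R]_3 := closure Oa `&` closure Os.

Definition tetra_region (A : set 'cV[R]_3) : Prop :=
  exists C : set ('cV[int]_3 * 'S_3),
    (forall c, C c -> tetra (cell_tetra R k c) `<=` Omega R M) /\
    A = interior (closure (\bigcup_(c in C) tetra (cell_tetra R k c))).

Definition regions : Prop :=
  [/\ tetra_region Oa /\ tetra_region Os,
      connected Oa /\ connected Os,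
      Oa `&` Os = set0,
      Omega R M = closure Oa `|` closure Os
    & closure Oa `<=` interior (Omega R M)].

Definition distant_from_boundary (RI : set 'cV[int]_3) : Prop :=
  forall eta l, RI eta ->
    closure (bond_volume R k l eta) `&` closure Oa !=set0 ->
    closure (bond_volume R k l eta) `<=` Omega R M.

Definition in_BGamma l eta : Prop :=
  bond_volume R k l eta `&` Gamma !=set0 \/
  (bond_volume R k l eta `<=` Oa /\
   closure (bond_volume R k l eta) `&` Gamma !=set0).

(* ybar y is the interpolant of y on the closure of Os. *)
Definition cb_interpolant
    (ybar : ('cV[int]_3 -> 'cV[R]_3) -> 'cV[R]_3 -> 'cV[R]_3) : Prop :=
  forall y, {within closure Os, continuous (ybar y)} /\
    forall c, tetra (cell_tetra R k c) `<=` Os ->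
      affine_interpolant k y (cell_tetra R k c) (ybar y).

Variables (TB : 'cV[int]_3 -> 'cV[int]_3 -> seq 'M[R]_(3, 4))
  (yB : ('cV[int]_3 -> 'cV[R]_3) -> 'cV[int]_3 -> 'cV[int]_3 ->
        'cV[R]_3 -> 'cV[R]_3).

Definition decomposition_kinds l eta : Prop :=
  forall T, T \in TB l eta ->
    [/\ tetra T `<=` Os \/ tetra T `<=` Oa,
        tetra T `<=` Os -> exists c, vertices T = vertices (cell_tetra R k c)
      & tetra T `<=` Oa -> lattice_tetra k T].

Definition decomposition_compatible l eta : Prop :=
  forall T j, T \in TB l eta -> tetra T `<=` Oa ->
    face T j `<=` boundary (bond_volume R k l eta `&` Oa) ->
    ~ (face T j `<=` Gamma) ->
    forall l', attached eta l l' ->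
      face T j `<=` closure (bond_volume R k l' eta) ->
      (bond_volume R k l' eta `<=` Oa ->
         (exists s j', same_face T j (typeA R k l' eta s) j') /\
         (in_BGamma l' eta -> is_typeA k l' eta (TB l' eta))) /\
      (~ (bond_volume R k l' eta `<=` Oa) ->
         exists T' j', T' \in TB l' eta /\ same_face T j T' j').

(* yB y l eta is the interpolant y^(l,eta) on the bond volume B_(l,eta), with
   decomposition TB l eta, which does not depend on y. *)
Definition bond_interpolants (RI : set 'cV[int]_3) : Prop :=
  forall l eta, RI eta -> in_BGamma l eta ->
    [/\ tetra_decomposition (bond_volume R k l eta) (TB l eta),
        forall y, {within closure (bond_volume R k l eta) `\` Gamma,
                     continuous (yB y l eta)},
        decomposition_kinds l eta,
        decomposition_compatible l eta
      & forall y T, T \in TB l eta -> affine_interpolant k y T (yB y l eta)].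

(* [[w eta]] and {{w}}; nu is the exterior unit normal to Oa. *)
Definition jump (w : 'cV[R]_3 -> 'cV[R]_3) (nu : 'cV[R]_3) eta
    (x : 'cV[R]_3) : 'cV[R]_3 :=
  dot nu (toR R eta) *: trace Oa w x + dot (- nu) (toR R eta) *: trace Os w x.

Definition mean (w : 'cV[R]_3 -> 'cV[R]_3) (x : 'cV[R]_3) : 'cV[R]_3 :=
  2%:R^-1 *: (trace Oa w x + trace Os w x).

(* Integral over the part of Gamma lying in S. Gamma is the union of the faces,
   contained in Gamma, of the cell tetrahedra in Oa; each such triangle is the
   face of exactly one of these tetrahedra, and nu is its exterior normal. *)
Definition Gamma_integral (S : set 'cV[R]_3)
    (g : 'cV[R]_3 -> 'cV[R]_3 -> R) : R :=
  \sum_(f \in [set f : 'cV[int]_3 * 'S_3 * 'I_4 |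
      tetra (cell_tetra R k f.1) `<=` Oa /\
      face (cell_tetra R k f.1) f.2 `<=` Gamma])
    face_integral (cell_tetra R k f.1) f.2 S
      (g (exterior_normal (cell_tetra R k f.1) f.2)).

Variable phi : 'cV[int]_3 -> 'cV[R]_3 -> R.
Variable ybar : ('cV[int]_3 -> 'cV[R]_3) -> 'cV[R]_3 -> 'cV[R]_3.

Definition energy_a eta y : R :=
  eps R k ^+ 3 *
  \sum_(l \in [set l | lattice R k M l /\
                       closure (bond_volume R k l eta) `<=` Oa])
    phi eta (Dbar k eta y l).

(* For a map w that is affine near x, 'D_eta w x is (grad w)(x) eta; where w is
   not differentiable its value is irrelevant, being on a null set. *)
Definition energy_acb eta y : R :=
  integral3 Os (fun x => phi eta ('D_(toR R eta) (ybar y) x)).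

(* y^(l,eta) is extended outside B_(l,eta) by ybar. Inside B_(l,eta) the two
   coincide on Os; the extension provides the limit from Os at the points of
   Gamma that lie on a face of B_(l,eta), where B_(l,eta) is on the Oa side. *)
Definition bond_function l eta y : 'cV[R]_3 -> 'cV[R]_3 :=
  patch (ybar y) (bond_volume R k l eta) (yB y l eta).

(* The surface integral is over the Gamma part of the boundary of
   B_(l,eta) `&` Oa: besides B_(l,eta) `&` Gamma, it contains the faces of
   B_(l,eta) that lie in Gamma with B_(l,eta) on the Oa side. With the open
   B_(l,eta) alone, coordinate-plane pieces of Gamma would not be counted
   |eta_1 eta_2 eta_3| times, and ghost forces would remain. *)
Definition energy_Gamma_bond l eta y : R :=
  integral3 (bond_volume R k l eta `&` Oa)
    (fun x => phi eta ('D_(toR R eta) (yB y l eta) x)) -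
  Gamma_integral (closure (bond_volume R k l eta `&` Oa)) (fun nu x =>
    dot (gradient (phi eta)
           (mean (fun z => 'D_(toR R eta) (bond_function l eta y) z) x))
        (jump (bond_function l eta y) nu eta x)).

Definition energy_Gamma eta y : R :=
  \sum_(l \in [set l | lattice R k M l /\ in_BGamma l eta])
    (`|\prod_i toR R eta i 0|^-1 * energy_Gamma_bond l eta y).

Definition energy_bv (RI : set 'cV[int]_3) y : R :=
  \sum_(eta \in RI)
    (energy_a eta y + energy_acb eta y + energy_Gamma eta y).

End Coupling.

(* Main.v *)
Require Import Defs.
From HB Require Import structures.
From mathcomp Require Import all_boot all_order all_algebra all_fingroup.
From mathcomp Require Import all_classical all_reals all_analysis.
From mathcomp Require Import measurable_realfun.
From mathcomp Require Import ring lra zify.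

Set Implicit Arguments.
Unset Strict Implicit.
Unset Printing Implicit Defensive.

Import Order.TTheory GRing.Theory Num.Theory.
Import numFieldNormedType.Exports.

Local Open Scope classical_set_scope.
Local Open Scope ring_scope.

(** At the homogeneous deformation the argument of the potential of [eta] is
    [F eta] in every term of the energy. Each first order term is therefore
    the gradient of the potential at [F eta], paired with a vector that is
    linear in the perturbation [v], and the claim is that for each [eta] these
    vectors add up to zero ([total_balance]). Three facts give this.

    The bond volumes of [eta] that are congruent modulo [eta] tile space. One
    such residue class, with its type A or given decompositions, therefore
    decomposes [Oa] into tetrahedra, and the interpolants of [v] form a
    continuous piecewise affine function on [Oa]: across the facets of the bond
    volumes this is what the compatibility of the decompositions provides
    ([class_affine_family]). By the divergence theorem the total gradient along
    [eta] over the class is the flux of this function through the interface.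

    In the surface energy the jump is of first order in [v], so its derivative
    is the flux through the interface of the difference between that function
    and the interpolant on the lattice cells. Subtracting it leaves the flux of
    the cell interpolant, hence the total gradient over the cells of [Oa]
    ([class_balance]). The number of residue classes is the product of the
    absolute values of the components of [eta], the factor by which the bond
    volume terms are divided.

    Thus the atomistic region contributes as if it were discretized by the
    lattice cells, and together with the cells of [Os] these fill one period of
    [v], over which the gradients of the interpolant cancel
    ([periodic_gradients]).

    The decompositions may have hanging nodes on the interface and are known
    only through the sets covered by their tetrahedra. The divergence theorem is
    therefore proved by integrating over parallel lines: along a line avoiding
    the intersections of the finitely many planes in play, the fundamental
    theorem of calculus holds chord by chord, and at each crossing the one-sided
    neighbourhoods of the point decide which tetrahedra are touched
    ([point_flux], [line_flux], [divergence_theorem]). The same generic points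
    are those at which traces, jumps and derivatives are evaluated
    ([surface_traces]). *)

(** * Lebesgue measure of affine images *)

Notation leb1 R := (@lebesgue_measure R).
Notation leb2 R := (@lebesgue_measure R \x @lebesgue_measure R)%E.
Notation leb3 R :=
  (@lebesgue_measure R \x @lebesgue_measure R \x @lebesgue_measure R)%E.

Section AffineMeasure.
Variable R : realType.
Notation T1 := (measurableTypeR R).
Notation T2 := (T1 * T1)%type.
Notation T3 := (T1 * T1 * T1)%type.

(** Lets the slices be taken along either factor. *)
Lemma product_measure12 d1 d2 (U1 : measurableType d1) (U2 : measurableType d2)
    (m1 : {sigma_finite_measure set U1 -> \bar R})
    (m2 : {sigma_finite_measure set U2 -> \bar R}) A : measurable A ->
  (m1 \x m2)%E A = (m1 \x^ m2)%E A.
Proof.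
move=> mA; have := indic_fubini_tonelli m1 m2 mA.
by rewrite indic_fubini_tonelli_FE // indic_fubini_tonelli_GE.
Qed.

Lemma measurable_affine1 (a b : R) :
  measurable_fun [set: T1] (fun x : T1 => a * x + b : T1).
Proof. by apply: measurable_funD => //; apply: measurable_funM. Qed.

Lemma leb1_affine (a b : R) (A : set T1) : a != 0 -> measurable A ->
  leb1 R ((fun x => a * x + b) @^-1` A) = (`|a|^-1%:E * leb1 R A)%E.
Proof.
move=> a0 mA.
have na : (0 <= `|a|)%R by [].
have pa : (0 < `|a|)%R by rewrite normr_gt0.
suff -> : leb1 R A = mscale (NngNum na)
    (pushforward (leb1 R) (fun x : T1 => a * x + b : T1)) A.
- exact: measurable_affine1.
- by move=> ?; rewrite /mscale /= muleA -EFinM mulVf ?normr_eq0 // mul1e.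
move=> mf; apply: lebesgue_measure_unique => //= _ [[c d]] _ <-.
rewrite /mscale /= -[pushforward _ _ _]/(leb1 R ((fun x : T1 => a * x + b) @^-1` `]c, d]%classic)).
have [a_gt0|a_lt0|/eqP] := ltgtP 0 a; last by rewrite eq_sym (negbTE a0).
  rewrite (_ : _ @^-1` _ = `](c - b) / a, (d - b) / a]%classic); last first.
    by apply/seteqP; split=> x /=;
      rewrite !in_itv /= ltr_pdivrMr // ler_pdivlMr // ltrBlDr lerBrDr mulrC.
  rewrite !lebesgue_measure_itv /= !lte_fin ltr_pM2r ?invr_gt0 // ltrD2r.
  case: ifP => // _; rewrite ?mule0 // -!EFinB -EFinM gtr0_norm //.
  by congr (_%:E); field.
rewrite (_ : _ @^-1` _ = `[(d - b) / a, (c - b) / a[%classic); last first.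
  by apply/seteqP; split=> x /=;
    rewrite !in_itv /= ltr_ndivlMr // ler_ndivrMr // ltrBlDr lerBrDr mulrC
      andbC.
rewrite !lebesgue_measure_itv /= !lte_fin ltr_nM2r ?invr_lt0 // ltrD2r.
case: ifP => // _; rewrite ?mule0 // -!EFinB -EFinM ltr0_norm //.
by congr (_%:E); field.
Qed.

Lemma measurable_lin2 (a b e : R) :
  measurable_fun [set: T2] (fun z : T2 => a * z.1 + b * z.2 + e : T1).
Proof.
apply: measurable_funD => //; apply: measurable_funD => //;
  apply: measurable_funM => //.
Qed.

Lemma measurable_affine2 (a b c d e f : R) :
  measurable_fun [set: T2]
    (fun z : T2 => (a * z.1 + b * z.2 + e, c * z.1 + d * z.2 + f) : T2).
Proof. by apply/measurable_fun_pairP; split; exact: measurable_lin2. Qed.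

Lemma measurable_preimage d1 d2 (U1 : measurableType d1) (U2 : measurableType d2)
    (f : U1 -> U2) (A : set U2) : measurable_fun setT f -> measurable A ->
  measurable (f @^-1` A).
Proof. by move=> mf mA; rewrite -[_ @^-1` _]setTI; exact: mf. Qed.

Lemma leb2_shear1 (a b e : R) (A : set T2) : a != 0 -> measurable A ->
  leb2 R ((fun z : T2 => (a * z.1 + b * z.2 + e, z.2) : T2) @^-1` A)
  = (`|a|^-1%:E * leb2 R A)%E.
Proof.
move=> a0 mA; have mf := measurable_affine2 a b 0 1 e 0.
have mpre : measurable
    ((fun z : T2 => (a * z.1 + b * z.2 + e, z.2) : T2) @^-1` A).
  apply: measurable_preimage mA.
  by apply/measurable_fun_pairP; split; [exact: measurable_lin2|exact: measurable_snd].
rewrite !product_measure12 // /product_measure2 /=.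
rewrite -ge0_integralZl //; last exact: measurable_fun_ysection.
apply: eq_integral => t _ /=.
rewrite -(@leb1_affine a (b * t + e)) //; last exact: measurable_ysection.
congr (leb1 R _); apply/seteqP; split => s;
  by rewrite /ysection /= !inE /= !addrA.
Qed.

Lemma leb2_swap (A : set T2) : measurable A ->
  leb2 R ((fun z : T2 => (z.2, z.1) : T2) @^-1` A) = leb2 R A.
Proof.
move=> mA; have mpre : measurable ((fun z : T2 => (z.2, z.1) : T2) @^-1` A).
  apply: measurable_preimage mA; exact: measurable_swap.
by rewrite [RHS]product_measure12.
Qed.

Lemma leb2_shear2 (c d f : R) (A : set T2) : d != 0 -> measurable A ->
  leb2 R ((fun z : T2 => (z.1, c * z.1 + d * z.2 + f) : T2) @^-1` A)
  = (`|d|^-1%:E * leb2 R A)%E.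
Proof.
move=> d0 mA; rewrite /product_measure1 /=.
rewrite -ge0_integralZl //; last exact: measurable_fun_xsection.
apply: eq_integral => t _ /=.
rewrite -(@leb1_affine d (c * t + f)) //; last exact: measurable_xsection.
have E s : c * t + d * s + f = d * s + (c * t + f) by ring.
congr (leb1 R _); apply/seteqP; split => s; by rewrite /xsection /= !inE /= E.
Qed.

(** The map is a product of two shears, after an exchange of the coordinates
    if the first pivot vanishes. *)
Lemma leb2_affine (a b c d e f : R) (A : set T2) :
  a * d - b * c != 0 -> measurable A ->
  leb2 R ((fun z : T2 => (a * z.1 + b * z.2 + e, c * z.1 + d * z.2 + f) : T2)
     @^-1` A) = (`|a * d - b * c|^-1%:E * leb2 R A)%E.
Proof.
wlog a0 : a b c d e f A / a != 0 => [hw D0 mA|D0 mA].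
  have [a0|] := eqVneq a 0; last by move=> a0; exact: hw.
  have b0 : b != 0 by apply: contra_neq D0 => ->; rewrite a0 !mul0r subr0.
  have -> : `|a * d - b * c| = `|b * c - a * d| by rewrite distrC.
  rewrite -(hw b a d c e f A b0 _ mA); last by rewrite -opprB oppr_eq0.
  rewrite -leb2_swap; last by apply: measurable_preimage mA; exact: measurable_affine2.
  congr (leb2 R _); apply/seteqP; split => z /=;
    by rewrite (addrC (b * _)) (addrC (d * _)).
pose D := a * d - b * c.
pose B := (fun z : T2 => (z.1, c / a * z.1 + D / a * z.2 + (f - c / a * e)) : T2)
  @^-1` A.
have mB : measurable B.
  apply: measurable_preimage mA.
  by apply/measurable_fun_pairP; split; [exact: measurable_fst|exact: measurable_lin2].
have Da0 : D / a != 0 by rewrite mulf_neq0 ?invr_eq0.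
transitivity (leb2 R ((fun z : T2 => (a * z.1 + b * z.2 + e, z.2) : T2) @^-1` B)).
  congr (leb2 R _); apply/seteqP; split => z /=; rewrite /B /=.
  - by move=> H; have -> // : c / a * (a * z.1 + b * z.2 + e) + D / a * z.2 + (f - c / a * e)
      = c * z.1 + d * z.2 + f by rewrite /D; field.
  - by have -> // : c / a * (a * z.1 + b * z.2 + e) + D / a * z.2 + (f - c / a * e)
      = c * z.1 + d * z.2 + f by rewrite /D; field.
rewrite leb2_shear1 // leb2_shear2 // muleA -EFinM; congr (_%:E * _)%E.
by rewrite normrM normfV -/D; field; rewrite !normr_eq0 D0.
Qed.

Lemma leb2_sigma_finite : sigma_finite setT (leb2 R).
Proof.
have /sigma_finiteP[F [TF ndF Foo]] := sigma_finiteT (leb1 R).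
exists (fun n => F n `*` F n).
  rewrite -setXTT TF predeqE => -[x y]; split.
    move=> [/= [n _ Fnx] [k _ Gky]]; exists (maxn n k) => //; split.
    - by move: x Fnx; exact/subsetPset/ndF/leq_maxl.
    - by move: y Gky; exact/subsetPset/ndF/leq_maxr.
  by move=> [n _ []/= ? ?]; split; exists n.
move=> k; have [? ?] := Foo k.
split; first exact: measurableX.
by rewrite product_measure1E// lte_mul_pinfty// ge0_fin_numE.
Qed.

(** The product of two Lebesgue measures as a sigma-finite measure, so that it
    can be exchanged with a third one. *)
Definition leb2_sf : {sigma_finite_measure set T2 -> \bar R} :=
  HB.pack (leb2 R) (Measure_isSigmaFinite.Build _ _ _ (leb2 R) leb2_sigma_finite).

Lemma leb3E A : leb3 R A = (\int[leb2 R]_z leb1 R (xsection A z))%E.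
Proof. by []. Qed.

Lemma leb3E2 (A : set T3) : measurable A ->
  leb3 R A = (\int[leb1 R]_t leb2 R (ysection A t))%E.
Proof. exact: (@product_measure12 _ _ T2 T1 leb2_sf (leb1 R)). Qed.

Lemma measurable_shear3 (u v : R) : measurable_fun setT
  (fun z : T3 => (z.1.1 + u * z.2, z.1.2 + v * z.2, z.2) : T3).
Proof.
apply/measurable_fun_pairP; split; last exact: measurable_snd.
apply/measurable_fun_pairP; split => /=; apply: measurable_funD;
  by [apply: measurableT_comp => //; apply: measurable_fst| apply: measurable_funM].
Qed.

Lemma leb3_shear (u v : R) (A : set T3) : measurable A ->
  leb3 R ((fun z : T3 => (z.1.1 + u * z.2, z.1.2 + v * z.2, z.2) : T3) @^-1` A)
  = leb3 R A.
Proof.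
move=> mA.
have mf := measurable_shear3 u v.
have mpre := measurable_preimage mf mA.
rewrite (leb3E2 mpre) (leb3E2 mA); apply: eq_integral => t _.
have := @leb2_affine 1 0 0 1 (u * t) (v * t) (ysection A t).
rewrite mul1r mul0r subr0 oner_eq0 normr1 invr1 mul1e => <- //; last exact: measurable_ysection.
congr (leb2 R _); apply/seteqP; split => s;
  by rewrite /ysection /= !inE /= !mul1r !mul0r addr0 add0r.
Qed.

Lemma leb3_trans (a b c : R) (A : set T3) : measurable A ->
  leb3 R ((fun z : T3 => (z.1.1 + a, z.1.2 + b, z.2 + c) : T3) @^-1` A)
  = leb3 R A.
Proof.
move=> mA.
have mf0 (p : R) : measurable_fun setT (fun z : T3 => (z.1, z.2 + p) : T3).
  apply/measurable_fun_pairP; split; first exact: measurable_fst.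
  by apply: measurable_funD.
have mf1 : measurable_fun setT (fun z : T3 => (z.1.1 + a, z.1.2 + b, z.2) : T3).
  apply/measurable_fun_pairP; split; last exact: measurable_snd.
  apply/measurable_fun_pairP; split => /=; apply: measurable_funD => //;
    by [apply: measurableT_comp => //; apply: measurable_fst|apply: measurableT_comp => //; apply: measurable_fst].
pose B := (fun z : T3 => (z.1, z.2 + c) : T3) @^-1` A.
have mB : measurable B by apply: measurable_preimage mA.
transitivity (leb3 R B).
  rewrite -[_ @^-1` _]/((fun z : T3 => (z.1.1 + a, z.1.2 + b, z.2) : T3) @^-1` B).
  have mpre := measurable_preimage mf1 mB.
  rewrite (leb3E2 mpre) (leb3E2 mB); apply: eq_integral => t _.
  have := @leb2_affine 1 0 0 1 a b (ysection B t).
  rewrite mul1r mul0r subr0 oner_eq0 normr1 invr1 mul1e => <- //; last exact: measurable_ysection.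
  congr (leb2 R _); apply/seteqP; split => s;
    by rewrite /ysection /= !inE /= !mul1r !mul0r addr0 add0r.
rewrite !leb3E; apply: eq_integral => t _.
have := @leb1_affine 1 c (xsection A t).
rewrite oner_eq0 normr1 invr1 mul1e => <- //; last exact: measurable_xsection.
congr (leb1 R _); apply/seteqP; split => s;
  by rewrite /xsection /B /= !inE /= mul1r.
Qed.

Lemma leb2_line0 (a b c : R) : (a != 0) || (b != 0) ->
  leb2 R [set z : T2 | a * z.1 + b * z.2 + c = 0] = 0%E.
Proof.
have main a' b' c' : b' != 0 -> leb2 R [set z : T2 | a' * z.1 + b' * z.2 + c' = 0] = 0%E.
  move=> b0; rewrite /product_measure1 /=; apply: integral0_eq => p _ /=.
  rewrite (_ : xsection _ _ = [set - (a' * p + c') / b']) ?lebesgue_measure_set1 //.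
  apply/seteqP; split => q; rewrite /xsection /= inE /=.
    move=> H; apply: (mulIf b0); rewrite mulfVK //.
    by apply/eqP; rewrite -subr_eq0 -H; apply/eqP; ring.
  by move=> ->; field.
case/orP => h; last exact: main.
rewrite -leb2_swap; first last.
  rewrite (_ : [set z | _] = (fun z : T2 => a * z.1 + b * z.2 + c : T1) @^-1` [set 0]) //.
  by apply: measurable_preimage; [exact: measurable_lin2|exact: measurable_set1].
rewrite -[RHS](main b a c h); congr (leb2 R _).
by apply/seteqP; split => z /=; rewrite (addrC (a * _)).
Qed.

Lemma measurable_lin3 (a b c d : R) :
  measurable_fun [set: T3] (fun z : T3 => a * z.1.1 + b * z.1.2 + c * z.2 + d : T1).
Proof.
have := @measurable_funD _ _ R setT
  (fun z : T3 => a * z.1.1 + b * z.1.2 : T1) (fun z : T3 => c * z.2 + d : T1).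
rewrite (_ : _ \+ _ = (fun z : T3 => a * z.1.1 + b * z.1.2 + c * z.2 + d)); last first.
  by apply/funext => z /=; rewrite addrA.
apply.
  have := measurableT_comp (@measurable_lin2 a b 0) (@measurable_fst _ _ T2 T1).
  by under eq_fun do rewrite addr0.
by apply: measurable_funD => //; apply: measurable_funM.
Qed.

Lemma leb3_plane0 (a b c d : R) : [|| a != 0, b != 0 | c != 0] ->
  leb3 R [set z : T3 | a * z.1.1 + b * z.1.2 + c * z.2 + d = 0] = 0%E.
Proof.
have [c0|c0 _] := eqVneq c 0; last first.
  rewrite leb3E; apply: integral0_eq => p _.
  rewrite (_ : xsection _ _ = [set - (a * p.1 + b * p.2 + d) / c]) ?lebesgue_measure_set1 //.
  apply/seteqP; split => q; rewrite /xsection /= inE /=.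
    move=> H; apply: (mulIf c0); rewrite mulfVK //.
    by apply/eqP; rewrite -subr_eq0 -H; apply/eqP; ring.
  by move=> ->; field.
rewrite orbF => ab0.
rewrite leb3E2; last first.
  rewrite (_ : [set z | _] = (fun z : T3 => a * z.1.1 + b * z.1.2 + c * z.2 + d : T1) @^-1` [set 0]) //.
  by apply: measurable_preimage; [exact: measurable_lin3|exact: measurable_set1].
apply: integral0_eq => t _.
rewrite -[RHS](@leb2_line0 a b d) //; congr (leb2 R _).
by apply/seteqP; split => z; rewrite /ysection /= !inE /= c0 mul0r addr0.
Qed.

(** The shear along [(u, v, 1)] turns vertical lines into lines of that
    direction, to which Fubini applies. *)
Lemma leb3_lines (u v : R) (A : set T3) : measurable A ->
  leb3 R A = (\int[leb2 R]_z leb1 R [set t | A ((z.1 + u * t)%R, (z.2 + v * t)%R, t)])%E.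
Proof.
move=> mA; rewrite -(leb3_shear u v mA) leb3E.
apply: eq_integral => z _; congr (leb1 R _).
by apply/seteqP; split => t; rewrite /xsection /= inE.
Qed.

End AffineMeasure.

(** * Integrals up to null sets *)

Section NullExt.
Context d (T : measurableType d) (R : realType) (mu : {measure set T -> \bar R}).
Import HBNNSimple.
Local Open Scope ereal_scope.

(** The integral is a supremum over simple functions below [F], and each of
    these ignores [N]; so the identity holds for arbitrary [F]. *)
Lemma ge0_integral_off_null (N : set T) (F : T -> \bar R) :
  measurable N -> mu N = 0 -> (forall x, 0 <= F x) ->
  \int[mu]_x F x = \int[mu]_(x in ~` N) F x.
Proof.
move=> mN N0 F0.
rewrite [RHS]integral_mkcond !ge0_integralTE //; last first.
  by move=> x; rewrite patchE; case: ifP.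
apply/eqP; rewrite eq_le; apply/andP; split.
- apply/ge_ereal_sup => _ [h /= hF <-].
  have mNC := measurableC mN.
  rewrite -integralT_nnsfun (ge0_negligible_integral mN) //; first last.
  + by move=> x _; rewrite lee_fin.
  + exact/measurable_EFinP.
  rewrite setTD integral_nnsfun //; apply: ereal_sup_ubound => /=.
  exists (proj_nnsfun h mNC) => [x|].
    have -> : proj_nnsfun h mNC x = (h x * \1_(~` N) x)%R by [].
    rewrite patchE indicE; case: ifPn => xN; last by rewrite mulr0.
    by rewrite mulr1; exact: hF.
  by congr sintegral; apply/funext => x; rewrite mrestrict /= .
- apply/ge_ereal_sup => _ [h /= hF <-]; apply: ereal_sup_ubound => /=.
  exists h => // x; apply: le_trans (hF x) _.
  by rewrite patchE; case: ifP.
Qed.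

Lemma integral_off_null (N : set T) (F : T -> \bar R) :
  measurable N -> mu N = 0 -> \int[mu]_x F x = \int[mu]_(x in ~` N) F x.
Proof.
move=> mN N0; rewrite integralE [RHS]integralE.
by congr (_ - _); apply: ge0_integral_off_null.
Qed.

(** Derivatives and traces of the interpolants are only computed at generic
    points, so the integrands of the energy are known off a null set. *)
Lemma Rintegral_null_ext (N D : set T) (f g : T -> R) :
  measurable N -> mu N = 0 -> (forall x, ~ N x -> (f \_ D) x = g x) ->
  (\int[mu]_(x in D) f x = \int[mu]_x g x)%R.
Proof.
move=> mN N0 fg; rewrite Rintegral_mkcond /Rintegral; congr fine.
rewrite (integral_off_null _ mN N0) [RHS](integral_off_null _ mN N0).
by apply: eq_integral => x; rewrite inE /= => Nx; rewrite fg.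
Qed.

Lemma Rintegral_sum (I : eqType) (r : seq I) (c : I -> R) (f : I -> T -> R) :
  (forall i, i \in r -> mu.-integrable setT (EFin \o f i)) ->
  (\int[mu]_x (\sum_(i <- r) c i * f i x) = \sum_(i <- r) c i * \int[mu]_x f i x)%R
  /\ mu.-integrable setT (EFin \o (fun x => \sum_(i <- r) c i * f i x)%R).
Proof.
elim: r => [|i r IH] fi.
  under [X in EFin \o X]eq_fun do rewrite big_nil.
  rewrite big_nil; split; last exact: integrable0.
  rewrite /Rintegral integral0_eq // => x _.
  by rewrite big_nil.
have [IH1 IH2] := IH (fun j jr => fi j (mem_behead (s := i :: r) jr)).
have Ii := fi i (mem_head _ _).
have Zi : mu.-integrable setT (EFin \o (fun x => c i * f i x)%R).
  have : mu.-integrable setT (fun x => (c i)%:E * (f i x)%:E).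
    exact: integrableZl.
  by [].
have E : (fun x => \sum_(j <- i :: r) c j * f j x)%R =
  (fun x => c i * f i x + \sum_(j <- r) c j * f j x)%R.
  by apply/funext => x; rewrite big_cons.
split; last by rewrite E; have := integrableD measurableT Zi IH2.
by rewrite E big_cons RintegralD // RintegralZl // IH1.
Qed.

End NullExt.

Section Int2.
Variable R : realType.
Notation T1 := (measurableTypeR R).
Notation T2 := (T1 * T1)%type.
Notation T3 := (T1 * T1 * T1)%type.

Lemma leb2_integrable_bounded (f : T2 -> R) (K C : R) :
  measurable_fun setT f -> (forall z, `|f z| <= C) ->
  (forall z, f z != 0 -> `|z.1| <= K /\ `|z.2| <= K) ->
  (leb2 R).-integrable setT (EFin \o f).
Proof.
move=> mf fC f0.
pose D : set T2 := (`[- K, K]%classic : set T1) `*` (`[- K, K]%classic : set T1).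
have mD : measurable D by apply: measurableX; exact: measurable_itv.
have -> : EFin \o f = (EFin \o f) \_ D.
  apply/funext => z; rewrite patchE; case: ifPn => // zD /=.
  have [->//|/f0 [z1 z2]] := eqVneq (f z) 0.
  by case/negP: zD; rewrite inE /D /=; split; rewrite /= in_itv /= -ler_norml.
apply/(integrable_mkcond _ mD).
apply: measurable_bounded_integrable => //.
- rewrite [X in (X < _)%E]product_measure1E //; try exact: measurable_itv.
  have F : (leb1 R (`[(- K)%R, K]%classic) < +oo)%E.
    by rewrite lebesgue_measure_itv /=; case: ifP => _; rewrite ?ltry // -EFinB ltry.
  by apply: lte_mul_pinfty => //; rewrite ge0_fin_numE //; exact: F.
- exact: measurable_funTS.
- exists C; split; first exact: num_real.
  by move=> M CM z _ /=; exact: le_trans (fC z) (ltW CM).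
Qed.

Lemma ge0_integral2_affine (a b c d e f : R) (g : T2 -> \bar R) :
  a * d - b * c != 0 -> measurable_fun setT g -> (forall z, 0 <= g z)%E ->
  (\int[leb2 R]_z g ((a * z.1 + b * z.2 + e)%R, (c * z.1 + d * z.2 + f)%R) =
   `|a * d - b * c|^-1%:E * \int[leb2 R]_z g z)%E.
Proof.
move=> D0 mg g0.
have nD : (0 <= `|a * d - b * c|^-1) by rewrite invr_ge0.
pose A := (fun z : T2 => (a * z.1 + b * z.2 + e, c * z.1 + d * z.2 + f) : T2).
have mA : measurable_fun setT A := measurable_affine2 a b c d e f.
have := ge0_integral_pushforward mA (leb2 R) (D := setT) measurableT mg (fun z _ => g0 z).
rewrite preimage_setT => <-.
have -> : (\int[pushforward (leb2 R) A]_z g z = \int[mscale (NngNum nD) (leb2 R)]_z g z)%E.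
  apply: eq_measure_integral => // B mB _.
  exact: leb2_affine.
by rewrite ge0_integral_mscale.
Qed.

Lemma Rintegral2_affine (a b c d e f : R) (g : T2 -> R) :
  a * d - b * c != 0 -> (leb2 R).-integrable setT (EFin \o g) ->
  \int[leb2 R]_z g (a * z.1 + b * z.2 + e, c * z.1 + d * z.2 + f) =
   `|a * d - b * c|^-1 * \int[leb2 R]_z g z.
Proof.
move=> D0 ig; have mg := measurable_int _ ig.
have [pf nf] : ((\int[leb2 R]_z (EFin \o g)^\+ z) \is a fin_num /\
  (\int[leb2 R]_z (EFin \o g)^\- z) \is a fin_num)%E.
  split; apply: integrable_fin_num => //; [exact: integrable_funepos|exact: integrable_funeneg].
rewrite /Rintegral integralE [in RHS]integralE.
have H1 := @ge0_integral2_affine a b c d e f (EFin \o g)^\+%E D0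
  (measurable_funepos mg) (fun z => funepos_ge0 _ z).
have H2 := @ge0_integral2_affine a b c d e f (EFin \o g)^\-%E D0
  (measurable_funeneg mg) (fun z => funeneg_ge0 _ z).
set r := `|_|^-1 in H1 H2 *.
transitivity (fine (r%:E * \int[leb2 R]_z (EFin \o g)^\+ z
  - r%:E * \int[leb2 R]_z (EFin \o g)^\- z)%E).
  rewrite -H1 -H2; congr (fine (_ - _)%E); apply: eq_integral => z _;
    by rewrite ?funepos.unlock ?funeneg.unlock.
rewrite -[X in _ = _ * fine X]/(\int[leb2 R]_z (EFin \o g)^\+ z - \int[leb2 R]_z (EFin \o g)^\- z)%E.
by rewrite -(fineK pf) -(fineK nf) -!EFinM -!EFinB /= mulrBr.
Qed.

End Int2.

(** * Affine functionals and barycentric coordinates *)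

Section AffineFunctionals.
Variable R : realType.
Notation V := 'cV[R]_3.
Implicit Types (u v w x y z m n : V) (P : V * R) (T : 'M[R]_(3, 4)) (A : set V).

Lemma dotC u v : dot u v = dot v u.
Proof. by apply: eq_bigr => i _; rewrite mulrC. Qed.

Lemma dotDr u v w : dot u (v + w) = dot u v + dot u w.
Proof. by rewrite -big_split /=; apply: eq_bigr => i _; rewrite mxE mulrDr. Qed.

Lemma dotZr (a : R) u v : dot u (a *: v) = a * dot u v.
Proof. by rewrite mulr_sumr; apply: eq_bigr => i _; rewrite mxE mulrCA. Qed.

Lemma dotNr u v : dot u (- v) = - dot u v.
Proof. by rewrite -scaleN1r dotZr mulN1r. Qed.

Lemma dotBr u v w : dot u (v - w) = dot u v - dot u w.
Proof. by rewrite dotDr dotNr. Qed.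

Lemma dotDl u v w : dot (v + w) u = dot v u + dot w u.
Proof. by rewrite !(dotC _ u) dotDr. Qed.

Lemma dotZl (a : R) u v : dot (a *: u) v = a * dot u v.
Proof. by rewrite !(dotC _ v) dotZr. Qed.

Lemma dotNl u v : dot (- u) v = - dot u v.
Proof. by rewrite !(dotC _ v) dotNr. Qed.

Lemma dot0r u : dot u 0 = 0.
Proof. by rewrite -(scale0r 0) dotZr mul0r. Qed.

Lemma dot0l u : dot 0 u = 0.
Proof. by rewrite dotC dot0r. Qed.

Lemma dot_sumr (I : Type) (r : seq I) (p : pred I) u (f : I -> V) :
  dot u (\sum_(i <- r | p i) f i) = \sum_(i <- r | p i) dot u (f i).
Proof. by elim/big_ind2 : _ => //; [exact: dot0r|move=> ? ? ? ? <- <-; exact: dotDr]. Qed.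

Lemma dot_delta u (i : 'I_3) : dot u (delta_mx i 0) = u i 0.
Proof.
rewrite /dot (bigD1 i) //= big1 ?addr0; first by rewrite mxE !eqxx mulr1.
by move=> j ji; rewrite mxE (negbTE ji) mulr0.
Qed.

Lemma dot_gt0 u : u != 0 -> 0 < dot u u.
Proof.
move=> u0; rewrite lt_neqAle sumr_ge0 ?andbT => [|i _]; last by rewrite -expr2 sqr_ge0.
apply: contra u0; rewrite eq_sym psumr_eq0 => [/allP u0|i _]; last by rewrite -expr2 sqr_ge0.
apply/eqP/matrixP => i j; rewrite ord1 mxE.
have := u0 i (mem_index_enum _); rewrite mulf_eq0 orbb => /eqP //.
Qed.

Lemma sum3 (f : 'I_3 -> R) : \sum_i f i = f 0 + f 1 + f 2%:R.
Proof.
rewrite !big_ord_recl big_ord0 addr0 addrA.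
by congr (f _ + f _ + f _); apply/val_inj.
Qed.

Lemma dotE u v : dot u v = u 0 0 * v 0 0 + u 1 0 * v 1 0 + u 2%:R 0 * v 2%:R 0.
Proof. exact: sum3. Qed.

Definition aff P x : R := dot P.1 x + P.2.

Lemma affB P x y : aff P x - aff P y = dot P.1 (x - y).
Proof. by rewrite /aff dotBr; ring. Qed.

Lemma affD P x u : aff P (x + u) = aff P x + dot P.1 u.
Proof. by rewrite /aff dotDr; ring. Qed.

Lemma dot_continuous u : continuous (dot u : V -> R).
Proof.
have -> : dot u = (fun v : V => u 0 0 * v 0 0 + u 1 0 * v 1 0 + u 2%:R 0 * v 2%:R 0).
  by apply/funext => v; exact: dotE.
move=> x; have c i : (fun v : V => u i 0 * v i 0) @ x --> u i 0 * x i 0.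
  exact: (cvgM (cvg_cst (u i 0)) (@coord_continuous R 3 1 i 0 x)).
exact: cvgD (cvgD (c 0) (c 1)) (c 2%:R).
Qed.

Lemma aff_continuous P : continuous (aff P).
Proof. move=> x; have c : dot P.1 z @[z --> x] --> dot P.1 x by exact: dot_continuous.
exact: cvgD c (cvg_cst P.2). Qed.

Lemma aff_near_gt P x (a : R) : a < aff P x -> \forall z \near x, a < aff P z.
Proof. by move=> h; have /cvgr_gt := @aff_continuous P x; exact. Qed.

Lemma aff_near_lt P x (a : R) : aff P x < a -> \forall z \near x, aff P z < a.
Proof. by move=> h; have /cvgr_lt := @aff_continuous P x; exact. Qed.

Lemma segment_cvg x u : x + s *: u @[s --> (0 : R)^'+] --> x.
Proof.
have h : x + s *: u @[s --> (0 : R)] --> x + 0 *: u.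
  by apply: cvgD; [exact: cvg_cst|apply: cvgZr_tmp; exact: cvg_id].
rewrite scale0r addr0 in h; apply: cvg_trans h.
by apply: cvg_app; exact: cvg_within.
Qed.

Lemma near_segment x u (A : set V) : (\forall z \near x, A z) ->
  \forall s \near (0 : R)^'+, A (x + s *: u).
Proof. by move=> h; have := @segment_cvg x u; apply. Qed.

(** One-sided neighbourhoods: at a point of a plane with normal [m], they tell
    which sets lie on the side of [m]. *)
Definition side A x m : Prop := \forall z \near x, 0 < dot m (z - x) -> A z.

Lemma side_ray A x m u : 0 < dot m u -> side A x m ->
  \forall s \near (0 : R)^'+, A (x + s *: u).
Proof.
move=> mu /(near_segment u) h; near=> s.
apply: (near h s) => //; rewrite addrC addKr dotZr.
by apply: mulr_gt0 => //; near: s; exact: nbhs_right_gt.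
Unshelve. all: by end_near. Qed.

Lemma half_ex A x m : m != 0 -> side A x m -> exists2 z, A z & 0 < dot m (z - x).
Proof.
move=> m0 h; have mm := dot_gt0 m0.
have h1 : side (A `&` [set z | 0 < dot m (z - x)]) x m.
  by apply: filterS h => z Az mz; split => //; exact: Az.
by have /filter_ex[s [? ?]] := side_ray mm h1; exists (x + s *: m).
Qed.

Lemma sideI A B x m : side A x m -> side B x m -> side (A `&` B) x m.
Proof. by apply: filterS2 => z Az Bz mz; split; [exact: Az|exact: Bz]. Qed.

Lemma sideS A B x m : A `<=` B -> side A x m -> side B x m.
Proof. by move=> AB; apply: filterS => z Az mz; apply/AB/Az. Qed.

Lemma sideZ A x m (c : R) : 0 < c -> side A x (c *: m) <-> side A x m.
Proof.
by move=> c0; split; apply: filterS => z; rewrite dotZl pmulr_rgt0.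
Qed.

Lemma side_meet A B x m : m != 0 -> side A x m -> side B x m -> A `&` B !=set0.
Proof. by move=> m0 hA hB; have [z] := half_ex m0 (sideI hA hB); exists z. Qed.

Lemma near_side A x m : (\forall z \near x, A z) -> side A x m.
Proof. by apply: filterS. Qed.

Lemma side_closure A x m : m != 0 -> side A x m -> closure A x.
Proof.
move=> m0 h B /(@near_side B x m) hB; exact: side_meet hB.
Qed.

End AffineFunctionals.

Section Barycentric.
Variable R : realType.
Notation V := 'cV[R]_3.
Implicit Types (u v w x y z m n : V) (P : V * R) (T : 'M[R]_(3, 4)) (A : set V).

Definition homog T : 'M[R]_4 := col_mx T (const_mx 1 : 'rV[R]_4).

Definition bary T x : 'cV[R]_4 := invmx (homog T) *m col_mx x (1%:M : 'M[R]_1).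

(** Row [j] of the inverse of the homogeneous vertex matrix: the barycentric
    coordinate of the vertex [j], as a linear part and a constant. *)
Definition lam T (j : 'I_4) : V * R :=
  (\col_(i < 3) invmx (homog T) j (lshift 1 i),
   invmx (homog T) j (rshift 3 (0 : 'I_1))).

Arguments lam : simpl never.

Lemma aff_lamE T j x : aff (lam T j) x = bary T x j 0.
Proof.
rewrite /bary mxE (big_split_ord _ _ _ (m := 3) (n := 1)) /=; congr (_ + _).
  by apply: eq_bigr => i _; rewrite mxE (col_mxEu x).
by rewrite big_ord1 (col_mxEd x) mxE eqxx mulr1.
Qed.

Lemma homog_mul T (a : 'cV[R]_4) :
  homog T *m a = col_mx (T *m a) ((\sum_i a i 0)%:M : 'M[R]_1).
Proof.
have E : (const_mx 1 : 'rV[R]_4) *m a = (\sum_i a i 0)%:M.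
  apply/matrixP => i j; rewrite !ord1 !mxE eqxx mulr1n.
  by apply: eq_bigr => l _; rewrite mxE mul1r.
by rewrite -E; exact: (mul_col_mx T (const_mx 1 : 'rV[R]_4) a).
Qed.

Section Nondegenerate.
Variable T : 'M[R]_(3, 4).
Hypothesis ndT : nondegenerate_tetra T.

Lemma homog_unit : homog T \in unitmx.
Proof. by rewrite -row_free_unit /row_free; apply/eqP. Qed.

Lemma lam_id (a : 'cV[R]_4) j : \sum_i a i 0 = 1 ->
  aff (lam T j) (T *m a) = a j 0.
Proof.
move=> a1; rewrite aff_lamE /bary; have := homog_mul T a; rewrite a1 => <-.
by rewrite mulKmx // homog_unit.
Qed.

Lemma bary_sum x : \sum_j aff (lam T j) x = 1.
Proof.
have := homog_mul T (bary T x); rewrite mulKVmx ?homog_unit // => h.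
have [_ /matrixP] := @eq_col_mx _ 3 1 1 _ _ _ _ h; move/(_ 0 0); rewrite !mxE !eqxx !mulr1n => ->.
by apply: eq_bigr => j _; rewrite aff_lamE.
Qed.

Lemma bary_mul x : T *m bary T x = x.
Proof.
have := homog_mul T (bary T x); rewrite mulKVmx ?homog_unit // => h.
by have [<- _] := @eq_col_mx _ 3 1 1 _ _ _ _ h.
Qed.

Lemma mul_colE (a : 'cV[R]_4) : T *m a = \sum_j a j 0 *: col j T.
Proof.
apply/matrixP => i j; rewrite ord1 summxE mxE; apply: eq_bigr => l _.
by rewrite !mxE mulrC.
Qed.

Lemma bary_comb x : x = \sum_j aff (lam T j) x *: col j T.
Proof.
rewrite -[LHS]bary_mul mul_colE; apply: eq_bigr => j _; by rewrite aff_lamE.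
Qed.

Lemma aff_sum (I : finType) P (a : I -> R) (f : I -> V) : \sum_i a i = 1 ->
  aff P (\sum_i a i *: f i) = \sum_i a i * aff P (f i).
Proof.
move=> a1; rewrite /aff dot_sumr; under eq_bigr do rewrite dotZr.
rewrite -[X in _ + X]mul1r -a1 mulr_suml -big_split /=.
by apply: eq_bigr => i _; rewrite mulrDr.
Qed.

Lemma aff_bary P x : aff P x = \sum_j aff (lam T j) x * aff P (col j T).
Proof. by rewrite {1}(bary_comb x) aff_sum // bary_sum. Qed.

Lemma lam_vertex i j : aff (lam T i) (col j T) = (i == j)%:R.
Proof.
have -> : col j T = T *m delta_mx j 0 by rewrite colE.
rewrite lam_id ?mxE ?eqxx ?andbT //.
rewrite (bigD1 j) //= big1 ?mxE ?eqxx ?addr0 // => l lj.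
by rewrite mxE (negbTE lj).
Qed.

Lemma dot_lam_edge i j l : dot (lam T i).1 (col j T - col l T) =
  (i == j)%:R - (i == l)%:R.
Proof. by rewrite -affB !lam_vertex. Qed.

Lemma lam_neq0 j : (lam T j).1 != 0.
Proof.
have [l lj] : exists l, l != j by exists (lift j (0 : 'I_3)); rewrite eq_sym neq_lift.
apply/eqP => h; have := dot_lam_edge j j l; rewrite h dot0l eqxx eq_sym (negbTE lj).
by move=> /eqP; rewrite subr0 eq_sym oner_eq0.
Qed.

Lemma lam_not_parallel i j (c : R) : (lam T j).1 = c *: (lam T i).1 -> i = j.
Proof.
move=> h; apply/eqP; apply/negPn/negP => ij.
have [l [li lj]] : exists l, l != i /\ l != j.
  have : (0 < #|~: [set i; j]|)%N.
    by rewrite cardsCs finset.setCK cards2 card_ord; case: (_ != _).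
  by case/card_gt0P => l; rewrite !inE negb_or => /andP[? ?]; exists l.
have := dot_lam_edge j j l; have := dot_lam_edge i j l.
rewrite h dotZl => ->; rewrite (negbTE ij) !eqxx ![_ == l]eq_sym (negbTE li) (negbTE lj).
by move=> /eqP; rewrite subrr mulr0 subr0 eq_sym oner_eq0.
Qed.

Lemma tetraP x : tetra T x <-> forall j, 0 < aff (lam T j) x.
Proof.
split=> [[a [a0 a1 ->]] j|h]; first by rewrite lam_id.
exists (bary T x); split; last by rewrite bary_mul.
  by move=> i; rewrite -aff_lamE.
by rewrite -[RHS](bary_sum x); apply: eq_bigr => j _; rewrite aff_lamE.
Qed.

Lemma faceP j x : face T j x <->
  (forall i, 0 <= aff (lam T i) x) /\ aff (lam T j) x = 0.
Proof.
split=> [[a [a0 aj a1 ->]]|[h hj]]; first by split=> [i|]; rewrite lam_id.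
exists (bary T x); split; last by rewrite bary_mul.
- by move=> i; rewrite -aff_lamE.
- by rewrite -aff_lamE.
- by rewrite -[RHS](bary_sum x); apply: eq_bigr => i _; rewrite aff_lamE.
Qed.

Definition centroid : V := T *m (const_mx 4%:R^-1 : 'cV[R]_4).

Lemma lam_centroid j : aff (lam T j) centroid = 4%:R^-1.
Proof.
rewrite lam_id ?mxE //; under eq_bigr do rewrite mxE.
by rewrite !big_ord_recl big_ord0; field.
Qed.

Lemma tetra_centroid : tetra T centroid.
Proof. by apply/tetraP => j; rewrite lam_centroid. Qed.

Lemma closure_tetraP x : closure (tetra T) x <-> forall j, 0 <= aff (lam T j) x.
Proof.
split=> [h j|h B /(near_segment (centroid - x)) hB].
  rewrite leNgt; apply/negP => /aff_near_lt /h[z [/tetraP /(_ j) z0]].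
  by rewrite /= ltNge ltW.
have : \forall s \near (0 : R)^'+, 0 < s < 1.
  near=> s; apply/andP; split; near: s; [exact: nbhs_right_gt|exact: nbhs_right_lt].
move=> /(filterI hB)/filter_ex[s [Bs /andP[s0 s1]]].
exists (x + s *: (centroid - x)); split => //; apply/tetraP => j.
rewrite affD dotZr -affB lam_centroid.
have -> : aff (lam T j) x + s * (4%:R^-1 - aff (lam T j) x) =
  (1 - s) * aff (lam T j) x + s / 4%:R by ring.
apply: ltr_wpDl; last by apply: divr_gt0.
by apply: mulr_ge0 => //; rewrite subr_ge0 ltW.
Unshelve. all: by end_near. Qed.

Lemma open_tetra : open (tetra T).
Proof.
rewrite openE => x /tetraP h.
have : \forall z \near x, forall j, 0 < aff (lam T j) z.
  apply: (@filter_forall _ _ (fun j z => 0 < aff (lam T j) z) (nbhs x)) => j.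
  exact: aff_near_gt (h j).
by apply: filterS => z hz; apply/tetraP.
Qed.

End Nondegenerate.
End Barycentric.

(** * Generic points of a finite family of planes *)

Section Generic.
Variable R : realType.
Notation V := 'cV[R]_3.
Implicit Types (u v w x y z m n : V) (P : V * R) (T : 'M[R]_(3, 4)) (A : set V).
Implicit Types Ps : seq (V * R).

Definition planes T : seq (V * R) := [seq lam T j | j <- enum 'I_4].

Lemma mem_planes T j : lam T j \in planes T.
Proof. by apply: map_f; rewrite mem_enum. Qed.

(** Near such a point a tetrahedron bounded by planes of [Ps] is a full
    neighbourhood, one side of the plane with normal [n], or absent. *)
Definition generic Ps x n : Prop :=
  n != 0 /\ forall P, P \in Ps -> aff P x = 0 -> exists k, P.1 = k *: n.

Lemma generic_aff Ps x n (c : R) P : generic Ps x n -> c != 0 -> P \in Ps ->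
  P.1 != 0 -> side [set z | 0 < aff P z] x (c *: n) \/
              side [set z | aff P z < 0] x (c *: n).
Proof.
move=> [n0 gn] c0 PPs P0; have [h|h|h] := ltgtP 0 (aff P x).
- by left; apply: near_side; exact: aff_near_gt.
- by right; apply: near_side; exact: aff_near_lt.
- have [k Pk] := gn P PPs (esym h).
  have k0 : k != 0 by apply: contra_neq P0 => k0; rewrite Pk k0 scale0r.
  have E z : aff P z = k / c * dot (c *: n) (z - x).
    by rewrite -[LHS]subr0 h affB Pk !dotZl mulrA divfK.
  have [kc|kc|/eqP] := ltgtP 0 (k / c); last by rewrite eq_sym mulf_eq0 invr_eq0 (negbTE k0) (negbTE c0).
    by left; apply: filterE => z zx /=; rewrite E mulr_gt0.
  by right; apply: filterE => z zx /=; rewrite E nmulr_rlt0.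
Qed.

Section Tetra.
Variables (Ps : seq (V * R)) (T : 'M[R]_(3, 4)).
Hypothesis ndT : nondegenerate_tetra T.
Hypothesis TPs : {subset planes T <= Ps}.

(** Each barycentric coordinate has a sign at [x], or changes sign across the
    plane with normal [n]. *)
Lemma generic_side x n (c : R) : generic Ps x n -> c != 0 ->
  side (tetra T) x (c *: n) \/ side (~` closure (tetra T)) x (c *: n).
Proof.
move=> gn c0.
have H j := generic_aff gn c0 (TPs (mem_planes T j)) (lam_neq0 ndT j).
have [h|] := pselect (forall j, side [set z | 0 < aff (lam T j) z] x (c *: n)).
  have h' : \forall z \near x, forall j, 0 < dot (c *: n) (z - x) -> 0 < aff (lam T j) z.
    exact: (@filter_forall _ _ (fun j z => 0 < dot (c *: n) (z - x) ->
      0 < aff (lam T j) z) (nbhs x)).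
  by left; apply: filterS h' => z hz cz; apply/tetraP => // j; exact: hz.
move=> /existsNP [j nj]; right; have [//|] := H j.
apply: sideS => z /= z0 /closure_tetraP => /(_ ndT j).
by rewrite leNgt z0.
Qed.

(** Two barycentric coordinates vanishing at [x] would have parallel
    gradients; so a generic boundary point is interior to a face. *)
Lemma closure_tetra_cases x n : generic Ps x n -> closure (tetra T) x ->
  ~ tetra T x -> exists j, [/\ aff (lam T j) x = 0,
    forall i, i != j -> 0 < aff (lam T i) x,
    side (tetra T) x (lam T j).1 & exists2 k, k != 0 & (lam T j).1 = k *: n].
Proof.
move=> gn /closure_tetraP => /(_ ndT) h0 nT.
have [j j0] : exists j, aff (lam T j) x = 0.
  apply: contrapT => /forallNP h; apply: nT; apply/tetraP => // j.
  by rewrite lt_neqAle h0 andbT eq_sym; apply/eqP; exact: h.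
have [k lk] := gn.2 _ (TPs (mem_planes T j)) j0.
have k0 : k != 0.
  by have := lam_neq0 ndT j; apply: contra_neq => k0; rewrite lk k0 scale0r.
have hi i : i != j -> 0 < aff (lam T i) x.
  move=> ij; rewrite lt_neqAle h0 andbT eq_sym; apply/eqP => i0.
  have [k' lk'] := gn.2 _ (TPs (mem_planes T i)) i0.
  move/negP: ij; apply; apply/eqP/esym/(lam_not_parallel ndT (c := k' / k)).
  rewrite lk' lk scalerA. 
  by rewrite divfK.
exists j; split => //; last by exists k.
have h : \forall z \near x, forall i, i != j -> 0 < aff (lam T i) z.
  apply: (@filter_forall _ _ (fun i z => i != j -> 0 < aff (lam T i) z) (nbhs x)) => i.
  have [->|ij] := eqVneq i j; first exact: filterE.
  by apply: filterS (aff_near_gt (hi i ij)).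
apply: filterS h => z hz zx; apply/tetraP => // i.
have [->|ij] := eqVneq i j; last exact: hz.
by have <- : dot (lam T j).1 (z - x) = aff (lam T j) z by rewrite -affB j0 subr0.
Qed.

End Tetra.

Section Line.
Variables (b0 om : V).
Hypothesis om0 : om != 0.
Variable T : 'M[R]_(3, 4).
Hypothesis ndT : nondegenerate_tetra T.

Let line (t : R) : V := b0 + t *: om.
Let I : set R := [set t | tetra T (line t)].

Lemma line_shift (t s : R) : line t + s *: om = line (t + s).
Proof. by rewrite /line scalerDl addrA. Qed.

Lemma aff_line P t : aff P (line t) = aff P b0 + t * dot P.1 om.
Proof. by rewrite affD dotZr. Qed.

Lemma line_convex t1 t2 t : I t1 -> I t2 -> t1 <= t <= t2 -> I t.
Proof.
move=> /tetraP => /(_ ndT) h1 /tetraP => /(_ ndT) h2 /andP[t1t tt2].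
apply/tetraP => // j; have := h1 j; have := h2 j; rewrite !aff_line.
have [d|d] := leP 0 (dot (lam T j).1 om); nra.
Qed.

Lemma line_open t : I t -> exists2 e, 0 < e & forall s, `|s| < e -> I (t + s).
Proof.
move=> It; have op := open_tetra ndT.
have h : \forall z \near line t, tetra T z by move: op; rewrite openE => /(_ _ It).
have [e1 e10 He1] : exists2 e : R, 0 < e & forall s, 0 < s -> s < e -> tetra T (line t + s *: om).
  have := near_segment om h; rewrite near_withinE => /nbhs_ballP[e /= e0 he].
  by exists e => // s s0 se; apply: he => //; rewrite /ball /= sub0r normrN gtr0_norm.
have [e2 e20 He2] : exists2 e : R, 0 < e & forall s, 0 < s -> s < e -> tetra T (line t + s *: (- om)).
  have := near_segment (- om) h; rewrite near_withinE => /nbhs_ballP[e /= e0 he].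
  by exists e => // s s0 se; apply: he => //; rewrite /ball /= sub0r normrN gtr0_norm.
exists (Num.min e1 e2); first by rewrite lt_min e10.
move=> s; rewrite lt_min => /andP[se1 se2]; rewrite /I /= -line_shift.
have [s0|s0|<-] := ltgtP 0 s; last by rewrite scale0r addr0.
  by apply: He1 => //; rewrite gtr0_norm in se1.
rewrite -[s]opprK scaleNr -scalerN; apply: He2; first by rewrite oppr_gt0.
by rewrite ltr0_norm in se2.
Qed.

Lemma exists_transverse : exists j, dot (lam T j).1 om != 0.
Proof.
apply: contrapT => /forallNP h; move/eqP: om0; apply.
have E : b0 + om = b0.
  rewrite (bary_comb ndT (b0 + om)) [RHS](bary_comb ndT b0); apply: eq_bigr => j _.
  rewrite affD; have /negP := h j; rewrite negbK => /eqP ->.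
  by rewrite addr0.
by apply: (addrI b0); rewrite addr0.
Qed.

Lemma line_bounded : exists K, forall t, I t -> `|t| <= K.
Proof.
have [j dj] := exists_transverse.
exists ((1 + `|aff (lam T j) b0|) / `|dot (lam T j).1 om|) => t It.
rewrite ler_pdivlMr ?normr_gt0 // -normrM.
have := (tetraP ndT _).1 It j; rewrite aff_line => h1.
have h2 : aff (lam T j) b0 + t * dot (lam T j).1 om <= 1.
  rewrite -aff_line -(bary_sum ndT (line t)) (bigD1 j) //= lerDl sumr_ge0 // => i _.
  exact/ltW/(tetraP ndT _).1.
rewrite ler_norml; have := ler_norm (aff (lam T j) b0); have := ler_norm (- aff (lam T j) b0).
by rewrite normrN; lra.
Qed.

(** A tetrahedron is open, convex and bounded. *)
Lemma line_itv : I !=set0 -> exists a b, a < b /\ I = `]a, b[%classic.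
Proof.
move=> [t0 It0]; have [K hK] := line_bounded.
have hs : has_sup I.
  by split; [exists t0|exists K => t /hK; rewrite ler_norml => /andP[]].
have hi : has_inf I.
  split; [by exists t0|exists (- K) => t /hK; rewrite ler_norml => /andP[]//].
have lt_sup t : I t -> t < sup I.
  move=> /line_open[e e0 he]; apply: (@lt_le_trans _ _ (t + e / 2)); first by rewrite ltrDl divr_gt0.
  apply: ub_le_sup => //; first by case: hs.
  by apply: he; rewrite gtr0_norm ?divr_gt0 // ltr_pdivrMr // ltr_pMr // ltr1n.
have inf_lt t : I t -> inf I < t.
  move=> /line_open[e e0 he]; apply: (@le_lt_trans _ _ (t - e / 2)); last by rewrite gtrBl divr_gt0.
  apply: ge_inf => //; first by case: hi.
  by apply: he; rewrite normrN gtr0_norm ?divr_gt0 // ltr_pdivrMr // ltr_pMr // ltr1n.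
exists (inf I), (sup I); split; first exact: lt_trans (inf_lt _ It0) (lt_sup _ It0).
apply/seteqP; split=> t; rewrite /= in_itv /=.
  by move=> It; rewrite inf_lt ?lt_sup.
move=> /andP[it ts].
have [t1 It1 h1] := inf_adherent (eps := t - inf I) ltac:(by rewrite subr_gt0) hi.
have [t2 It2 h2] := sup_adherent (eps := sup I - t) ltac:(by rewrite subr_gt0) hs.
apply: (line_convex It1 It2); apply/andP; split; apply: ltW.
  by rewrite addrC subrK in h1.
by rewrite subKr in h2.
Qed.

End Line.
End Generic.

(** * Flux along a line *)

Lemma sum_unique (U : nmodType) (I : eqType) (r : seq I) (p : I -> Prop) (F : I -> U) e0 :
  uniq r -> e0 \in r -> p e0 -> (forall e, e \in r -> p e -> e = e0) ->
  \sum_(e <- r | `[< p e >]) F e = F e0.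
Proof.
move=> ur e0r pe0 hu; rewrite big_mkcond (bigD1_seq e0) //= big1_seq ?addr0.
  by case: asboolP.
move=> e /andP[ee0 er]; case: asboolP => // /(hu _ er) E.
by rewrite E eqxx in ee0.
Qed.

Lemma sum_none (U : nmodType) (I : eqType) (r : seq I) (p : I -> Prop) (F : I -> U) :
  (forall e, e \in r -> ~ p e) -> \sum_(e <- r | `[< p e >]) F e = 0.
Proof.
move=> h; rewrite big1_seq // => e /andP[/asboolP pe er]; exfalso; exact: (h e).
Qed.

Lemma side_all (R : realType) (I : eqType) (r : seq I) (A : I -> set 'cV[R]_3) x m :
  (forall i, i \in r -> side (A i) x m) ->
  side [set z | forall i, i \in r -> A i z] x m.
Proof.
elim: r => [|i r IH] h; first by apply: filterE.
have h1 : side [set z | forall i, i \in r -> A i z] x m.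
  by apply: IH => j jr; apply: h; rewrite inE jr orbT.
apply: sideS (sideI h1 (h i (mem_head _ _))) => z [z1 z2] j.
by rewrite inE => /predU1P[->|/z1].
Qed.

Section Flux.
Variable R : realType.
Notation V := 'cV[R]_3.
Notation tet := 'M[R]_(3, 4).
Variables (Oa : set V) (Ps : seq (V * R)).
Variable fam : seq (tet * (V * R)).
Variable Fs : seq (tet * 'I_4).

(** The gradient of the barycentric coordinate of the opposite vertex: a
    normal of the face that points into the tetrahedron. *)
Definition interior_side (f : tet * 'I_4) : V := (lam f.1 f.2).1.

(** A piecewise affine function on [Oa] over a possibly nonconforming
    decomposition; continuity is expressed by the values at generic points. *)
Definition affine_family : Prop :=
  [/\ uniq fam,
      forall e, e \in fam -> [/\ nondegenerate_tetra e.1,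
        {subset planes e.1 <= Ps} & tetra e.1 `<=` Oa],
      forall e e', e \in fam -> e' \in fam ->
        tetra e.1 `&` tetra e'.1 !=set0 -> e = e',
      forall x, Oa x -> exists2 e, e \in fam & closure (tetra e.1) x
    & forall x n e e', generic Ps x n -> Oa x -> e \in fam -> e' \in fam ->
        closure (tetra e.1) x -> closure (tetra e'.1) x ->
        aff e.2 x = aff e'.2 x].

(** The polyhedral boundary of [Oa], described at generic points only: there
    [Oa] is locally one side of a single face. *)
Definition boundary_faces : Prop :=
  [/\ uniq Fs,
      forall f, f \in Fs -> nondegenerate_tetra f.1 /\ {subset planes f.1 <= Ps},
      forall f x n, f \in Fs -> generic Ps x n -> face f.1 f.2 x ->
        [/\ ~ Oa x, side Oa x (interior_side f) & side (~` Oa) x (- interior_side f)],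
      forall x n c, generic Ps x n -> c != 0 -> side Oa x (c *: n) -> ~ Oa x ->
        exists2 f, f \in Fs & face f.1 f.2 x
    & forall x n f f', generic Ps x n -> f \in Fs -> f' \in Fs ->
        face f.1 f.2 x -> face f'.1 f'.2 x -> f = f'].

Hypotheses (famH : affine_family) (FsH : boundary_faces).

(** Otherwise the one-sided neighbourhood in [Oa] would avoid all closed
    tetrahedra, which cover [Oa]. *)
Lemma touch_exists x n c : generic Ps x n -> c != 0 -> side Oa x (c *: n) ->
  exists2 e, e \in fam & side (tetra e.1) x (c *: n).
Proof.
move=> gn c0 sO; have [_ fH _ fcov _] := famH.
apply: contrapT => h.
have h' e : e \in fam -> side (~` closure (tetra e.1)) x (c *: n).
  move=> ef; have [nd pl _] := fH e ef.
  have [se|//] := generic_side nd pl gn c0.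
  by exfalso; apply: h; exists e.
have cn0 : c *: n != 0 by rewrite scaler_eq0 negb_or c0; case: gn => ->.
have : side [set z | forall e, e \in fam -> ~ closure (tetra e.1) z] x (c *: n).
  exact: side_all.
move=> /(sideI sO) /(half_ex cn0)[z [Oz hz] _].
by have [e /hz] := fcov z Oz.
Qed.

Lemma touch_unique x m e e' : m != 0 -> e \in fam -> e' \in fam ->
  side (tetra e.1) x m -> side (tetra e'.1) x m -> e = e'.
Proof.
move=> m0 ef ef' s s'; have [_ _ fd _ _] := famH; apply: fd => //.
exact: side_meet s'.
Qed.

Lemma face_normal f x n : f \in Fs -> generic Ps x n -> face f.1 f.2 x ->
  exists2 k, k != 0 & interior_side f = k *: n.
Proof.
move=> fF gn; have [_ /(_ f fF)[nd pl] _ _ _] := FsH.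
move=> /faceP => /(_ nd)[_ l0]; have [k lk] := gn.2 _ (pl _ (mem_planes _ _)) l0.
exists k => //; have := lam_neq0 nd f.2; apply: contra_neq => k0.
by rewrite lk k0 scale0r.
Qed.

(** A second closed tetrahedron through [x] would either touch the face from
    outside, where [Oa] is absent, or overlap the first one. *)
Lemma face_touch f x n : f \in Fs -> generic Ps x n -> face f.1 f.2 x ->
  exists e, [/\ e \in fam, closure (tetra e.1) x, side (tetra e.1) x (interior_side f)
    & forall e', e' \in fam -> closure (tetra e'.1) x -> e' = e].
Proof.
move=> fF gn fx; have [k k0 lk] := face_normal fF gn fx.
have [_ _ /(_ f x n fF gn fx)[nO sO sC] _ _] := FsH.
have [_ fH _ _ _] := famH.
have [e ef se] := touch_exists gn k0 (eq_rect _ (side Oa x) sO _ lk).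
have kn0 : k *: n != 0 by rewrite scaler_eq0 negb_or k0; case: gn => ->.
exists e; rewrite lk; split; [by []|exact: side_closure se|by []|].
move=> e' e'f ce'; apply: (touch_unique kn0 e'f ef _ se).
have [nd pl sub] := fH e' e'f.
have nT : ~ tetra e'.1 x by move=> /sub.
have [j [_ _ sj [k' k'0 lk']]] := closure_tetra_cases nd pl gn ce' nT.
rewrite lk' in sj; have E : k' *: n = (k' / k) *: (k *: n) by rewrite scalerA divfK.
have [kk|kk|/eqP] := ltgtP 0 (k' / k).
- by move: sj; rewrite E; move/sideZ; apply.
- exfalso; move: sj; rewrite E -[_ *: (k *: n)]opprK -scaleNr -scalerN.
  move=> /sideZ; rewrite oppr_gt0 => /(_ kk) sj.
  rewrite lk in sC; have [|z [Tz nz]] := side_meet _ sj sC; first by rewrite oppr_eq0.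
  by apply: nz; exact: sub.
- by rewrite eq_sym mulf_eq0 invr_eq0 (negbTE k0) (negbTE k'0).
Qed.

Hypothesis oOa : open Oa.
Variable om : V.
Hypothesis om0 : om != 0.

(** At interior points the traces from both sides cancel by continuity; at
    boundary points one of them is left, with the sign of the crossing. *)
Lemma point_flux x n : generic Ps x n -> 0 < dot n om ->
  \sum_(e <- fam | `[< side (tetra e.1) x (- n) /\ ~ tetra e.1 x >]) aff e.2 x
  - \sum_(e <- fam | `[< side (tetra e.1) x n /\ ~ tetra e.1 x >]) aff e.2 x
  = \sum_(f <- Fs | `[< face f.1 f.2 x >])
      Num.sg (- dot (interior_side f) om) *
      \sum_(e <- fam | `[< closure (tetra e.1) x >]) aff e.2 x.
Proof.
move=> gn nom; have n0 : n != 0 by case: gn.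
have nn0 : - n != 0 by rewrite oppr_eq0.
have m10 : (-1 : R) != 0 by rewrite oppr_eq0 oner_eq0.
have [ufam fH fd fcov fcont] := famH; have [uF FH Hin Hex Hu] := FsH.
(* At a boundary point only the tetrahedron inside [Oa] contributes. *)
have [[f fF fx]|nf] := pselect (exists2 f, f \in Fs & face f.1 f.2 x).
  rewrite (@sum_unique _ _ _ (fun f => face f.1 f.2 x) _ f) //; last first.
    by move=> f' f'F f'x; exact: Hu gn _ _ _ _.
  have [k k0 lk] := face_normal fF gn fx.
  have [nO sO sC] := Hin f x n fF gn fx.
  have [e0 [e0f ce0 se0 ue0]] := face_touch fF gn fx.
  rewrite (@sum_unique _ _ _ (fun e => closure (tetra e.1) x) _ e0) //.
  have nT e : e \in fam -> ~ tetra e.1 x by move=> /fH[_ _ sub] /sub.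
  rewrite lk dotZl; have [kp|kn|/eqP] := ltgtP 0 k; last by rewrite eq_sym (negbTE k0).
  - rewrite ltr0_sg ?oppr_lt0 ?mulr_gt0 // mulN1r.
    rewrite lk in se0 sC; rewrite sum_none ?sub0r.
      rewrite (@sum_unique _ _ _ (fun e => side (tetra e.1) x n /\ ~ tetra e.1 x) _ e0) //.
        by split; [move/sideZ: se0; apply|exact: nT].
      by move=> e ef [s _]; apply: ue0 => //; exact: side_closure s.
    move=> e ef [s _]; rewrite -scalerN in sC; move/sideZ: sC => /(_ kp) sC.
    have [z [Tz nz]] := side_meet nn0 s sC.
    by apply: nz; have [_ _ sub] := fH e ef; exact: sub.
  - rewrite gtr0_sg ?oppr_gt0 ?nmulr_rlt0 // mul1r.
    have nkp : 0 < - k by rewrite oppr_gt0.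
    have E : k *: n = (- k) *: (- n) by rewrite scaleNr scalerN opprK.
    rewrite lk E in se0; rewrite lk -scaleNr in sC.
    rewrite [X in _ - X]sum_none ?subr0.
      rewrite (@sum_unique _ _ _ (fun e => side (tetra e.1) x (- n) /\ ~ tetra e.1 x) _ e0) //.
        by split; [move/sideZ: se0; apply|exact: nT].
      by move=> e ef [s _]; apply: ue0 => //; exact: side_closure s.
    move=> e ef [s _]; move/sideZ: sC => /(_ nkp) sC.
    have [z [Tz nz]] := side_meet n0 s sC.
    by apply: nz; have [_ _ sub] := fH e ef; exact: sub.
rewrite [RHS]sum_none; last by move=> f fF fx; apply: nf; exists f.
have [Ox|nOx] := pselect (Oa x); last first.
  rewrite !sum_none ?subrr // => e ef [s _].
    apply: nf; apply: (Hex x n 1 gn (oner_neq0 _) _ nOx).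
    by rewrite scale1r; apply: sideS s; case: (fH e ef).
  apply: nf; apply: (Hex x n (-1) gn m10 _ nOx).
  by rewrite scaleN1r; apply: sideS s; case: (fH e ef).
(* At an interior point one tetrahedron is touched from each side. *)
have oO : \forall z \near x, Oa z.
  by move: oOa; rewrite openE; apply.
have [ep epf sp] : exists2 e, e \in fam & side (tetra e.1) x n.
  have [|e ef se] := @touch_exists x n 1 gn (oner_neq0 _); first exact: near_side.
  by exists e => //; rewrite scale1r in se.
have [em emf sm] : exists2 e, e \in fam & side (tetra e.1) x (- n).
  have [|e ef se] := @touch_exists x n (-1) gn m10; first exact: near_side.
  by exists e => //; rewrite scaleN1r in se.
have inT e : e \in fam -> tetra e.1 x -> e = ep /\ e = em.
  move=> ef Tx; have [nd _ _] := fH e ef.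
  have h : \forall z \near x, tetra e.1 z by have := open_tetra nd; rewrite openE; apply.
  have s1 : side (tetra e.1) x n by exact: near_side h.
  have s2 : side (tetra e.1) x (- n) by exact: near_side h.
  by split; [exact: touch_unique n0 ef epf s1 sp|exact: touch_unique nn0 ef emf s2 sm].
have [Tx|nTx] := pselect (exists2 e, e \in fam & tetra e.1 x).
  case: Tx => e ef Tx; have [E1 E2] := inT e ef Tx.
  rewrite !sum_none ?subrr // => e' e'f [s]; apply.
    by rewrite (touch_unique n0 e'f epf s sp) -E1.
  by rewrite (touch_unique nn0 e'f emf s sm) -E2.
rewrite (@sum_unique _ _ _ (fun e => side (tetra e.1) x (- n) /\ ~ tetra e.1 x) _ em) //; first last.
- by move=> e ef [s _]; exact: touch_unique nn0 ef emf s sm.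
- by split => // Tx; apply: nTx; exists em.
rewrite (@sum_unique _ _ _ (fun e => side (tetra e.1) x n /\ ~ tetra e.1 x) _ ep) //; first last.
- by move=> e ef [s _]; exact: touch_unique n0 ef epf s sp.
- by split => // Tx; apply: nTx; exists ep.
rewrite (fcont x n em ep) ?subrr //; [exact: side_closure sm|exact: side_closure sp].
Qed.

(** [nt t] is the common normal of the planes met at time [t], oriented along
    the line. *)
Definition crossings (b0 : V) (ts : seq R) (nt : R -> V) : Prop :=
  [/\ uniq ts, forall t P, P \in Ps -> aff P (b0 + t *: om) = 0 -> t \in ts
    & forall t, t \in ts -> generic Ps (b0 + t *: om) (nt t) /\ 0 < dot (nt t) om].

Section OneLine.
Variables (b0 : V) (ts : seq R) (nt : R -> V).
Hypothesis tsH : crossings b0 ts nt.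
Let line t := b0 + t *: om.

(** The fundamental theorem of calculus on the chord of one tetrahedron. *)
Lemma line_tetra e : e \in fam ->
  dot e.2.1 om * fine (leb1 R [set t | tetra e.1 (line t)]) =
  \sum_(t <- ts | `[< side (tetra e.1) (line t) (- nt t) /\ ~ tetra e.1 (line t) >])
     aff e.2 (line t) -
  \sum_(t <- ts | `[< side (tetra e.1) (line t) (nt t) /\ ~ tetra e.1 (line t) >])
     aff e.2 (line t).
Proof.
move=> ef; have [_ /(_ e ef)[nd pl _] _ _ _] := famH.
have [uts tsP tsg] := tsH.
have up t : t \in ts -> side (tetra e.1) (line t) (nt t) ->
    \forall s \near (0 : R)^'+, tetra e.1 (line (t + s)).
  move=> /tsg[_ /side_ray h] /h; apply: filterS => s.
  by rewrite /line scalerDl addrA.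
have down t : t \in ts -> side (tetra e.1) (line t) (- nt t) ->
    \forall s \near (0 : R)^'+, tetra e.1 (line (t - s)).
  move=> /tsg[_ nom] h; have {h} := @side_ray _ _ _ _ (- om) _ h.
  rewrite dotNl dotNr opprK => /(_ nom); apply: filterS => s.
  by rewrite /line scalerBl addrA scalerN.
have [[a [b [ab IE]]]|I0] : (exists a b, a < b /\
    [set t | tetra e.1 (line t)] = `]a, b[%classic) \/
    [set t | tetra e.1 (line t)] = set0.
  have [->|/set0P h] := eqVneq [set t | tetra e.1 (line t)] set0; first by right.
  by left; exact: (line_itv om0 nd h).
have inI t : tetra e.1 (line t) <-> a < t < b.
  by have -> : tetra e.1 (line t) = [set t | tetra e.1 (line t)] t by []; rewrite IE /= in_itv.
have cl t : a <= t <= b -> closure (tetra e.1) (line t).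
  move=> /andP[at_ tb]; apply/closure_tetraP => // j.
  have tin s : a < s < b -> 0 < aff (lam e.1 j) b0 + s * dot (lam e.1 j).1 om.
    by rewrite -aff_line => /inI/tetraP; apply.
  rewrite /line aff_line leNgt; apply/negP => neg.
  set A := aff _ _ in tin neg *; set D := dot _ _ in tin neg *.
  have hm := tin ((a + b) / 2) ltac:(lra).
  pose c := (A + (a + b) / 2 * D) - (A + t * D).
  have c0 : 0 < c by rewrite /c; lra.
  pose s := (A + (a + b) / 2 * D) / c.
  have s01 : 0 < s < 1.
    by rewrite /s divr_gt0 //= ltr_pdivrMr // mul1r /c; lra.
  have sE : s * c = A + (a + b) / 2 * D by rewrite divfK // gt_eqF.
  have hs : a < (1 - s) * ((a + b) / 2) + s * t < b.
    by case/andP: s01 => s0 s1; nra.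
  have := tin _ hs.
  have -> : A + ((1 - s) * ((a + b) / 2) + s * t) * D = (A + (a + b) / 2 * D) - s * c.
    by rewrite /c; ring.
  by rewrite sE subrr ltxx.
have onT t : a <= t <= b -> ~ (a < t < b) -> t \in ts.
  move=> /cl ct nt'; have [j j0] : exists j, aff (lam e.1 j) (line t) = 0.
    apply: contrapT => /forallNP h; apply: nt'; apply/inI/tetraP => // j.
    rewrite lt_neqAle ((closure_tetraP nd _).1 ct j) andbT eq_sym.
    by apply/eqP; exact: h.
  by apply: tsP j0; exact/pl/mem_planes.
have touches t : t \in ts -> a <= t <= b -> ~ tetra e.1 (line t) ->
    side (tetra e.1) (line t) (nt t) \/ side (tetra e.1) (line t) (- nt t).
  move=> tts tab nT; have [gn nom] := tsg t tts.
  have [j [_ _ sj [k k0 lk]]] := closure_tetra_cases nd pl gn (cl t tab) nT.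
  rewrite lk in sj; have [kp|kn|/eqP] := ltgtP 0 k; last by rewrite eq_sym (negbTE k0).
    by left; move/sideZ: sj; apply.
  right; have nkp : 0 < - k by rewrite oppr_gt0.
  by rewrite -[k *: _]opprK -scaleNr -scalerN in sj; move/sideZ: sj; apply.
have upE t : t \in ts -> side (tetra e.1) (line t) (nt t) -> a <= t < b.
  move=> tts /(up t tts) h.
  have : \forall s \near (0 : R)^'+, 0 < s by exact: nbhs_right_gt.
  move=> h0; apply/andP; split.
    rewrite leNgt; apply/negP => ta.
    have h1 : \forall s \near (0 : R)^'+, s < a - t by apply: nbhs_right_lt; rewrite subr_gt0.
    have [s [/inI /andP[h2 _] h3]] := filter_ex (filterI h h1); lra.
  have [s [/inI /andP[_ h2] h3]] := filter_ex (filterI h h0); lra.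
have downE t : t \in ts -> side (tetra e.1) (line t) (- nt t) -> a < t <= b.
  move=> tts /(down t tts) h.
  have : \forall s \near (0 : R)^'+, 0 < s by exact: nbhs_right_gt.
  move=> h0; apply/andP; split.
    have [s [/inI /andP[h2 _] h3]] := filter_ex (filterI h h0); lra.
  rewrite leNgt; apply/negP => ta.
  have h1 : \forall s \near (0 : R)^'+, s < t - b by apply: nbhs_right_lt; rewrite subr_gt0.
  have [s [/inI /andP[_ h2] h3]] := filter_ex (filterI h h1); lra.
rewrite (@sum_unique _ _ ts (fun t => side (tetra e.1) (line t) (- nt t) /\ ~ tetra e.1 (line t)) _ b) //.
- rewrite (@sum_unique _ _ ts (fun t => side (tetra e.1) (line t) (nt t) /\ ~ tetra e.1 (line t)) _ a) //.
  + rewrite IE lebesgue_measure_itv /= lte_fin ab -EFinB /= !/(line _) affB.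
    by rewrite opprD addrACA subrr add0r -scalerBl dotZr mulrC.
  + by apply: onT; rewrite ?lexx ?ltxx ?ltW.
  + have ats : a \in ts by apply: onT; rewrite ?lexx ?ltxx ?ltW.
    have nT : ~ tetra e.1 (line a) by move/inI; rewrite ltxx.
    split => //; case: (touches a ats _ nT) => //; first by rewrite lexx ltW.
    by move=> /(downE a ats); rewrite ltxx.
  + move=> t tts [/(upE t tts) /andP[at_ tb] /inI nT].
    by apply/eqP; rewrite eq_le at_ andbT leNgt; apply/negP => h; apply: nT; rewrite h.
- by apply: onT; rewrite ?lexx ?ltxx ?andbF ?ltW.
- have bts : b \in ts by apply: onT; rewrite ?lexx ?ltxx ?andbF ?ltW.
  have nT : ~ tetra e.1 (line b) by move/inI; rewrite ltxx andbF.
  split => //; case: (touches b bts _ nT) => //; first by rewrite lexx ltW.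
  by move=> /(upE b bts); rewrite ltxx andbF.
- move=> t tts [/(downE t tts) /andP[at_ tb] /inI nT].
  by apply/eqP; rewrite eq_le tb /= leNgt; apply/negP => h; apply: nT; rewrite h at_.
have nI t : ~ tetra e.1 (line t).
  by move=> h; have : [set t | tetra e.1 (line t)] t by []; rewrite I0.
rewrite I0 measure0 mulr0 !sum_none ?subrr // => t tts [h _].
  by have /filter_ex[s] := up t tts h; exact: nI.
by have /filter_ex[s] := down t tts h; exact: nI.
Qed.

Definition crossing_point (f : tet * 'I_4) : V :=
  line (- aff (lam f.1 f.2) b0 / dot (interior_side f) om).

(** The chord identities add up, and [point_flux] collects the terms at each
    crossing. *)
Lemma line_flux :
  \sum_(e <- fam) dot e.2.1 om * fine (leb1 R [set t | tetra e.1 (line t)]) =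
  \sum_(f <- Fs) Num.sg (- dot (interior_side f) om) *
    \sum_(e <- fam | `[< face f.1 f.2 (crossing_point f) /\
                         closure (tetra e.1) (crossing_point f) >])
      aff e.2 (crossing_point f).
Proof.
have [uts tsP tsg] := tsH.
have -> : \sum_(e <- fam) dot e.2.1 om * fine (leb1 R [set t | tetra e.1 (line t)]) =
    \sum_(t <- ts) \sum_(f <- Fs | `[< face f.1 f.2 (line t) >])
      Num.sg (- dot (interior_side f) om) *
      \sum_(e <- fam | `[< closure (tetra e.1) (line t) >]) aff e.2 (line t).
  rewrite (eq_big_seq _ line_tetra) big_split /= sumrN.
  rewrite (exchange_big_dep xpredT) //= [X in _ - X](exchange_big_dep xpredT) //=.
  rewrite -sumrB; apply: eq_big_seq => t /tsg[gn nom].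
  exact: point_flux.
rewrite (exchange_big_dep xpredT) //=; apply: eq_big_seq => f fF.
rewrite -mulr_sumr; have [d0|d0] := eqVneq (dot (interior_side f) om) 0.
  by rewrite d0 oppr0 sgr0 !mul0r.
congr (_ * _); have [_ /(_ f fF)[nd pl] _ _ _] := FsH.
have tE t : face f.1 f.2 (line t) -> t = - aff (lam f.1 f.2) b0 / dot (interior_side f) om.
  move=> /faceP => /(_ nd)[_]; rewrite /line aff_line => h.
  by apply: (mulIf d0); rewrite divfK //; apply/eqP; rewrite -subr_eq0 opprK addrC h.
have [fx|nfx] := pselect (face f.1 f.2 (crossing_point f)).
  rewrite (@sum_unique _ _ ts (fun t => face f.1 f.2 (line t)) _
    (- aff (lam f.1 f.2) b0 / dot (interior_side f) om)) //.
  - by apply: eq_bigl => e; apply/asboolP/asboolP => [|[]].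
  - apply: (tsP _ (lam f.1 f.2)); first exact/pl/mem_planes.
    exact: ((faceP nd _ _).1 fx).2.
  - by move=> t _; exact: tE.
rewrite sum_none => [|t _ ft]; first by rewrite sum_none // => e _ [].
by apply: nfx; rewrite /crossing_point -(tE t ft).
Qed.

End OneLine.
End Flux.

(** * Areas and normals of faces *)

Section Faces.
Variable R : realType.
Notation V := 'cV[R]_3.
Implicit Types (u v w x y z m n : V) (P : V * R).

Lemma cross0 u v : cross u v 0 0 = u 1 0 * v 2%:R 0 - u 2%:R 0 * v 1 0.
Proof. by rewrite mxE !add0r. Qed.

Lemma cross1 u v : cross u v 1 0 = u 2%:R 0 * v 0 0 - u 0 0 * v 2%:R 0.
Proof.
rewrite mxE; have -> : (1 + 1 : 'I_3) = 2%:R by apply/val_inj.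
by have -> : (1 + 2%:R : 'I_3) = 0 by apply/val_inj.
Qed.

Lemma cross2 u v : cross u v 2%:R 0 = u 0 0 * v 1 0 - u 1 0 * v 0 0.
Proof.
rewrite mxE; have -> : (2%:R + 1 : 'I_3) = 0 by apply/val_inj.
by have -> : (2%:R + 2%:R : 'I_3) = 1 by apply/val_inj.
Qed.

Definition crossE := (cross0, cross1, cross2).

Lemma dot_crossl u v : dot (cross u v) u = 0.
Proof. by rewrite dotE !crossE; ring. Qed.

Lemma dot_crossr u v : dot (cross u v) v = 0.
Proof. by rewrite dotE !crossE; ring. Qed.

Lemma lagrange u v w z : dot (cross u v) (cross w z) =
  dot u w * dot v z - dot u z * dot v w.
Proof. by rewrite !dotE !crossE; ring. Qed.

Lemma enorm_sqr u : enorm u * enorm u = dot u u.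
Proof.
rewrite /enorm -expr2 sqr_sqrtr // /dot sumr_ge0 // => i _.
by rewrite -expr2 sqr_ge0.
Qed.

Variables (T : 'M[R]_(3, 4)) (j : 'I_4).
Hypothesis ndT : nondegenerate_tetra T.

Let n := face_cross T j.
Let mu := dot n (col j T - col (lift j 0) T).

Lemma aff_lam_inj P Q : (forall i, aff P (col i T) = aff Q (col i T)) -> P.1 = Q.1.
Proof.
move=> h; have h' x : aff P x = aff Q x.
  by rewrite (aff_bary ndT P) (aff_bary ndT Q); apply: eq_bigr => i _; rewrite h.
apply/matrixP => i l; rewrite ord1.
by have := affB P (delta_mx i 0) 0; rewrite !h' affB subr0 !dot_delta.
Qed.

Lemma ord4_lift (i : 'I_4) : i = j \/ exists l : 'I_3, i = lift j l.
Proof. by case: (unliftP j i) => [l ->|->]; [right; exists l|left]. Qed.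

Lemma ord3_cases (l : 'I_3) : [\/ l = 0, l = 1 | l = 2%:R].
Proof.
by case: l => -[|[|[|//]]] h; [constructor 1|constructor 2|constructor 3]; apply/val_inj.
Qed.

Lemma face_cross_lam : n = mu *: (lam T j).1.
Proof.
pose P : V * R := (n, - dot n (col (lift j 0) T)).
pose Q : V * R := (mu *: (lam T j).1, mu * (lam T j).2).
have -> : n = P.1 by []. have -> : mu *: (lam T j).1 = Q.1 by [].
apply: aff_lam_inj => i.
have -> : aff Q (col i T) = mu * aff (lam T j) (col i T) by rewrite /aff dotZl mulrDr.
rewrite lam_vertex //; have -> : aff P (col i T) = dot n (col i T - col (lift j 0) T).
  by rewrite dotBr.
case: (ord4_lift i) => [->|[l ->]]; first by rewrite eqxx mulr1.
rewrite eq_liftF mulr0; case: (ord3_cases l) => ->.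
- by rewrite subrr dot0r.
- exact: dot_crossl.
- exact: dot_crossr.
Qed.

Lemma lam_edge (i l : 'I_3) : dot (lam T (lift j i)).1 (face_edge T j l) =
  (i == l)%:R - (i == 0)%:R.
Proof. by rewrite /face_edge dot_lam_edge // !(inj_eq lift_inj). Qed.

Lemma face_mu_neq0 : mu != 0.
Proof.
apply/eqP => mu0; have := lagrange (face_edge T j 1) (face_edge T j 2%:R)
  (lam T (lift j 1)).1 (lam T (lift j 2%:R)).1.
rewrite -/(face_cross T j) -/n face_cross_lam mu0 scale0r dot0l !(dotC (face_edge _ _ _)).
by rewrite !lam_edge /= !subr0 mul0r subr0 mulr1 => /eqP; rewrite eq_sym oner_eq0.
Qed.

(** The cross product of the edges is a multiple of the gradient of the
    barycentric coordinate, which points inwards. *)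
Lemma flux_coefE om : enorm (face_cross T j) * dot (exterior_normal T j) om =
  - (`|mu| * dot (lam T j).1 om).
Proof.
rewrite /exterior_normal -/n -/mu dotZl mulNr mulrN.
have [e0|e0] := eqVneq (enorm n) 0.
  have n0 : n = 0.
    by apply/eqP; apply: contraLR isT => /dot_gt0; rewrite -enorm_sqr e0 mul0r ltxx.
  have -> : mu = 0 by rewrite /mu n0 dot0l.
  by rewrite e0 normr0 !mul0r.
congr (- _); rewrite mulrA mulrCA mulfV // mulr1 {1}face_cross_lam dotZl mulrA.
by rewrite -normrEsg.
Qed.

Lemma lam_face_point (st : R * R) i : aff (lam T i) (face_point T j st) =
  (i == lift j 0)%:R * (1 - st.1 - st.2) + (i == lift j 1)%:R * st.1 +
  (i == lift j 2%:R)%:R * st.2.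
Proof.
rewrite /face_point !affD !dotZr lam_vertex // /face_edge !dot_lam_edge //.
by ring.
Qed.

Lemma face_point_face (st : R * R) : face T j (face_point T j st) <->
  [/\ 0 <= st.1, 0 <= st.2 & st.1 + st.2 <= 1].
Proof.
have l i : aff (lam T (lift j i)) (face_point T j st) =
  (i == 0)%:R * (1 - st.1 - st.2) + (i == 1)%:R * st.1 + (i == 2%:R)%:R * st.2.
  by rewrite lam_face_point !(inj_eq lift_inj).
split.
  move=> /faceP => /(_ ndT)[h _]; have := h (lift j 0); have := h (lift j 1).
  have := h (lift j 2%:R); rewrite !l /= !mul1r !mul0r !add0r !addr0.
  by move=> h2 h1 h0; split => //; lra.
move=> [h1 h2 h3]; apply/faceP => //.
split; last by rewrite lam_face_point !eq_liftF !mul0r !addr0.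
move=> i; case: (ord4_lift i) => [->|[m ->]].
  by rewrite lam_face_point !eq_liftF !mul0r !addr0.
by rewrite l; case: (ord3_cases m) => -> /=; rewrite !mul1r !mul0r ?add0r ?addr0 //; lra.
Qed.

Lemma lam_face_point0 st : aff (lam T j) (face_point T j st) = 0.
Proof. by rewrite lam_face_point !eq_liftF !mul0r !addr0. Qed.

End Faces.

(** * From lines to volumes and faces *)

Section NullSeq.
Context d (T : measurableType d) (R : realType) (mu : {measure set T -> \bar R}).

Lemma null_seq (I : eqType) (s : seq I) (A : I -> set T) :
  (forall i, i \in s -> measurable (A i) /\ mu (A i) = 0%E) ->
  exists N, [/\ measurable N, mu N = 0%E & forall i, i \in s -> A i `<=` N].
Proof.
elim: s => [|i s IH] h; first by exists set0; split => //; exact: measure0.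
have [|N [mN N0 sN]] := IH; first by move=> j js; apply: h; rewrite inE js orbT.
have [mA A0] := h i (mem_head _ _).
exists (A i `|` N); split; first exact: measurableU.
  by rewrite measureU0.
move=> j; rewrite inE => /predU1P[->|/sN sj]; first exact: subsetUl.
exact: subset_trans sj (@subsetUr _ _ _).
Qed.

End NullSeq.

Section Points.
Variable R : realType.
Notation V := 'cV[R]_3.
Notation T1 := (measurableTypeR R).
Notation T2 := (T1 * T1)%type.
Notation T3 := (T1 * T1 * T1)%type.
Implicit Types (u v w x y n : V) (P Q : V * R).

Lemma point3_0 (p : R * R * R) : point3 p 0 0 = p.1.1.
Proof. by rewrite mxE. Qed.

Lemma point3_1 (p : R * R * R) : point3 p 1 0 = p.1.2.
Proof. by rewrite mxE. Qed.

Lemma point3_2 (p : R * R * R) : point3 p 2%:R 0 = p.2.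
Proof. by rewrite mxE. Qed.

Lemma cV3_ext (x y : V) : x 0 0 = y 0 0 -> x 1 0 = y 1 0 -> x 2%:R 0 = y 2%:R 0 ->
  x = y.
Proof.
move=> h0 h1 h2; apply/matrixP => i j; rewrite ord1.
by case: (ord3_cases i) => ->.
Qed.

Lemma aff_point3 P (p : R * R * R) : aff P (point3 p) =
  P.1 0 0 * p.1.1 + P.1 1 0 * p.1.2 + P.1 2%:R 0 * p.2 + P.2.
Proof. by rewrite /aff dotE point3_0 point3_1 point3_2. Qed.

Lemma measurable_aff3 P : measurable_fun setT (fun p : T3 => aff P (point3 p) : T1).
Proof. by under eq_fun do rewrite aff_point3; exact: measurable_lin3. Qed.

Lemma measurable_tetra T : nondegenerate_tetra T ->
  measurable ((@point3 R : T3 -> V) @^-1` tetra T).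
Proof.
move=> nd; rewrite (_ : _ @^-1` _ = \bigcap_(j in [set: 'I_4])
    ((fun p : T3 => aff (lam T j) (point3 p) : T1) @^-1` `]0, +oo[%classic)).
  apply: fin_bigcap_measurable => // j _.
  by apply: measurable_preimage; [exact: measurable_aff3|exact: measurable_itv].
apply/seteqP; split => p /=.
  by move=> /tetraP => /(_ nd) h j _ /=; rewrite in_itv /= h.
by move=> h; apply/tetraP => // j; have := h j I; rewrite /= in_itv /= andbT.
Qed.

Lemma plane_null P : P.1 != 0 ->
  measurable ([set p : T3 | aff P (point3 p) = 0]) /\
  leb3 R [set p : T3 | aff P (point3 p) = 0] = 0%E.
Proof.
move=> P0; split.
  rewrite (_ : [set p | _] = (fun p : T3 => aff P (point3 p) : T1) @^-1` [set 0]) //.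
  by apply: measurable_preimage; [exact: measurable_aff3|exact: measurable_set1].
rewrite (_ : [set p | _] = [set p : T3 | P.1 0 0 * p.1.1 + P.1 1 0 * p.1.2 + P.1 2%:R 0 * p.2 + P.2 = 0]).
  apply: leb3_plane0; apply: contraNT P0; rewrite !negb_or !negbK => /and3P[/eqP a /eqP b /eqP c].
  by apply/eqP/cV3_ext; rewrite ?a ?b ?c mxE.
by apply/seteqP; split => p /=; rewrite aff_point3.
Qed.

Section Projection.
Variable om : V.
Hypothesis om2 : om 2%:R 0 = 1.

(** Coordinates on the lines of direction [om]: [proj] projects along [om]
    onto the plane of vanishing third coordinate, and [base] embeds that
    plane. *)
Definition base (z : R * R) : V := point3 (z.1, z.2, 0).

Definition proj (x : V) : R * R := (x 0 0 - x 2%:R 0 * om 0 0, x 1 0 - x 2%:R 0 * om 1 0).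

Lemma aff_base P z : aff P (base z) = P.1 0 0 * z.1 + P.1 1 0 * z.2 + P.2.
Proof. by rewrite aff_point3 /= mulr0 addr0. Qed.

Lemma base_line z t : base z + t *: om = point3 (z.1 + om 0 0 * t, z.2 + om 1 0 * t, t).
Proof.
apply: cV3_ext; rewrite !mxE /= ?om2 ?add0r ?mulr1 //; by rewrite mulrC.
Qed.

Lemma base_proj x : base (proj x) + x 2%:R 0 *: om = x.
Proof.
rewrite base_line; apply: cV3_ext; rewrite !mxE //=;
  by rewrite [om _ _ * _]mulrC subrK.
Qed.

Lemma line_plane_null Q : dot Q.1 om = 0 -> Q.1 != 0 ->
  measurable ([set z : T2 | aff Q (base z) = 0]) /\
  leb2 R [set z : T2 | aff Q (base z) = 0] = 0%E.
Proof.
move=> Qom Q0; rewrite (_ : [set z : T2 | _] =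
   [set z : T2 | Q.1 0 0 * z.1 + Q.1 1 0 * z.2 + Q.2 = 0]); last first.
  by apply/seteqP; split => z /=; rewrite aff_base.
split.
  rewrite (_ : [set z | _] = (fun z : T2 => Q.1 0 0 * z.1 + Q.1 1 0 * z.2 + Q.2 : T1) @^-1` [set 0]) //.
  by apply: measurable_preimage; [exact: measurable_lin2|exact: measurable_set1].
apply: leb2_line0; apply: contraNT Q0; rewrite negb_or !negbK => /andP[/eqP a /eqP b].
move: Qom; rewrite dotE a b om2 !mul0r !add0r mulr1 => c.
by apply/eqP/cV3_ext; rewrite ?a ?b ?c mxE.
Qed.

(** A line is bad if it lies in a plane, or meets two nonparallel planes at
    the same point. Either way it lies in one of finitely many planes parallel
    to [om], which project to null sets. *)
Lemma generic_lines (Ps : seq (V * R)) : (forall P, P \in Ps -> P.1 != 0) ->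
  exists N, [/\ measurable N, leb2 R N = 0%E & forall z : T2, ~ N z ->
    exists ts nt, crossings Ps om (base z) ts nt].
Proof.
move=> Ps0.
(* For two planes, the plane parallel to [om] through their intersection: it
   contains the lines of direction [om] that meet both at the same point. *)
pose Q (P P' : V * R) : V * R := (dot P'.1 om *: P.1 - dot P.1 om *: P'.1,
  dot P'.1 om * P.2 - dot P.1 om * P'.2).
pose s := Ps ++ [seq Q P P' | P <- Ps, P' <- Ps].
pose A (P : V * R) : set T2 :=
  if (dot P.1 om == 0) && (P.1 != 0) then [set z : T2 | aff P (base z) = 0] else set0.
have [P _|N [mN N0 sN]] := @null_seq _ T2 R (leb2 R) _ s A.
  rewrite /A; case: ifP => [/andP[/eqP P1 P2]|_]; first exact: line_plane_null.
  by split => //; exact: measure0.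
exists N; split => // z nN.
have good P : P \in s -> dot P.1 om = 0 -> P.1 != 0 -> aff P (base z) != 0.
  move=> Ps' P1 P2; apply/eqP => Pz; apply: nN; apply: (sN P Ps').
  by rewrite /A P1 P2 eqxx.
have trans t P : P \in Ps -> aff P (base z + t *: om) = 0 -> dot P.1 om != 0.
  move=> PPs; rewrite affD dotZr => Pt; apply/eqP => P1.
  have := good P _ P1 (Ps0 P PPs); rewrite mem_cat PPs => /(_ isT).
  by move: Pt; rewrite P1 mulr0 addr0 => ->; rewrite eqxx.
have par t P P' : P \in Ps -> P' \in Ps -> aff P (base z + t *: om) = 0 ->
    aff P' (base z + t *: om) = 0 -> dot P'.1 om *: P.1 = dot P.1 om *: P'.1.
  move=> PPs PPs'; rewrite !affD !dotZr => h h'.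
  have [//|/eqP ne] := pselect (dot P'.1 om *: P.1 = dot P.1 om *: P'.1).
  have := good (Q P P') _ _ _.
  rewrite mem_cat allpairs_f ?orbT //= dotDl dotNl !dotZl => /(_ isT).
  rewrite mulrC subrr subr_eq0 => /(_ erefl ne) /eqP; case.
  rewrite /aff /= dotDl dotNl !dotZl; rewrite /aff in h h'.
  have -> : dot P'.1 om * dot P.1 (base z) - dot P.1 om * dot P'.1 (base z) +
    (dot P'.1 om * P.2 - dot P.1 om * P'.2) =
    dot P'.1 om * (dot P.1 (base z) + P.2 + t * dot P.1 om) -
    dot P.1 om * (dot P'.1 (base z) + P'.2 + t * dot P'.1 om) by ring.
  by rewrite h h' !mulr0 subrr.
pose ts := undup [seq - aff P (base z) / dot P.1 om | P <- Ps & dot P.1 om != 0].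
have hts t : t \in ts -> exists2 P, P \in Ps & aff P (base z + t *: om) = 0.
  rewrite mem_undup => /mapP[P]; rewrite mem_filter => /andP[P1 PPs] ->.
  by exists P => //; rewrite affD dotZr divfK // addrN.
pose nt t : V := xget 0 [set n | exists P, [/\ P \in Ps, aff P (base z + t *: om) = 0 & n = Num.sg (dot P.1 om) *: P.1]].
exists ts, nt; split; first exact: undup_uniq.
  move=> t P PPs h; rewrite mem_undup; apply/mapP; exists P.
    by rewrite mem_filter PPs (trans t P).
  move: h; rewrite affD dotZr => h; have := trans t P PPs.
  rewrite affD dotZr => /(_ h) P1; apply: (mulIf P1); rewrite divfK //.
  by apply/eqP; rewrite -subr_eq0 opprK addrC h.
move=> t /hts[P0 P0s h0].
rewrite /nt; case: xgetP => [n _ [P [PPs h ->]]|/(_ (Num.sg (dot P0.1 om) *: P0.1))]; last first.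
  by case; exists P0.
have P1 := trans t P PPs h.
split; last by rewrite dotZl -normrEsg normr_gt0.
split; first by rewrite scaler_eq0 negb_or sgr_eq0 P1 Ps0.
move=> P' P's h'; exists (dot P'.1 om / `|dot P.1 om|).
have E := par t P P' PPs P's h h'.
apply: (scalerI P1); rewrite -E !scalerA; congr (_ *: _).
have -> : dot P.1 om * (dot P'.1 om / `|dot P.1 om|) * Num.sg (dot P.1 om) =
  dot P'.1 om * (Num.sg (dot P.1 om) * dot P.1 om) / `|dot P.1 om| by ring.
by rewrite -normrEsg mulfK // normr_eq0.
Qed.

Lemma proj_face_point T j st :
  let e1 := face_edge T j 1 in let e2 := face_edge T j 2%:R in
  let p0 := col (lift j 0) T in
  proj (face_point T j st) =
  ((e1 0 0 - e1 2%:R 0 * om 0 0) * st.1 + (e2 0 0 - e2 2%:R 0 * om 0 0) * st.2 +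
     (p0 0 0 - p0 2%:R 0 * om 0 0),
   (e1 1 0 - e1 2%:R 0 * om 1 0) * st.1 + (e2 1 0 - e2 2%:R 0 * om 1 0) * st.2 +
     (p0 1 0 - p0 2%:R 0 * om 1 0)).
Proof.
move=> e1 e2 p0; rewrite /proj /face_point -/e1 -/e2 -/p0.
have E i : (p0 + st.1 *: e1 + st.2 *: e2) i 0 = p0 i 0 + st.1 * e1 i 0 + st.2 * e2 i 0.
  by rewrite !mxE.
by rewrite !E; congr pair; ring.
Qed.

Lemma proj_det T j :
  let e1 := face_edge T j 1 in let e2 := face_edge T j 2%:R in
  (e1 0 0 - e1 2%:R 0 * om 0 0) * (e2 1 0 - e2 2%:R 0 * om 1 0) -
  (e2 0 0 - e2 2%:R 0 * om 0 0) * (e1 1 0 - e1 2%:R 0 * om 1 0) =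
  dot (face_cross T j) om.
Proof. by move=> e1 e2; rewrite /face_cross -/e1 -/e2 dotE !crossE om2; ring. Qed.

Lemma norm_cV3_bound T : nondegenerate_tetra T -> exists K, forall x,
  closure (tetra T) x -> forall i, `|x i 0| <= K.
Proof.
move=> nd; exists (\sum_j \sum_(i < 3) `|T i j|) => x cx i.
have hl := (closure_tetraP nd x).1 cx.
rewrite {1}(bary_comb nd x) summxE (le_trans (ler_norm_sum _ _ _)) // ler_sum // => j _.
rewrite !mxE normrM (ger0_norm (hl j)).
apply: (@le_trans _ _ (1 * `|T i j|)).
  apply: ler_wpM2r => //; rewrite -(bary_sum nd x) (bigD1 j) //= lerDl.
  by apply: sumr_ge0.
by rewrite mul1r (bigD1 i) //= lerDl sumr_ge0.
Qed.

Lemma aff_bound T P : nondegenerate_tetra T -> exists K, forall x,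
  closure (tetra T) x -> `|aff P x| <= K.
Proof.
move=> nd; exists (\sum_j `|aff P (col j T)|) => x cx.
have hl := (closure_tetraP nd x).1 cx.
rewrite (aff_bary nd P) (le_trans (ler_norm_sum _ _ _)) // ler_sum // => j _.
rewrite normrM (ger0_norm (hl j)) ler_piMl //.
by rewrite -(bary_sum nd x) (bigD1 j) //= lerDl sumr_ge0.
Qed.

Lemma face_closure T j x : nondegenerate_tetra T -> face T j x -> closure (tetra T) x.
Proof. by move=> nd /faceP => /(_ nd)[h _]; apply/closure_tetraP. Qed.

Definition volume T : R := fine (leb3 R ((@point3 R : T3 -> V) @^-1` tetra T)).

Lemma volume_lt_top T : nondegenerate_tetra T ->
  (leb3 R ((@point3 R : T3 -> V) @^-1` tetra T) < +oo)%E.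
Proof.
move=> nd; have [K hK] := norm_cV3_bound nd.
pose B : set T1 := `[(- K)%R, K]%classic.
have mB : measurable B by exact: measurable_itv.
have F : (leb1 R B < +oo)%E.
  by rewrite lebesgue_measure_itv /=; case: ifP => _; rewrite ?ltry // -EFinB ltry.
have mBB : measurable (B `*` B : set T2) by exact: measurableX.
have F2 : (leb2 R (B `*` B) < +oo)%E.
  rewrite [X in (X < _)%E]product_measure1E //.
  by apply: lte_mul_pinfty => //; rewrite ge0_fin_numE //; exact: F.
apply: (@le_lt_trans _ _ (leb3 R ((B `*` B) `*` B))).
  apply: le_measure; rewrite ?inE; first exact: measurable_tetra.
    exact: measurableX.
  move=> p /= Tp; have h i := hK _ (subset_closure Tp) i.
  have h0 := h 0; have h1 := h 1; have h2 := h 2%:R.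
  rewrite point3_0 in h0; rewrite point3_1 in h1; rewrite point3_2 in h2.
  by rewrite /B /= !in_itv /= -!ler_norml.
rewrite [X in (X < _)%E]product_measure1E //.
by apply: lte_mul_pinfty => //; rewrite ge0_fin_numE //; exact: F2.
Qed.

Lemma om_neq0 : om != 0.
Proof. by apply/eqP => h; move: om2; rewrite h mxE => /eqP; rewrite eq_sym oner_eq0. Qed.

Definition chord T (z : R * R) : set R := [set t | tetra T (base z + t *: om)].

Lemma chord_finite T z : nondegenerate_tetra T ->
  (leb1 R (chord T z) < +oo)%E.
Proof.
move=> nd; have [->|/set0P h] := eqVneq (chord T z) set0.
  by rewrite measure0.
rewrite /chord; have [a [b [ab ->]]] := line_itv om_neq0 nd h.
by rewrite lebesgue_measure_itv /=; case: ifP => _; rewrite ?ltry // -EFinB ltry.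
Qed.

(** Fubini along the lines of direction [om]. *)
Lemma volume_chords T : nondegenerate_tetra T ->
  (leb2 R).-integrable setT
     (EFin \o (fun z : T2 => fine (leb1 R (chord T z)))) /\
  volume T = \int[leb2 R]_z fine (leb1 R (chord T z)).
Proof.
move=> nd; have mT := measurable_tetra nd.
have E (z : T2) : (fine (leb1 R (chord T z)))%:E =
   leb1 R (chord T z).
  by rewrite fineK // ge0_fin_numE ?chord_finite.
have S : (fun z : T2 => leb1 R (chord T z)) =
  (fun z : T2 => leb1 R (xsection ((fun p : T3 =>
    (p.1.1 + om 0 0 * p.2, p.1.2 + om 1 0 * p.2, p.2) : T3) @^-1` ((@point3 R : T3 -> V) @^-1` tetra T)) z)).
  apply/funext => z; congr (leb1 R _); apply/seteqP; split => t; by rewrite /xsection /= inE /chord /= base_line.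
have V1 : leb3 R ((@point3 R : T3 -> V) @^-1` tetra T) =
   (\int[leb2 R]_z leb1 R (chord T z))%E.
  rewrite (leb3_lines (om 0 0) (om 1 0) mT); apply: eq_integral => z _.
  by congr (leb1 R _); apply/seteqP; split => t; rewrite /chord /= base_line.
have mf : measurable_fun [set: T2] (fun z : T2 => leb1 R (chord T z)).
  rewrite S; apply: measurable_fun_xsection; apply: measurable_preimage mT.
  exact: measurable_shear3.
split; last first.
  by rewrite /volume V1 /Rintegral; congr fine; apply: eq_integral => z _; rewrite E.
apply/integrableP; split.
  by rewrite (_ : EFin \o _ = (fun z : T2 => leb1 R (chord T z))) //; apply/funext => z /=; rewrite E.
rewrite (_ : (\int[_]_z _)%E = leb3 R ((@point3 R : T3 -> V) @^-1` tetra T)); first exact: volume_lt_top.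
by rewrite V1; apply: eq_integral => z _ /=; rewrite -E /= ger0_norm // fine_ge0.
Qed.

Section FacetFlux.
Variables (f : 'M[R]_(3, 4) * 'I_4) (T : 'M[R]_(3, 4)) (W : V * R).
Hypotheses (ndf : nondegenerate_tetra f.1) (ndT : nondegenerate_tetra T).

Let x (z : R * R) : V := crossing_point om (base z) f.
Let A : set T2 := [set z | face f.1 f.2 (x z) /\ closure (tetra T) (x z)].

Definition facet_trace (z : T2) : R := if `[< A z >] then aff W (x z) else 0.

Lemma measurable_crossing Q : measurable_fun setT (fun z : T2 => aff Q (x z) : T1).
Proof.
set d := dot (interior_side f) om.
have -> : (fun z => aff Q (x z)) = (fun z : T2 =>
  (Q.1 0 0 - (lam f.1 f.2).1 0 0 / d * dot Q.1 om) * z.1 +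
  (Q.1 1 0 - (lam f.1 f.2).1 1 0 / d * dot Q.1 om) * z.2 +
  (Q.2 - (lam f.1 f.2).2 / d * dot Q.1 om)).
  apply/funext => z; rewrite /x /crossing_point -/d affD dotZr !aff_base.
  by ring.
exact: measurable_lin2.
Qed.

Lemma measurable_facet : measurable A.
Proof.
have m1 Q : measurable [set z : T2 | 0 <= aff Q (x z)].
  rewrite (_ : [set z | _] = (fun z : T2 => aff Q (x z) : T1) @^-1` `[0, +oo[%classic).
    by apply: measurable_preimage; [exact: measurable_crossing|exact: measurable_itv].
  by apply/seteqP; split => z /=; rewrite in_itv /= andbT.
have m0 Q : measurable [set z : T2 | aff Q (x z) = 0].
  rewrite (_ : [set z | _] = (fun z : T2 => aff Q (x z) : T1) @^-1` [set 0]) //.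
  by apply: measurable_preimage; [exact: measurable_crossing|exact: measurable_set1].
have mT T' : measurable (\bigcap_(i in [set: 'I_4]) [set z : T2 | 0 <= aff (lam T' i) (x z)]).
  by apply: fin_bigcap_measurable.
rewrite (_ : A = ((\bigcap_(i in [set: 'I_4]) [set z : T2 | 0 <= aff (lam f.1 i) (x z)]) `&`
   [set z : T2 | aff (lam f.1 f.2) (x z) = 0]) `&`
   \bigcap_(i in [set: 'I_4]) [set z : T2 | 0 <= aff (lam T i) (x z)]).
  by apply: measurableI => //; apply: measurableI.
apply/seteqP; split => z /=.
  move=> [fz cz]; have [h h0] := (faceP ndf _ _).1 fz; have h1 := (closure_tetraP ndT _).1 cz.
  by split; [split|] => // i _ /=.
move=> [[h h0] h1]; split.
  by apply/faceP => //; split => // i; exact: h.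
by apply/closure_tetraP => // i; exact: h1.
Qed.

Lemma facet_trace_integrable : (leb2 R).-integrable setT (EFin \o facet_trace).
Proof.
have [K hK] := norm_cV3_bound ndf; have [C hC] := aff_bound W ndf.
have C0 : 0 <= C by apply: le_trans (hC _ (subset_closure (tetra_centroid ndf))).
apply: (@leb2_integrable_bounded _ _ (K + K * (`|om 0 0| + `|om 1 0|)) C).
- have -> : facet_trace = (fun z => aff W (x z) * \1_A z).
    apply/funext => z; rewrite /facet_trace indicE; case: asboolP => Az.
      by rewrite mem_set // mulr1.
    by rewrite memNset // mulr0.
  apply: measurable_funM; first exact: measurable_crossing.
  by apply: measurable_indic; exact: measurable_facet.
- move=> z; rewrite /facet_trace; case: asboolP => [[fz _]|_]; last by rewrite normr0.
  exact: hC (face_closure ndf fz).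
- move=> z; rewrite /facet_trace; case: asboolP => [[fz _] _|_]; last by rewrite eqxx.
  have h i := hK _ (face_closure ndf fz) i.
  have K0 : 0 <= K by exact: le_trans (h 0).
  have px : proj (x z) = z.
    rewrite /x /crossing_point; set t := (_ / _); rewrite /proj base_line !mxE /=.
    by rewrite [RHS]surjective_pairing; congr pair; ring.
  have bd i : `|x z i 0 - x z 2%:R 0 * om i 0| <= K + K * `|om i 0|.
    rewrite (le_trans (ler_normB _ _)) // lerD //.
    by rewrite normrM ler_wpM2r.
  have E1 : z.1 = x z 0 0 - x z 2%:R 0 * om 0 0 by rewrite -{1}px.
  have E2 : z.2 = x z 1 0 - x z 2%:R 0 * om 1 0 by rewrite -{1}px.
  have n0 := normr_ge0 (om 0 0); have n1 := normr_ge0 (om 1 0).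
  by rewrite E1 E2; split; rewrite (le_trans (bd _)) // lerD2l ler_wpM2l // ?lerDl ?lerDr.
Qed.

(** The flux of [W om] through a face, in the parameters of the face and in
    the projection along [om]: the determinant of the change of variables is
    the flux of [om] through the face. *)
Lemma facet_flux :
  enorm (face_cross f.1 f.2) * dot (exterior_normal f.1 f.2) om *
    \int[leb2 R]_(st in [set st : R * R | [/\ 0 <= st.1, 0 <= st.2,
        st.1 + st.2 <= 1 & closure (tetra T) (face_point f.1 f.2 st)]])
      aff W (face_point f.1 f.2 st) =
  Num.sg (- dot (interior_side f) om) * \int[leb2 R]_z facet_trace z.
Proof.
rewrite flux_coefE // -/(interior_side f).
have [->|d0] := eqVneq (dot (interior_side f) om) 0.
  by rewrite mulr0 oppr0 sgr0 !mul0r.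
have mu0 := face_mu_neq0 f.2 ndf.
set mu := dot _ (_ - _) in mu0 *.
pose e1 := face_edge f.1 f.2 1; pose e2 := face_edge f.1 f.2 2%:R.
have detE := proj_det f.1 f.2; rewrite /= in detE.
have crossE : dot (face_cross f.1 f.2) om = mu * dot (interior_side f) om.
  by rewrite face_cross_lam // dotZl.
have cross0 : dot (face_cross f.1 f.2) om != 0 by rewrite crossE mulf_neq0.
have D0 := cross0; rewrite -detE in D0.
have := Rintegral2_affine (col (lift f.2 0) f.1 0 0 - col (lift f.2 0) f.1 2%:R 0 * om 0 0)
  (col (lift f.2 0) f.1 1 0 - col (lift f.2 0) f.1 2%:R 0 * om 1 0) D0 facet_trace_integrable.
rewrite detE => H.
have -> : \int[leb2 R]_(st in [set st : R * R | [/\ 0 <= st.1, 0 <= st.2,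
        st.1 + st.2 <= 1 & closure (tetra T) (face_point f.1 f.2 st)]])
      aff W (face_point f.1 f.2 st) = `|dot (face_cross f.1 f.2) om|^-1 * \int[leb2 R]_z facet_trace z.
  rewrite -H Rintegral_mkcond; apply: eq_Rintegral => st _.
  have := proj_face_point f.1 f.2 st; rewrite /= => <-.
  have xE : x (proj (face_point f.1 f.2 st)) = face_point f.1 f.2 st.
    rewrite /x /crossing_point -[RHS]base_proj; congr (_ + _ *: _).
    have := lam_face_point0 f.2 ndf st; rewrite -{1}(base_proj (face_point f.1 f.2 st)) affD dotZr.
    by move=> /eqP; rewrite addr_eq0 => /eqP ->; rewrite opprK mulfK.
  rewrite /facet_trace /A /= xE patchE; case: ifPn.
    by rewrite inE /= => -[h1 h2 h3 h4]; case: asboolP => // -[]; split => //; exact/face_point_face.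
  rewrite notin_setE /= => h; case: asboolP => // -[h1 h2]; exfalso; apply: h.
  by have [] := (face_point_face f.2 ndf st).1 h1.
rewrite crossE normrM mulrA sgrN; congr (_ * _).
have nmu : `|mu| != 0 by rewrite normr_eq0.
have nd0 : `|dot (interior_side f) om| != 0 by rewrite normr_eq0.
rewrite {1}[dot (interior_side f) om]numEsg; field; by rewrite nmu nd0.
Qed.

End FacetFlux.

End Projection.
End Points.

(** * Divergence theorem for piecewise affine functions *)

Section FluxTheorem.
Variable R : realType.
Notation V := 'cV[R]_3.
Notation tet := 'M[R]_(3, 4).
Notation T1 := (measurableTypeR R).
Notation T2 := (T1 * T1)%type.
Notation T3 := (T1 * T1 * T1)%type.

(** Flux of the vector [om] through a face, per unit of parameter area. *)
Definition face_flux (f : tet * 'I_4) (om : V) : R :=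
  enorm (face_cross f.1 f.2) * dot (exterior_normal f.1 f.2) om.

(** Integral in the parameters of the face; the area element is part of
    [face_flux]. *)
Definition face_int (f : tet * 'I_4) (S : set V) (W : V * R) : R :=
  \int[leb2 R]_(st in [set st : R * R | [/\ 0 <= st.1, 0 <= st.2,
      st.1 + st.2 <= 1 & S (face_point f.1 f.2 st)]])
    aff W (face_point f.1 f.2 st).

Lemma face_fluxZ f (c : R) om : face_flux f (c *: om) = c * face_flux f om.
Proof. by rewrite /face_flux dotZr mulrCA. Qed.

Variables (Oa : set V) (Ps : seq (V * R)) (Fs : seq (tet * 'I_4)).
Hypotheses (oOa : open Oa) (Ps0 : forall P, P \in Ps -> P.1 != 0).
Hypothesis FsH : boundary_faces Oa Ps Fs.

(** Integral of [line_flux] over all lines of direction [om]. *)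
Lemma divergence_theorem1 fam (om : V) : affine_family Oa Ps fam -> om 2%:R 0 = 1 ->
  \sum_(e <- fam) volume e.1 * dot e.2.1 om =
  \sum_(f <- Fs) face_flux f om *
    \sum_(e <- fam) face_int f (closure (tetra e.1)) e.2.
Proof.
move=> famH om2; have [ufam fH _ _ _] := famH; have [uF FH _ _ _] := FsH.
have nde e : e \in fam -> nondegenerate_tetra e.1 by move=> /fH[].
have ndf f : f \in Fs -> nondegenerate_tetra f.1 by move=> /FH[].
have [N [mN N0 hN]] := generic_lines om2 Ps0.
have [S1 _] := @Rintegral_sum _ T2 R (leb2 R) _ fam (fun e => dot e.2.1 om)
  (fun e z => fine (leb1 R (chord om e.1 z)))
  (fun e ef => (volume_chords om2 (nde e ef)).1).
transitivity (\int[leb2 R]_z \sum_(e <- fam) dot e.2.1 om * fine (leb1 R (chord om e.1 z))).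
  rewrite S1; apply: eq_big_seq => e ef; rewrite mulrC; congr (_ * _).
  exact: (volume_chords om2 (nde e ef)).2.
pose s := [seq (f, e) | f <- Fs, e <- fam].
pose h (fe : tet * 'I_4 * (tet * (V * R))) := facet_trace om fe.1 fe.2.1 fe.2.2.
have hi fe : fe \in s -> (leb2 R).-integrable setT (EFin \o h fe).
  move=> /allpairsP[[f e] /= [fF ef ->]].
  exact: (facet_trace_integrable om2 _ (ndf f fF) (nde e ef)).
have [S2 _] := @Rintegral_sum _ T2 R (leb2 R) _ s
  (fun fe => Num.sg (- dot (interior_side fe.1) om)) h hi.
transitivity (\int[leb2 R]_z \sum_(fe <- s) Num.sg (- dot (interior_side fe.1) om) * h fe z).
  apply: (@Rintegral_null_ext _ T2 R (leb2 R) N setT) => // z nz.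
  rewrite patchE mem_setT; have [ts [nt tsH]] := hN z nz.
  rewrite (line_flux famH FsH oOa (om_neq0 om2) tsH) big_allpairs.
  apply: eq_bigr => f _; rewrite mulr_sumr /=.
  rewrite big_mkcond /=; apply: eq_bigr => e _; rewrite /h /facet_trace /=.
  by case: asboolP => //; rewrite mulr0.
rewrite S2 big_allpairs; apply: eq_big_seq => f fF.
rewrite mulr_sumr; apply: eq_big_seq => e ef; rewrite /h /=.
by rewrite -(facet_flux om2 _ (ndf f fF) (nde e ef)).
Qed.

Lemma divergence_theorem fam (om : V) : affine_family Oa Ps fam -> om 2%:R 0 != 0 ->
  \sum_(e <- fam) volume e.1 * dot e.2.1 om =
  \sum_(f <- Fs) face_flux f om *
    \sum_(e <- fam) face_int f (closure (tetra e.1)) e.2.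
Proof.
move=> famH om0; set c := om 2%:R 0 in om0.
have omE : om = c *: (c^-1 *: om) by rewrite scalerA divff // scale1r.
have h := @divergence_theorem1 fam (c^-1 *: om) famH _.
rewrite {1}omE; under eq_bigr do rewrite dotZr mulrCA.
rewrite -mulr_sumr h ?mxE ?mulVf //.
rewrite mulr_sumr [RHS](eq_bigr (fun f => c * (face_flux f (c^-1 *: om) *
   \sum_(e <- fam) face_int f (closure (tetra e.1)) e.2))) //.
by move=> f _; rewrite mulrA -face_fluxZ -omE.
Qed.

(** A plane that is not parallel to the face meets it in a null set. *)
Lemma generic_face_points f : f \in Fs ->
  exists N, [/\ measurable N, leb2 R N = 0%E & forall st : T2, ~ N st ->
    generic Ps (face_point f.1 f.2 st) (interior_side f)].
Proof.
move=> fF; have [_ /(_ f fF)[nd pl] _ _ _] := FsH.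
pose e1 := face_edge f.1 f.2 1; pose e2 := face_edge f.1 f.2 2%:R.
pose A (P : V * R) : set T2 :=
  if (dot P.1 e1 != 0) || (dot P.1 e2 != 0)
  then [set st : T2 | aff P (face_point f.1 f.2 st) = 0] else set0.
have E P st : aff P (face_point f.1 f.2 st) =
  dot P.1 e1 * st.1 + dot P.1 e2 * st.2 + aff P (col (lift f.2 0) f.1).
  by rewrite /face_point !affD !dotZr -/e1 -/e2; ring.
have [P _|N [mN N0 sN]] := @null_seq _ T2 R (leb2 R) _ Ps A.
  rewrite /A; case: ifP => [h|_]; last by split => //; exact: measure0.
  rewrite (_ : [set st : T2 | _] = [set z : T2 | dot P.1 e1 * z.1 + dot P.1 e2 * z.2 + aff P (col (lift f.2 0) f.1) = 0]); last first.
    by apply/seteqP; split => st /=; rewrite E.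
  split; last exact: leb2_line0.
  rewrite (_ : [set z | _] = (fun z : T2 => dot P.1 e1 * z.1 + dot P.1 e2 * z.2 + aff P (col (lift f.2 0) f.1) : T1) @^-1` [set 0]) //.
  by apply: measurable_preimage; [exact: measurable_lin2|exact: measurable_set1].
exists N; split => // st nst; split; first exact: lam_neq0.
move=> P PPs P0.
have [h|h] := boolP ((dot P.1 e1 != 0) || (dot P.1 e2 != 0)).
  by exfalso; apply: nst; apply: (sN P PPs); rewrite /A h.
move: h; rewrite negb_or !negbK => /andP[/eqP d1 /eqP d2].
exists (aff P (col f.2 f.1)).
pose Q : V * R := (aff P (col f.2 f.1) *: (lam f.1 f.2).1, aff P (col f.2 f.1) * (lam f.1 f.2).2).
have -> : aff P (col f.2 f.1) *: interior_side f = Q.1 by [].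
apply: (aff_lam_inj nd) => i.
have -> : aff Q (col i f.1) = aff P (col f.2 f.1) * aff (lam f.1 f.2) (col i f.1) by rewrite /aff dotZl mulrDr.
rewrite lam_vertex //; case: (ord4_lift f.2 i) => [->|[l ->]]; first by rewrite eqxx mulr1.
rewrite eq_liftF mulr0.
have P00 : aff P (col (lift f.2 0) f.1) = 0 by move: P0; rewrite E d1 d2 !mul0r !add0r.
have el (m : 'I_3) : aff P (col (lift f.2 m) f.1) = aff P (col (lift f.2 0) f.1) + dot P.1 (face_edge f.1 f.2 m).
  by rewrite -affD /face_edge addrC subrK.
by rewrite el P00; case: (ord3_cases l) => ->; rewrite ?d1 ?d2 ?addr0 // /face_edge subrr dot0r addr0.
Qed.

(** The pieces [S i] may overlap along segments, as closed tetrahedra do. *)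
Lemma face_int_partition (I : eqType) (r : seq I) (f : tet * 'I_4) (S : I -> set V) (S0 : set V)
    (W : I -> V * R) (W0 : V * R) N :
  (forall i, i \in r -> (leb2 R).-integrable setT (EFin \o
     ((fun st : T2 => aff (W i) (face_point f.1 f.2 st)) \_
      [set st : T2 | [/\ 0 <= st.1, 0 <= st.2, st.1 + st.2 <= 1 & S i (face_point f.1 f.2 st)]]))) ->
  measurable N -> leb2 R N = 0%E ->
  (forall st : T2, ~ N st -> 0 <= st.1 -> 0 <= st.2 -> st.1 + st.2 <= 1 ->
     \sum_(i <- r | `[< S i (face_point f.1 f.2 st) >]) aff (W i) (face_point f.1 f.2 st) =
     if `[< S0 (face_point f.1 f.2 st) >] then aff W0 (face_point f.1 f.2 st) else 0) ->
  \sum_(i <- r) face_int f (S i) (W i) = face_int f S0 W0.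
Proof.
move=> hi mN N0 h.
have [S1 _] := @Rintegral_sum _ T2 R (leb2 R) _ r (fun=> 1) _ hi.
have -> : \sum_(i <- r) face_int f (S i) (W i) =
  \sum_(i <- r) 1 * \int[leb2 R]_st ((fun st : T2 => aff (W i) (face_point f.1 f.2 st)) \_
      [set st : T2 | [/\ 0 <= st.1, 0 <= st.2, st.1 + st.2 <= 1 & S i (face_point f.1 f.2 st)]]) st.
  by apply: eq_bigr => i _; rewrite mul1r /face_int Rintegral_mkcond.
rewrite -S1; apply/esym.
apply: (@Rintegral_null_ext _ T2 R (leb2 R) N) => // st nst.
have [D|nD] := pselect [/\ 0 <= st.1, 0 <= st.2 & st.1 + st.2 <= 1]; last first.
  rewrite patchE memNset; last by move=> -[a b c _]; apply: nD.
  rewrite big1 // => i _; rewrite patchE memNset ?mulr0 //.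
  by move=> -[a b c _]; apply: nD.
have [D1 D2 D3] := D; have := h st nst D1 D2 D3; rewrite patchE.
rewrite [X in X = _ -> _]big_mkcond /= => hh.
transitivity (if `[< S0 (face_point f.1 f.2 st) >] then aff W0 (face_point f.1 f.2 st) else 0).
  by case: asboolP => s0; [rewrite mem_set|rewrite memNset // => -[]].
rewrite -hh; apply: eq_bigr => i _; rewrite mul1r patchE.
by case: asboolP => s0; [rewrite mem_set|rewrite memNset // => -[]].
Qed.

End FluxTheorem.

(** * Interpolation and type A decompositions *)

Section Polyhedra.
Variable R : realType.
Notation V := 'cV[R]_3.

Definition polyhedron (L : seq (V * R)) : set V :=
  [set x | forall P, P \in L -> 0 < aff P x].
Definition cpolyhedron (L : seq (V * R)) : set V :=
  [set x | forall P, P \in L -> 0 <= aff P x].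

(** Segments towards an interior point stay in the open polyhedron. *)
Lemma closure_polyhedron L : polyhedron L !=set0 ->
  closure (polyhedron L) = cpolyhedron L.
Proof.
move=> [g hg]; apply/seteqP; split => x.
  move=> h P PL; rewrite leNgt; apply/negP => /aff_near_lt /h[z [hz z0]].
  by have := hz P PL; rewrite /= ltNge ltW.
move=> h B /(near_segment (g - x)) hB.
have : \forall s \near (0 : R)^'+, 0 < s < 1.
  near=> s; apply/andP; split; near: s; [exact: nbhs_right_gt|exact: nbhs_right_lt].
move=> /(filterI hB)/filter_ex[s [Bs /andP[s0 s1]]].
exists (x + s *: (g - x)); split => // P PL; rewrite affD dotZr -affB.
have -> : aff P x + s * (aff P g - aff P x) = (1 - s) * aff P x + s * aff P g by ring.
apply: ltr_wpDl; last by apply: mulr_gt0 => //; exact: hg.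
by apply: mulr_ge0; [rewrite subr_ge0 ltW|exact: h].
Unshelve. all: by end_near. Qed.

End Polyhedra.

Notation o4 i := (@Ordinal 4 i isT).

Section Interp.
Variables (R : realType) (k : nat).
Hypothesis k0 : (0 < k)%N.
Notation V := 'cV[R]_3.
Notation Zv := 'cV[int]_3.
Notation eps := (eps R k).
Notation node := (node R k).
Implicit Types (y v : Zv -> V) (l eta : Zv) (T : 'M[R]_(3, 4)).

Lemma eps_gt0 : 0 < eps.
Proof. by rewrite invr_gt0 ltr0n. Qed.

Lemma eps_neq0 : eps != 0.
Proof. by rewrite gt_eqF // eps_gt0. Qed.

Lemma nodeE l (i : 'I_3) j : node l i j = eps * (l i 0)%:~R.
Proof. by rewrite !mxE ord1. Qed.

Lemma node_inj : injective node.
Proof.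
move=> l l' /matrixP h; apply/matrixP => i j; rewrite ord1.
have := h i 0; rewrite !nodeE => /(mulfI eps_neq0); exact: intr_inj.
Qed.

(** Evaluation of a lattice function at a point of space; [xget] inverts the
    injective map [node]. *)
Definition nodeval y (x : V) : V := y (xget 0 [set l | node l = x]).

Lemma nodevalE y l : nodeval y (node l) = y l.
Proof.
by rewrite /nodeval; case: xgetP => [l' _ /= /node_inj ->|/(_ l) []].
Qed.

(** The affine interpolant of [y] on [T], extended to the whole space;
    [dinterp] is its linear part. *)
Definition interp y T (x : V) : V := \sum_j aff (lam T j) x *: nodeval y (col j T).
Definition dinterp y T (u : V) : V :=
  \sum_j dot (lam T j).1 u *: nodeval y (col j T).

Definition interp_fun y T (i : 'I_3) : V * R :=
  (\sum_j nodeval y (col j T) i 0 *: (lam T j).1,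
   \sum_j nodeval y (col j T) i 0 * (lam T j).2).

Lemma aff_interp_fun y T i x : aff (interp_fun y T i) x = interp y T x i 0.
Proof.
rewrite /aff /interp dotC dot_sumr -big_split summxE; apply: eq_bigr => j _.
by rewrite [RHS]mxE [RHS]mulrC mulrDr dotZr [dot x _]dotC.
Qed.

Lemma dot_interp_fun y T i u : dot (interp_fun y T i).1 u = dinterp y T u i 0.
Proof.
rewrite dotC dot_sumr /dinterp summxE; apply: eq_bigr => j _.
by rewrite dotZr [RHS]mxE dotC; ring.
Qed.

Lemma interpD y T x u : interp y T (x + u) = interp y T x + dinterp y T u.
Proof.
by rewrite /interp /dinterp -big_split; apply: eq_bigr => j _; rewrite affD scalerDl.
Qed.

Lemma dinterpZ y T (c : R) u : dinterp y T (c *: u) = c *: dinterp y T u.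
Proof. by rewrite scaler_sumr; apply: eq_bigr => j _; rewrite dotZr scalerA. Qed.

Definition lattice_vertices T := forall j, exists l, col j T = node l.

Section Nondeg.
Variable T : 'M[R]_(3, 4).
Hypothesis ndT : nondegenerate_tetra T.

Lemma interp_sum (I : finType) y (a : I -> R) (p : I -> V) : \sum_i a i = 1 ->
  interp y T (\sum_i a i *: p i) = \sum_i a i *: interp y T (p i).
Proof.
move=> a1; rewrite /interp; under eq_bigr do rewrite aff_sum // scaler_suml.
rewrite exchange_big; apply: eq_bigr => i _; rewrite scaler_sumr.
by apply: eq_bigr => j _; rewrite scalerA.
Qed.

Lemma interp_vertex y j : interp y T (col j T) = nodeval y (col j T).
Proof.
rewrite /interp (bigD1 j) //= lam_vertex // eqxx scale1r big1 ?addr0 // => i ij.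
by rewrite lam_vertex // (negbTE ij) scale0r.
Qed.

Lemma interp_comb (I : finType) y (a : I -> R) (p : I -> V) :
  (forall i, 0 <= a i) -> \sum_i a i = 1 ->
  (forall i, 0 < a i -> exists j, p i = col j T) ->
  closure (tetra T) (\sum_i a i *: p i) /\
  interp y T (\sum_i a i *: p i) = \sum_i a i *: nodeval y (p i).
Proof.
move=> a0 a1 ap; split; last first.
  rewrite interp_sum //; apply: eq_bigr => i _.
  have := a0 i; rewrite le_eqVlt => /predU1P[<-|/ap[j ->]]; first by rewrite !scale0r.
  by rewrite interp_vertex.
apply/closure_tetraP => // j; rewrite aff_sum //; apply: sumr_ge0 => i _.
have := a0 i; rewrite le_eqVlt => /predU1P[<-|/[dup] ai /ap[j' ->]]; first by rewrite mul0r.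
by rewrite lam_vertex // mulr_ge0.
Qed.

Lemma interp_unique y (w : V -> V) : lattice_vertices T ->
  affine_interpolant k y T w -> forall x, tetra T x -> w x = interp y T x.
Proof.
move=> lat [G [c [hw hv]]] x Tx; rewrite hw // {1}(bary_comb ndT x).
rewrite mulmx_sumr -[c]scale1r -(bary_sum ndT x) scaler_suml -big_split.
apply: eq_bigr => j _; rewrite /= -scalemxAr -scalerDr; congr (_ *: _).
by have [l jl] := lat j; rewrite jl nodevalE -(hv j l jl).
Qed.

Lemma interp_yt (F : 'M[R]_3) v (t : R) x : lattice_vertices T ->
  interp (fun l => F *m node l + t *: v l) T x = F *m x + t *: interp v T x.
Proof.
move=> lat; rewrite {2}(bary_comb ndT x) mulmx_sumr scaler_sumr -big_split.
apply: eq_bigr => j _; have [l ->] := lat j.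
rewrite !nodevalE; move: (node l) => p.
by rewrite scalerDr -scalemxAr !scalerA [t * _]mulrC.
Qed.

Lemma dinterp_yt (F : 'M[R]_3) v (t : R) u : lattice_vertices T ->
  dinterp (fun l => F *m node l + t *: v l) T u = F *m u + t *: dinterp v T u.
Proof.
move=> lat; have E y : dinterp y T u = interp y T (0 + u) - interp y T 0.
  by rewrite interpD addrAC subrr add0r.
by rewrite !E !interp_yt // add0r mulmx0 add0r scalerBr addrA.
Qed.

End Nondeg.

(** The value of an interpolant at [x] depends only on the vertices that carry
    [x]. *)
Lemma interp_agree T T' y x : nondegenerate_tetra T -> nondegenerate_tetra T' ->
  closure (tetra T) x ->
  (forall j, 0 < aff (lam T j) x -> exists j', col j T = col j' T') ->
  closure (tetra T') x /\ interp y T x = interp y T' x.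
Proof.
move=> nd nd' cx h; have [h1 h2] := @interp_comb T' nd' _ y
  (fun j => aff (lam T j) x) (fun j => col j T)
  ((closure_tetraP nd x).1 cx) (bary_sum nd x) h.
by rewrite -(bary_comb nd) in h1 h2.
Qed.

Section TypeA.
Variables (l eta : Zv).
Implicit Types (x : V) (a : 'cV[R]_4) (s : 'S_3).
Hypothesis eta0 : forall i, eta i 0 != 0.

(** Affine coordinates in which the bond volume is the unit cube. *)
Definition theta (i : 'I_3) : V * R :=
  ((eps * (eta i 0)%:~R)^-1 *: delta_mx i 0, - (l i 0)%:~R / (eta i 0)%:~R).

Lemma etaR_neq0 i : ((eta i 0)%:~R : R) != 0.
Proof. by rewrite intr_eq0. Qed.

Lemma thetaE i x : aff (theta i) x = (x i 0 / eps - (l i 0)%:~R) / (eta i 0)%:~R.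
Proof.
rewrite /aff /theta /= dotZl dotC dot_delta; have := etaR_neq0 i; have := eps_neq0.
by move=> h1 h2; field; rewrite h1 h2.
Qed.

Lemma thetaK i (x : V) : x i 0 = eps * ((l i 0)%:~R + (eta i 0)%:~R * aff (theta i) x).
Proof.
rewrite thetaE; have := etaR_neq0 i; have := eps_neq0.
by move=> h1 h2; field; rewrite h1 h2.
Qed.

Lemma theta_inj x x' : (forall i, aff (theta i) x = aff (theta i) x') -> x = x'.
Proof. by move=> h; apply/matrixP => i j; rewrite ord1 (thetaK i x) h -thetaK. Qed.

(** Partial sums of the barycentric coordinates; along the path of vertices of
    a type A tetrahedron they are the coordinates [theta]. *)
Definition tail (a : 'cV[R]_4) (m : nat) : R := \sum_(j < 4 | (m <= j)%N) a j 0.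

Lemma sum4 (f : 'I_4 -> R) :
  \sum_i f i = f (o4 0) + f (o4 1) + f (o4 2) + f (o4 3).
Proof.
rewrite !big_ord_recl big_ord0 addr0 !addrA.
by congr (f _ + f _ + f _ + f _); apply/val_inj.
Qed.

Lemma tailE (a : 'cV[R]_4) : [/\ tail a 0%N = a (o4 0) 0 + a (o4 1) 0 + a (o4 2) 0 + a (o4 3) 0,
  tail a 1%N = a (o4 1) 0 + a (o4 2) 0 + a (o4 3) 0, tail a 2%N = a (o4 2) 0 + a (o4 3) 0,
  tail a 3%N = a (o4 3) 0 & tail a 4%N = 0].
Proof. by split; rewrite /tail big_mkcond sum4 /= ?add0r ?addr0. Qed.

Lemma sum_typeA (c p q : R) (b : pred 'I_4) (a : 'cV[R]_4) :
  \sum_j (c * (p + if b j then q else 0)) * a j 0 =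
  c * (p * (\sum_j a j 0) + q * (\sum_(j | b j) a j 0)).
Proof.
rewrite (eq_bigr (fun j => c * p * a j 0 + (if b j then c * q * a j 0 else 0))).
  by rewrite big_split -mulr_sumr -big_mkcond -mulr_sumr /=; ring.
by move=> j _; case: ifP => _; ring.
Qed.

Lemma typeA_mul s (a : 'cV[R]_4) i : (typeA R k l eta s *m a) i 0 =
   eps * ((l i 0)%:~R * (\sum_j a j 0) + (eta i 0)%:~R * tail a (s i).+1).
Proof.
rewrite mxE /tail -sum_typeA; apply: eq_bigr => j _; congr (_ * _).
by rewrite mxE rmorphD /=; case: ifP.
Qed.

Lemma theta_typeA s (a : 'cV[R]_4) i : \sum_j a j 0 = 1 ->
  aff (theta i) (typeA R k l eta s *m a) = tail a (s i).+1.
Proof.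
move=> a1; rewrite thetaE typeA_mul.
by rewrite a1 mulr1; have := etaR_neq0 i; have := eps_neq0 => h1 h2; field; rewrite h1 h2.
Qed.

Lemma typeA_nondegenerate s : nondegenerate_tetra (typeA R k l eta s).
Proof.
rewrite /nondegenerate_tetra -/(homog _); set A := homog _.
suff : row_free A^T by rewrite /row_free mxrank_tr => /eqP.
apply: inj_row_free => v vA; apply: trmx_inj; rewrite trmx0.
have : A *m v^T = 0 by rewrite -[A]trmxK -trmx_mul vA trmx0.
set a := v^T; rewrite homog_mul => h.
have h' : col_mx (typeA R k l eta s *m a) ((\sum_i a i 0)%:M : 'M[R]_1) = col_mx 0 0.
  by rewrite h col_mx0.
have [h1 /matrixP/(_ 0 0)] := @eq_col_mx _ 3 1 1 _ _ _ _ h'.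
rewrite !mxE eqxx mulr1n => a0.
have t0 i : tail a (s i).+1 = 0.
  have /matrixP/(_ i 0) := h1; rewrite typeA_mul a0 mulr0 add0r mxE.
  by move=> /eqP; rewrite !mulf_eq0 (negbTE eps_neq0) (negbTE (etaR_neq0 i)) => /eqP.
have t m : (m < 3)%N -> tail a m.+1 = 0.
  by move=> m3; have := t0 (s^-1 (Ordinal m3))%g; rewrite permKV.
have [e0 e1 e2 e3 _] := tailE a.
have := t 0%N isT; have := t 1%N isT; have := t 2%N isT.
rewrite e1 e2 e3 => z3 z2 z1.
have z0 : tail a 0%N = 0 by rewrite -[RHS]a0 /tail; apply: eq_bigl.
rewrite e0 in z0.
apply/matrixP => i j; rewrite ord1 [RHS]mxE.
case: i => -[|[|[|[|//]]]] hi.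
- by rewrite (_ : Ordinal hi = o4 0); [lra|apply/val_inj].
- by rewrite (_ : Ordinal hi = o4 1); [lra|apply/val_inj].
- by rewrite (_ : Ordinal hi = o4 2); [lra|apply/val_inj].
- by rewrite (_ : Ordinal hi = o4 3); [lra|apply/val_inj].
Qed.

(** The lattice point obtained from [l] by a step in the directions where the
    coordinate of [x] is at least [tau]. *)
Definition level (x : V) (tau : R) : Zv :=
  \col_i (l i 0 + (if tau <= aff (theta i) x then eta i 0 else 0)).

Lemma typeA_col s j : col j (typeA R k l eta s) =
  node (\col_i (l i 0 + (if (s i < j)%N then eta i 0 else 0))).
Proof. by apply/matrixP => i m; rewrite !mxE. Qed.

Lemma typeA_lattice s : lattice_vertices (typeA R k l eta s).
Proof. by move=> j; rewrite typeA_col; eexists. Qed.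

Let bcol T x : 'cV[R]_4 := \col_j aff (lam T j) x.

Lemma theta_tail s x i :
  aff (theta i) x = tail (bcol (typeA R k l eta s) x) (s i).+1.
Proof.
have nd := typeA_nondegenerate s.
rewrite -(theta_typeA s) ?mul_colE; last first.
  by rewrite -(bary_sum nd x); apply: eq_bigr => j _; rewrite mxE.
congr (aff _ _); rewrite {1}(bary_comb nd x); apply: eq_bigr => j _.
by rewrite mxE.
Qed.

Lemma tail_le (a : 'cV[R]_4) m m' : (forall j, 0 <= a j 0) -> (m <= m')%N ->
  tail a m' <= tail a m.
Proof.
move=> a0 mm'; rewrite /tail [leLHS]big_mkcond [leRHS]big_mkcond /=.
by apply: ler_sum => j _; case: ifP => [/(leq_trans mm') ->//|_]; case: ifP.
Qed.

Lemma tail0 s x : tail (bcol (typeA R k l eta s) x) 0%N = 1.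
Proof.
rewrite -(bary_sum (typeA_nondegenerate s) x) /tail.
by apply: eq_big => // j _; rewrite mxE.
Qed.

Lemma tailS (a : 'cV[R]_4) (j : 'I_4) : tail a j = a j 0 + tail a j.+1.
Proof.
rewrite /tail (bigD1 j) //=; congr (_ + _); apply: eq_bigl => i.
by rewrite [RHS]ltn_neqAle andbC eq_sym.
Qed.

(** The coordinates [theta] are the partial sums, so a level set of [x] is an
    initial part of the path of vertices. *)
Lemma level_vertex s x tau (j : 'I_4) : closure (tetra (typeA R k l eta s)) x ->
  let a := bcol (typeA R k l eta s) x in tail a j.+1 < tau <= tail a j ->
  col j (typeA R k l eta s) = node (level x tau).
Proof.
move=> /closure_tetraP => /(_ (typeA_nondegenerate s)) h0 a /andP[h1 h2].
have a0 i : 0 <= a i 0 by rewrite mxE.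
rewrite typeA_col; congr node; apply/matrixP => i m; rewrite !mxE.
rewrite (theta_tail s); case: ltnP => sij.
  by rewrite (le_trans h2) // tail_le.
rewrite leNgt (le_lt_trans _ h1) //; exact: tail_le.
Qed.

Lemma level_exists s x tau : closure (tetra (typeA R k l eta s)) x ->
  0 < tau <= 1 -> exists j, col j (typeA R k l eta s) = node (level x tau).
Proof.
move=> cx /andP[t0 t1]; set a := bcol (typeA R k l eta s) x.
suff [j h] : exists j : 'I_4, tail a j.+1 < tau <= tail a j.
  by exists j; apply: level_vertex h.
have [_ _ _ _ a4] := tailE a; have a0 : tail a 0%N = 1 := tail0 s x.
have [h1|h1] := ltP (tail a 1%N) tau; first by exists (o4 0); rewrite a0 t1 h1.
have [h2|h2] := ltP (tail a 2%N) tau; first by exists (o4 1); rewrite h1 h2.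
have [h3|h3] := ltP (tail a 3%N) tau; first by exists (o4 2); rewrite h2 h3.
by exists (o4 3); rewrite h3 a4 t0.
Qed.

Lemma vertex_level s x j : closure (tetra (typeA R k l eta s)) x ->
  0 < aff (lam (typeA R k l eta s) j) x ->
  exists2 tau, 0 < tau <= 1 & col j (typeA R k l eta s) = node (level x tau).
Proof.
move=> cx xj; set a := bcol (typeA R k l eta s) x.
have aj : 0 < a j 0 by rewrite mxE.
have a0 i : 0 <= a i 0.
  by rewrite mxE; have /closure_tetraP := cx; move=> /(_ (typeA_nondegenerate s)).
exists (tail a j); last by apply: level_vertex; rewrite // lexx andbT tailS ltrDr.
apply/andP; split; last by rewrite -(tail0 s x); exact: tail_le.
rewrite tailS; apply: ltr_pwDl => //; apply: sumr_ge0 => i _; exact: a0.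
Qed.

Lemma theta_range s x i : closure (tetra (typeA R k l eta s)) x ->
  0 <= aff (theta i) x <= 1.
Proof.
move=> /closure_tetraP => /(_ (typeA_nondegenerate s)) h; rewrite (theta_tail s).
have a0 j : 0 <= bcol (typeA R k l eta s) x j 0 by rewrite mxE.
by rewrite sumr_ge0 //= -(tail0 s x) tail_le.
Qed.

Lemma bond_volumeP x : bond_volume R k l eta x <-> forall i, 0 < aff (theta i) x < 1.
Proof.
have E i : (Num.min (node l i 0) (node (l + eta) i 0) < x i 0
            < Num.max (node l i 0) (node (l + eta) i 0)) = (0 < aff (theta i) x < 1).
  have -> : node (l + eta) i 0 = node l i 0 + eps * (eta i 0)%:~R.
    by rewrite !nodeE [(l + eta) i 0]mxE rmorphD mulrDr.
  have -> : x i 0 = node l i 0 + eps * (eta i 0)%:~R * aff (theta i) x.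
    by rewrite [LHS]thetaK nodeE; ring.
  have h0 : eps * (eta i 0)%:~R != 0 by rewrite mulf_neq0 ?eps_neq0 ?etaR_neq0.
  set h := _ * _ in h0 *; set t := aff _ _; set a := node _ _ _.
  have [hp|hn|/eqP] := ltgtP 0 h; last by rewrite eq_sym (negbTE h0).
    have E1 : (h * t < h) = (t < 1) by rewrite -[X in _ < X]mulr1 ltr_pM2l.
    by rewrite minEle maxEle lerDl (ltW hp) ltrDl pmulr_rgt0 // ltrD2l E1.
  have E1 : (h < h * t) = (t < 1) by rewrite -[X in X < _]mulr1 ltr_nM2l.
  by rewrite minEle maxEle lerDl leNgt hn /= ltrD2l E1 gtrDl nmulr_rlt0 // andbC.
by split=> h i; have := h i; rewrite E.
Qed.

Definition bond_planes : seq (V * R) :=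
  [seq theta i | i <- enum 'I_3] ++
  [seq (- (theta i).1, 1 - (theta i).2) | i <- enum 'I_3].

Lemma aff_opp_theta i x : aff (- (theta i).1, 1 - (theta i).2) x = 1 - aff (theta i) x.
Proof. by move: (theta i) => P; rewrite /aff /= dotNl; ring. Qed.

Lemma bond_polyhedron : bond_volume R k l eta = polyhedron bond_planes.
Proof.
apply/seteqP; split => x.
  move=> /bond_volumeP h P; rewrite mem_cat => /orP[] /mapP[i _ ->];
    by have /andP[h1 h2] := h i; rewrite ?aff_opp_theta ?subr_gt0.
move=> h; apply/bond_volumeP => i; rewrite h /=; last by rewrite mem_cat map_f ?mem_enum.
rewrite -subr_gt0 -aff_opp_theta h // mem_cat; apply/orP; right.
by apply/mapP; exists i => //; rewrite mem_enum.
Qed.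

Lemma bond_neq0 : bond_volume R k l eta !=set0.
Proof.
exists (\col_i (eps * ((l i 0)%:~R + (eta i 0)%:~R / 2%:R))).
apply/bond_volumeP => i; rewrite thetaE mxE.
have -> : (eps * ((l i 0)%:~R + (eta i 0)%:~R / 2%:R) / eps - (l i 0)%:~R) / (eta i 0)%:~R = 2%:R^-1 :> R.
  by have h1 := eps_neq0; have h2 := etaR_neq0 i; field; rewrite h1 h2.
by rewrite invr_gt0 ltr0n invf_lt1 ?ltr1n ?ltr0n.
Qed.

Lemma closure_bondP x : closure (bond_volume R k l eta) x <-> forall i, 0 <= aff (theta i) x <= 1.
Proof.
rewrite bond_polyhedron closure_polyhedron; last by rewrite -bond_polyhedron; exact: bond_neq0.
split => [h i|h P].
  rewrite h /=; last by rewrite mem_cat map_f ?mem_enum.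
  rewrite -subr_ge0 -aff_opp_theta h // mem_cat; apply/orP; right.
  by apply/mapP; exists i => //; rewrite mem_enum.
rewrite mem_cat => /orP[] /mapP[i _ ->];
  by have /andP[h1 h2] := h i; rewrite ?aff_opp_theta ?subr_ge0.
Qed.

Lemma typeA_sub s : tetra (typeA R k l eta s) `<=` bond_volume R k l eta.
Proof.
move=> x Tx; apply/bond_volumeP => i; rewrite (theta_tail s).
set a := bcol _ _; have a_gt0 j : 0 < a j 0.
  by rewrite mxE; have /tetraP := Tx; move=> /(_ (typeA_nondegenerate s)).
have a0 j : 0 <= a j 0 by apply: ltW.
have [e0 e1 e2 e3 _] := tailE a; have t0 : tail a 0%N = 1 := tail0 s x.
apply/andP; split.
  apply: (@lt_le_trans _ _ (tail a 3%N)); first by rewrite e3.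
  by apply: tail_le => //; exact: ltn_ord.
apply: (@le_lt_trans _ _ (tail a 1%N)); first exact: tail_le.
by rewrite -t0 e0 e1 -!addrA ltrDr.
Qed.

Lemma sorting_perm (th : 'I_3 -> R) :
  exists s : 'S_3, forall i i', (s i < s i')%N -> th i' <= th i.
Proof.
pose before (i' i : 'I_3) := (th i < th i') || (th i == th i') && (i' < i)%N.
have btr i1 i2 i3 : before i1 i2 -> before i2 i3 -> before i1 i3.
  rewrite /before => /orP[h|/andP[/eqP h h']] /orP[g|/andP[/eqP g g']].
  - by rewrite (lt_trans g h).
  - by rewrite g h.
  - by rewrite -h g.
  - by rewrite g h eqxx (ltn_trans h' g') orbT.
have birr i : before i i = false by rewrite /before ltxx ltnn andbF.
have btot i i' : i != i' -> before i i' || before i' i.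
  rewrite /before => ii'; have [//|h|h] := ltgtP (th i) (th i'); rewrite ?orbT //.
  by rewrite /= -neq_ltn.
pose rk i := #|[pred i' | before i' i]|.
have rk_lt i i' : before i i' -> (rk i < rk i')%N.
  move=> b; apply: proper_card; apply/properP; split.
    by apply/fintype.subsetP => j; rewrite !inE => /btr; apply.
  by exists i; rewrite inE ?birr.
have rk3 i : (rk i < 3)%N.
  have : (rk i <= #|predC1 i|)%N.
    apply/subset_leq_card/fintype.subsetP => j; rewrite !inE.
    by apply: contraTneq => ->; rewrite birr.
  by rewrite cardC1 card_ord.
have rk_inj : injective (fun i => Ordinal (rk3 i)).
  move=> i i' /(congr1 val) /= e; apply/eqP; apply: contraT => /btot /orP[] /rk_lt;
  by rewrite e ltnn.
exists (perm rk_inj) => i i'; rewrite !permE /= => h.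
rewrite leNgt; apply/negP => lt; have : before i' i by rewrite /before lt.
by move=> /rk_lt; rewrite ltnNge ltnW.
Qed.

(** Sorting the coordinates [theta] of [x] gives the permutation. *)
Lemma typeA_cover x : closure (bond_volume R k l eta) x ->
  exists s, closure (tetra (typeA R k l eta s)) x.
Proof.
move=> /closure_bondP h01; have [s hs] := sorting_perm (fun i => aff (theta i) x).
exists s; have nd := typeA_nondegenerate s.
pose th (m : nat) := if [pick i | s i == m :> nat] is Some i then aff (theta i) x else 0.
pose u m := if m is m'.+1 then th m' else 1.
pose a : 'cV[R]_4 := \col_j (u j - u j.+1).
have u4 : th 3%N = 0.
  by rewrite /th; case: pickP => // i /eqP e; have := ltn_ord (s i); rewrite e.
have thE i : th (s i) = aff (theta i) x.
  rewrite /th; case: pickP => [i' /eqP/val_inj/perm_inj -> //|/(_ i)].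
  by rewrite eqxx.
have ta (m : 'I_4) : tail a m = u m.
  have aj (j : 'I_4) : a j 0 = u j - u j.+1 by rewrite mxE.
  have [e0 e1 e2 e3 _] := tailE a; rewrite !aj /= u4 in e0 e1 e2 e3.
  by case: m => -[|[|[|[|//]]]] hm /=; rewrite ?e0 ?e1 ?e2 ?e3 /u; ring.
have a1 : \sum_j a j 0 = 1.
  by have := ta (o4 0); rewrite /tail /= => <-; apply: eq_bigl.
have xE : typeA R k l eta s *m a = x.
  apply: theta_inj => i; rewrite theta_typeA //.
  have h4 : ((s i).+1 < 4)%N by rewrite ltnS ltn_ord.
  by rewrite (ta (Ordinal h4)) /u /= thE.
apply/closure_tetraP => // j; rewrite -xE lam_id // mxE subr_ge0.
have th01 m : 0 <= th m <= 1.
  by rewrite /th; case: pickP => [i _|_]; [exact: h01|rewrite lexx ler01].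
have thd m m' : (m < m')%N -> th m' <= th m.
  move=> mm'; rewrite {1}/th; case: pickP => [i' /eqP iE|_]; last by case/andP: (th01 m).
  have mo : (m < 3)%N by rewrite (ltn_trans mm') // -iE ltn_ord.
  rewrite /th; case: pickP => [i /eqP iE'|/(_ (s^-1 (Ordinal mo)))%g]; last by rewrite permKV /= eqxx.
  by apply: hs; rewrite iE iE'.
case: j => -[|m] hm /=; first by case/andP: (th01 0%N).
by apply: thd.
Qed.

End TypeA.

(** The vertices that carry [x] are the points [level x tau], which depend
    neither on the permutation nor, in a residue class, on the bond volume. *)
Lemma typeA_conforming l l' eta s s' x j : (forall i, eta i 0 != 0) ->
  (forall i, exists d : int, l' i 0 = l i 0 + d * eta i 0) ->
  closure (tetra (typeA R k l eta s)) x -> closure (tetra (typeA R k l' eta s')) x ->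
  0 < aff (lam (typeA R k l eta s) j) x ->
  exists j', col j (typeA R k l eta s) = col j' (typeA R k l' eta s').
Proof.
move=> eta0 ll' cx cx' xj.
have [tau t01 ->] := vertex_level eta0 cx xj.
have [j' hj] := level_exists eta0 cx' t01.
exists j'; rewrite hj; congr node; apply/matrixP => i m; rewrite !mxE.
have [d dE] := ll' i; have e0 := etaR_neq0 eta0 i.
have r := theta_range eta0 i cx; have r' := theta_range eta0 i cx'.
have E : aff (theta l' eta i) x = aff (theta l eta i) x - d%:~R.
  by rewrite !thetaE // dE rmorphD rmorphM /=; have ep := eps_neq0; field; rewrite e0 ep.
case/andP: t01 => t0 t1; case/andP: r => r0 r1; case/andP: r' => r0' r1'.
rewrite E in r0' r1' *.
have d1 : -1 <= d <= 1.
  by rewrite -!(ler_int R) rmorphN /=; apply/andP; split; lra.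
rewrite dE; have [d0|[d0|d0]] : d = 0 \/ d = 1 \/ d = -1 by lia.
- by rewrite d0 subr0 mul0r addr0.
- rewrite d0 mulr1z in r0' r1' *; have h : aff (theta l eta i) x = 1 by lra.
  by rewrite h subrr t1 leNgt t0 /= mul1r addr0.
- rewrite d0 rmorphN /= mulr1z opprK in r0' r1' *.
  have h : aff (theta l eta i) x = 0 by lra.
  by rewrite h add0r t1 leNgt t0 /= mulN1r addr0 subrK.
Qed.

End Interp.

(** * Lattice cells *)

Lemma finite_set_seq (T : choiceType) (A : set T) : finite_set A ->
  exists s : seq T, uniq s /\ forall x, A x <-> x \in s.
Proof.
move=> /finite_seqP[s ->]; exists (undup s); split; first exact: undup_uniq.
by move=> x; rewrite mem_undup.
Qed.

Lemma fsbig_seqE (U : nmodType) (T : choiceType) (A : set T) (s : seq T) (F : T -> U) :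
  uniq s -> (forall x, A x <-> x \in s) -> \sum_(x \in A) F x = \sum_(x <- s) F x.
Proof.
move=> us As; rewrite (fsbig_seq _ _ us); congr (\big[_/_]_(_ \in _) _).
by apply/seteqP; split => x /=; rewrite As.
Qed.

Lemma finite_int_box (a b : 'I_3 -> int) :
  finite_set [set l : 'cV[int]_3 | forall i, a i <= l i 0 <= b i].
Proof.
pose K := (\sum_i `|b i - a i|).+1%N.
pose f (o : {ffun 'I_3 -> 'I_K}) : 'cV[int]_3 := \col_i (a i + (o i)%:Z).
apply: (@sub_finite_set _ _ (f @` [set: {ffun 'I_3 -> 'I_K}])); last first.
  by apply: finite_image; exact: finite_finset.
move=> l hl; have hK i : (absz ((l i (0 : 'I_1) : int) - a i)%R < K)%N.
  rewrite ltnS (bigD1 i) //=; apply: leq_trans (leq_addr _ _).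
  have := hl i; lia.
exists [ffun i => Ordinal (hK i)] => //; apply/matrixP => i j; rewrite ord1 mxE ffunE /=.
have := hl i; lia.
Qed.

Section Topology.
Variable R : realType.
Notation V := 'cV[R]_3.

Lemma closure_bigU (I : eqType) (s : seq I) (A : I -> set V) (x : V) :
  closure (\bigcup_(i in [set` s]) A i) x -> exists2 i, i \in s & closure (A i) x.
Proof.
elim: s => [|i s IH].
  rewrite (_ : \bigcup_(i in _) A i = set0); first by rewrite closure0.
  by apply/seteqP; split => // z [i].
rewrite (_ : \bigcup_(i in _) A i = A i `|` \bigcup_(i in [set` s]) A i).
  rewrite closureU => -[h|/IH[j js h]]; first by exists i; rewrite ?mem_head.
  by exists j; rewrite ?inE ?js ?orbT.
apply/seteqP; split => z.
  move=> [j /=]; rewrite inE => /predU1P[->|js] h; first by left.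
  by right; exists j.
by case=> [h|[j js h]]; [exists i; rewrite /= ?mem_head|exists j; rewrite /= ?inE ?js ?orbT].
Qed.

(** The boundary points of the half-space are limits along [m] of its interior
    points. *)
Lemma side_closure_near (A : set V) x m : m != 0 -> side A x m ->
  \forall z \near x, 0 <= dot m (z - x) -> closure A z.
Proof.
move=> m0 h; have := near_join h; apply: filterS => z hz mz B hB.
have h2 : \forall z' \near z, B z' /\ (0 < dot m (z' - x) -> A z').
  exact: filterI hB hz.
have h3 := near_segment m h2.
have h4 : \forall s \near (0 : R)^'+, 0 < s by exact: nbhs_right_gt.
have [s [[Bs As] s0]] := filter_ex (filterI h3 h4).
exists (z + s *: m); split => //; apply: As.
rewrite addrAC dotDr dotZr ltr_wpDl // mulr_gt0 //; exact: dot_gt0.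
Qed.

Lemma open_meets_closure (A B : set V) x : open A -> A x -> closure B x -> A `&` B !=set0.
Proof.
move=> oA Ax /(_ A); rewrite setIC; apply.
by move: oA; rewrite openE => /(_ _ Ax).
Qed.

End Topology.

Section Cells.
Variables (R : realType) (k : nat).
Hypothesis k0 : (0 < k)%N.
Notation V := 'cV[R]_3.
Notation Zv := 'cV[int]_3.
Notation cell := (Zv * 'S_3)%type.
Notation cell_tetra := (cell_tetra R k).
Implicit Types (c : cell) (x : V).

Lemma one_neq0 (i : 'I_3) : (const_mx 1 : Zv) i 0 != 0.
Proof. by rewrite mxE. Qed.

Lemma cell_nondegenerate c : nondegenerate_tetra (cell_tetra c).
Proof. by apply: typeA_nondegenerate => // i; exact: one_neq0. Qed.

Lemma cell_lattice c : lattice_vertices k (cell_tetra c).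
Proof. exact: typeA_lattice. Qed.

Lemma cell_conforming c c' x j :
  closure (tetra (cell_tetra c)) x -> closure (tetra (cell_tetra c')) x ->
  0 < aff (lam (cell_tetra c) j) x ->
  exists j', col j (cell_tetra c) = col j' (cell_tetra c').
Proof.
apply: (typeA_conforming k0 one_neq0) => i; exists (c'.1 i 0 - c.1 i 0).
by rewrite mxE mulr1 addrC subrK.
Qed.

(** A value of a permutation is the number of smaller values. *)
Lemma perm_order_inj (s s' : 'S_3) :
  (forall i i', (s i < s i')%N -> (s' i < s' i')%N) -> s = s'.
Proof.
move=> h; have h' i i' : (s i < s i')%N = (s' i < s' i')%N.
  apply/idP/idP => [/h //|lt]; rewrite ltnNge; apply/negP.
  rewrite leq_eqVlt => /orP[/eqP/val_inj/perm_inj e|/h]; first by rewrite e ltnn in lt.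
  by rewrite ltnNge ltnW.
have cnt (u : 'S_3) i : (\sum_i' (u i' < u i)%N)%N = u i.
  transitivity (\sum_(m < 3) (m < u i)%N)%N.
    by rewrite [RHS](reindex_inj (@perm_inj _ u)).
  by rewrite !big_ord_recl big_ord0; case: (u i) => -[|[|[|]]].
apply/permP => i; apply/val_inj; rewrite /= -[LHS]cnt -[RHS]cnt.
by apply: eq_bigr => i' _; rewrite h'.
Qed.

Lemma theta_shift (l l' eta : Zv) (d : int) i x : (forall i, eta i 0 != 0) ->
  l' i 0 = l i 0 + d * eta i 0 ->
  aff (theta R k l' eta i) x = aff (theta R k l eta i) x - d%:~R.
Proof.
move=> eta0 dE; have e0 := etaR_neq0 R eta0 i; have ep := eps_neq0 R k0.
by rewrite !thetaE // dE rmorphD rmorphM /=; field; rewrite e0 ep.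
Qed.

(** In the coordinates [theta] the bond volumes of a residue class are integer
    translates of the unit cube. *)
Lemma bond_disjoint (l l' eta : Zv) : (forall i, eta i 0 != 0) ->
  (forall i, exists d : int, l' i 0 = l i 0 + d * eta i 0) ->
  bond_volume R k l eta `&` bond_volume R k l' eta !=set0 -> l = l'.
Proof.
move=> eta0 ll' [x [/(bond_volumeP k0 l eta0) b1 /(bond_volumeP k0 l' eta0) b2]].
apply/matrixP => i j; rewrite ord1; have [d dE] := ll' i.
have := b2 i; have := b1 i; rewrite (theta_shift x eta0 dE) => /andP[h1 h2] /andP[h3 h4].
have : -1 < d < 1.
  by rewrite -!(ltr_int R) rmorphN /= mulr1z; apply/andP; split; lra.
move=> /andP[d1 d2]; have d0 : d = 0 by lia.
by have := dE; rewrite d0 mul0r addr0.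
Qed.

(** Inside a bond volume the permutation is recovered from the order of the
    coordinates [theta]. *)
Lemma typeA_disjoint (l l' eta : Zv) s s' : (forall i, eta i 0 != 0) ->
  (forall i, exists d : int, l' i 0 = l i 0 + d * eta i 0) ->
  tetra (typeA R k l eta s) `&` tetra (typeA R k l' eta s') !=set0 -> l = l' /\ s = s'.
Proof.
move=> eta0 ll' [x [Tx Tx']].
have E : l = l'.
  by apply: (bond_disjoint eta0 ll'); exists x; split; apply: typeA_sub; eassumption.
split=> //; rewrite -E in Tx'.
have mono (u : 'S_3) : tetra (typeA R k l eta u) x -> forall i i', (u i < u i')%N <->
    aff (theta R k l eta i') x < aff (theta R k l eta i) x.
  move=> Tu; have lt i i' : (u i < u i')%N ->
      aff (theta R k l eta i') x < aff (theta R k l eta i) x.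
    move=> h; rewrite !(theta_tail k0 l eta0 u).
    have a0 j : 0 < (\col_j aff (lam (typeA R k l eta u) j) x : 'cV[R]_4) j 0.
      by rewrite mxE; have /tetraP := Tu; move=> /(_ (typeA_nondegenerate R k0 l eta0 u)); apply.
    have h3 : ((u i).+1 < 4)%N by rewrite ltnS ltn_ord.
    apply: (@le_lt_trans _ _ (tail (\col_j aff (lam (typeA R k l eta u) j) x) (u i).+2)).
      by apply: tail_le => [j|//]; exact: ltW.
    by rewrite [ltRHS](tailS _ (Ordinal h3)) /= ltrDr.
  move=> i i'; split; first exact: lt.
  move=> h; rewrite ltnNge; apply/negP; rewrite leq_eqVlt => /orP[/eqP/val_inj/perm_inj e|/lt].
    by rewrite e ltxx in h.
  by rewrite ltNge ltW.
by apply: perm_order_inj => i i' /(mono s Tx) /(mono s' Tx').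
Qed.

Lemma cell_disjoint c c' : tetra (cell_tetra c) `&` tetra (cell_tetra c') !=set0 -> c = c'.
Proof.
case: c c' => [l s] [l' s'] /(typeA_disjoint one_neq0) [|/= -> -> //].
by move=> i; exists (l' i 0 - l i 0); rewrite mxE mulr1 addrC subrK.
Qed.

Variable M : 'I_3 -> nat.

Definition cell_range (l : Zv) : Prop :=
  forall i, k%:Z * (1 - (M i)%:Z) <= l i 0 < k%:Z * (M i)%:Z.

Lemma Omega_nodeP (l : Zv) i : (1 - (M i)%:R <= node R k l i 0 <= (M i)%:R) =
  (k%:Z * (1 - (M i)%:Z) <= l i 0 <= k%:Z * (M i)%:Z).
Proof.
have kR : (0 : R) < k%:R by rewrite ltr0n.
rewrite nodeE /eps mulrC ler_pdivlMr // ler_pdivrMr // -!(ler_int R) !rmorphM rmorphB /=.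
by rewrite -!pmulrn mulrC [k%:R * (M i)%:R]mulrC.
Qed.

Lemma cell_in_Omega c : tetra (cell_tetra c) `<=` Omega R M <-> cell_range c.1.
Proof.
have clO x : closure (Omega R M) x -> Omega R M x.
  move=> h i; have hi := dot_delta x i.
  apply/andP; split; rewrite leNgt; apply/negP => lt.
  - have := @aff_near_lt R (delta_mx i 0, 0) x (1 - (M i)%:R).
    rewrite /aff /= dotC dot_delta addr0 => /(_ lt) /h[z [/(_ i) /andP[h1 _]]] /=.
    by rewrite dotC dot_delta addr0 ltNge h1.
  - have := @aff_near_gt R (delta_mx i 0, 0) x (M i)%:R.
    rewrite /aff /= dotC dot_delta addr0 => /(_ lt) /h[z [/(_ i) /andP[_ h1]]] /=.
    by rewrite dotC dot_delta addr0 ltNge h1.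
have nd := cell_nondegenerate c.
split=> [h i|h x Tx i].
  have hv j : Omega R M (col j (cell_tetra c)).
    apply/clO/(closure_subset h)/closure_tetraP => // j'.
    by rewrite lam_vertex // ler0n.
  have := hv (o4 0) i; have := hv (o4 3) i; rewrite !typeA_col !Omega_nodeP !mxE /=.
  by rewrite ltn_ord; lia.
have /(bond_volumeP k0 c.1 one_neq0)/(_ i) := typeA_sub k0 one_neq0 Tx.
rewrite thetaE //; last exact: one_neq0.
rewrite mxE divr1 /eps invrK => /andP[h1 h2].
have kR : (0 : R) < k%:R by rewrite ltr0n.
have /andP[g1 g2] := h i.
have {}g1 : (k%:R * (1 - (M i)%:R) : R) <= (c.1 i 0)%:~R.
  by have := g1; rewrite -(ler_int R) rmorphM rmorphB /= -!pmulrn.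
have {}g2 : (c.1 i 0)%:~R + 1 <= k%:R * (M i)%:R :> R.
  have : c.1 i 0 + 1 <= k%:Z * (M i)%:Z by lia.
  by rewrite -(ler_int R) rmorphM rmorphD /= -!pmulrn.
apply/andP; split; rewrite -(ler_pM2l kR) [k%:R * x i 0]mulrC; lra.
Qed.

End Cells.

(** * The two regions and their interface *)

Section PolyhedronInterior.
Variable R : realType.
Notation V := 'cV[R]_3.

(** An open set contained in a closed half-space avoids the bounding plane. *)
Lemma open_sub_polyhedron (A : set V) (L : seq (V * R)) : open A ->
  (forall P, P \in L -> P.1 != 0) -> A `<=` cpolyhedron L -> A `<=` polyhedron L.
Proof.
move=> oA L0 AL x Ax P PL; rewrite lt_neqAle (AL _ Ax _ PL) andbT; apply/eqP => /esym P0.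
have h : \forall z \near x, A z by move: oA; rewrite openE => /(_ _ Ax).
have h2 := near_segment (- P.1) h.
have [s [As s0]] := filter_ex (filterI h2 (nbhs_right_gt (0 : R))).
have := AL _ As _ PL; rewrite affD P0 add0r dotZr dotNr leNgt; move/negP; apply.
by rewrite mulrN oppr_lt0 mulr_gt0 // dot_gt0 // L0.
Qed.

(** Moving away from [x] along [m] and along [- m] cannot increase [P] both
    times. *)
Lemma side_plane_excl (P : V * R) x m : m != 0 -> aff P x = 0 ->
  side [set z | 0 < aff P z] x m -> side [set z | 0 < aff P z] x (- m) -> False.
Proof.
move=> m0 P0 h1 h2.
have d1 := dot_gt0 m0.
have d2 : 0 < dot (- m) (- m) by rewrite dotNl dotNr opprK.
have [s [[s1 s2] s0]] := filter_ex
  (filterI (filterI (side_ray d1 h1) (side_ray d2 h2)) (nbhs_right_gt (0 : R))).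
move: s1 s2; rewrite /= !affD P0 !add0r !dotZr dotNr => s1.
by rewrite mulrN oppr_gt0 => /(lt_trans s1); rewrite ltxx.
Qed.

(** On a face the interpolant is determined by the vertices of that face. *)
Lemma shared_face (k : nat) (y : 'cV[int]_3 -> V) T T' j x :
  nondegenerate_tetra T -> nondegenerate_tetra T' ->
  (forall i, i != j -> exists j', col i T = col j' T') -> face T j x ->
  closure (tetra T') x /\ interp k y T x = interp k y T' x.
Proof.
move=> nd nd' h fx; have fx' := (faceP nd _ _).1 fx.
apply: interp_agree => //; first exact: face_closure fx.
by move=> i i0; apply: h; apply/eqP => ij; move: i0; rewrite ij fx'.2 ltxx.
Qed.

Lemma same_vertices (T T' : 'M[R]_(3, 4)) (j : 'I_4) : vertices T = vertices T' ->
  exists j', col j T = col j' T'.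
Proof.
move=> h; have : vertices T (col j T) by exists j.
by rewrite h => -[j' _ e]; exists j'.
Qed.

(** The two matrices may list the vertices in different orders. *)
Lemma same_vertices_tetra (T T' : 'M[R]_(3, 4)) : nondegenerate_tetra T -> nondegenerate_tetra T' ->
  vertices T = vertices T' -> tetra T = tetra T'.
Proof.
have sub (T1 T2 : 'M[R]_(3, 4)) : nondegenerate_tetra T1 -> nondegenerate_tetra T2 ->
    vertices T1 = vertices T2 -> tetra T1 `<=` tetra T2.
  move=> n1 n2 e; rewrite -(_ : polyhedron (planes T2) = tetra T2).
    apply: open_sub_polyhedron => [|P /mapP[j _ ->]|x Tx P /mapP[j _ ->]].
    - exact: open_tetra.
    - exact: lam_neq0.
    have cx : closure (tetra T1) x by apply: subset_closure.
    have [|/closure_tetraP c2 _] := interp_agree 0 (fun=> 0) n1 n2 cx; last exact: c2.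
    by move=> i _; exact: same_vertices.
  apply/seteqP; split => x.
    by move=> h; apply/tetraP => // j; apply: h; exact: mem_planes.
  by move=> /tetraP h P /mapP[j _ ->]; exact: h.
by move=> n1 n2 e; apply/seteqP; split; apply: sub.
Qed.

End PolyhedronInterior.

Section Regions.
Variables (R : realType) (k : nat) (M : 'I_3 -> nat) (Oa Os : set 'cV[R]_3).
Hypothesis k0 : (0 < k)%N.
Notation V := 'cV[R]_3.
Notation Zv := 'cV[int]_3.
Notation cell := (Zv * 'S_3)%type.
Notation cell_tetra := (cell_tetra R k).
Implicit Types (c : cell) (x : V).

Lemma cells_exist : exists C : seq cell, uniq C /\ forall c, cell_range k M c.1 <-> c \in C.
Proof.
have fin : finite_set [set c : cell | cell_range k M c.1].
  apply: (@sub_finite_set _ _ ([set l : Zv | forall i,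
      k%:Z * (1 - (M i)%:Z) <= l i 0 <= k%:Z * (M i)%:Z] `*` [set: 'S_3])); last first.
    by apply: finite_setX; [exact: finite_int_box|exact: finite_finset].
  by move=> c h; split => // i; have /andP[-> /ltW ->] := h i.
by have [C [uC CE]] := finite_set_seq fin; exists C.
Qed.

Lemma closed_Omega : closed (Omega R M).
Proof.
move=> x h i; have hi := dot_delta x i.
apply/andP; split; rewrite leNgt; apply/negP => lt.
- have := @aff_near_lt R (delta_mx i 0, 0) x (1 - (M i)%:R).
  rewrite /aff /= dotC dot_delta addr0 => /(_ lt) /h[z [/(_ i) /andP[h1 _]]] /=.
  by rewrite dotC dot_delta addr0 ltNge h1.
- have := @aff_near_gt R (delta_mx i 0, 0) x (M i)%:R.
  rewrite /aff /= dotC dot_delta addr0 => /(_ lt) /h[z [/(_ i) /andP[_ h1]]] /=.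
  by rewrite dotC dot_delta addr0 ltNge h1.
Qed.

Lemma region_open (A : set V) : tetra_region k M A -> open A.
Proof. by move=> [C [_ ->]]; exact: open_interior. Qed.

Lemma region_regular (A : set V) : tetra_region k M A -> interior (closure A) `<=` A.
Proof.
move=> [C [_ ->]] z hz; have := @interior_closure_idem V (\bigcup_(c in C) tetra (cell_tetra c)).
by move=> /= <-.
Qed.

(** All cells inside the region are taken, whichever cells define it; they are
    finitely many because the region is bounded. *)
Lemma region_cells (A : set V) : tetra_region k M A -> exists C : seq cell,
  [/\ uniq C, forall c, tetra (cell_tetra c) `<=` A <-> c \in C
    & forall x, closure A x -> exists2 c, c \in C & closure (tetra (cell_tetra c)) x].
Proof.
move=> regA; have [C0 [C0O AE]] := regA; have [cells [uc cE]] := cells_exist.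
have AO : A `<=` Omega R M.
  rewrite AE => x /interior_subset h; apply: closed_Omega; move: h; apply: closure_subset.
  by move=> z [c /C0O h]; exact: h.
pose C := [seq c <- cells | `[< tetra (cell_tetra c) `<=` A >]].
have CE c : tetra (cell_tetra c) `<=` A <-> c \in C.
  rewrite mem_filter; split => [h|/andP[/asboolP //]].
  apply/andP; split; first exact/asboolP.
  by apply/cE/(cell_in_Omega R k0) => z /h/AO.
exists C; split => // [|x Ax]; first exact: filter_uniq.
apply: closure_bigU; move: Ax; rewrite {1}AE => Ax.
have /closure_subset := @interior_subset _ (closure (\bigcup_(c in C0) tetra (cell_tetra c))).
move=> /(_ _ Ax); rewrite -(closure_id _).1; last exact: closed_closure.
apply: closure_subset => z [c C0c h].
exists c => //=; apply/CE; rewrite AE -open_subsetE; last exact/open_tetra/cell_nondegenerate.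
by move=> w cw; apply: subset_closure; exists c.
Qed.

End Regions.

Section Interface.
Variables (R : realType) (k : nat) (M : 'I_3 -> nat) (Oa Os : set 'cV[R]_3).
Hypothesis k0 : (0 < k)%N.
Hypothesis reg : regions k M Oa Os.
Notation V := 'cV[R]_3.
Notation Zv := 'cV[int]_3.
Notation cell := (Zv * 'S_3)%type.
Notation cell_tetra := (cell_tetra R k).
Notation Gamma := (Gamma Oa Os).
Implicit Types (c : cell) (x : V).

Lemma open_Oa : open Oa.
Proof. by case: reg => -[h _] _ _ _ _; exact: region_open h. Qed.

Lemma open_Os : open Os.
Proof. by case: reg => -[_ h] _ _ _ _; exact: region_open h. Qed.

Lemma Oa_Os x : Oa x -> ~ closure Os x.
Proof.
case: reg => _ _ dis _ _ ax sx.
by have [z] := open_meets_closure open_Oa ax sx; rewrite dis.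
Qed.

Lemma Os_Oa x : Os x -> ~ closure Oa x.
Proof.
case: reg => _ _ dis _ _ sx ax.
by have [z] := open_meets_closure open_Os sx ax; rewrite setIC dis.
Qed.

Lemma Gamma_notin x : Gamma x -> ~ Oa x /\ ~ Os x.
Proof. by move=> [ax sx]; split => [/Oa_Os|/Os_Oa]; apply. Qed.

(** A boundary point of [Oa] away from [Os] would be interior to the closure
    of [Oa], hence to [Oa] itself. *)
Lemma boundary_Oa x : closure Oa x -> ~ Oa x -> Gamma x.
Proof.
case: reg => -[ra _] _ _ OE Oint ax nax; split => //; apply: contrapT => nsx.
apply: nax; apply: (region_regular ra).
have h : \forall z \near x, Omega R M z by exact: (Oint _ ax).
have h2 : \forall z \near x, (~` closure Os) z.
  have : open (~` closure Os) by apply/closed_openC/closed_closure.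
  by rewrite openE => /(_ _ nsx).
apply: filterS (filterI h h2) => z [Oz nz].
by move: Oz; rewrite OE => -[].
Qed.

Variables CA CS : seq cell.
Hypotheses (CAE : forall c, tetra (cell_tetra c) `<=` Oa <-> c \in CA)
  (CSE : forall c, tetra (cell_tetra c) `<=` Os <-> c \in CS)
  (CAcl : forall x, closure Oa x -> exists2 c, c \in CA & closure (tetra (cell_tetra c)) x)
  (CScl : forall x, closure Os x -> exists2 c, c \in CS & closure (tetra (cell_tetra c)) x)
  (uCA : uniq CA) (uCS : uniq CS).

Lemma cells_excl c : c \in CA -> c \in CS -> False.
Proof.
move=> /CAE a /CSE s; have h := tetra_centroid (cell_nondegenerate R k0 c).
by apply: (Oa_Os (a _ h)); apply: subset_closure; exact: s.
Qed.

(** An interior point of a cell of the period lies in the closure of one of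
    the regions, hence in a closed cell of it; and cells are disjoint. *)
Lemma cells_union c : cell_range k M c.1 <-> c \in CA ++ CS.
Proof.
case: reg => -[[Ca [CaO OaE]] [Cs [CsO OsE]]] _ _ OE _.
rewrite mem_cat; split => [h|].
  have nd := cell_nondegenerate R k0 c.
  have h1 := tetra_centroid nd.
  have : Omega R M (centroid (cell_tetra c)) by exact: ((cell_in_Omega R k0 M c).2 h).
  rewrite OE => -[/CAcl|/CScl] [c' c'C /(open_meets_closure (open_tetra nd) h1)] hh.
    by have := cell_disjoint k0 hh => ->; rewrite c'C.
  by have := cell_disjoint k0 hh => ->; rewrite c'C orbT.
move=> h; apply/(cell_in_Omega R k0) => z cz; rewrite OE.
by case/orP: h => [/CAE|/CSE] /(_ _ cz) h; [left|right]; exact: subset_closure.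
Qed.

Definition interface_faces : seq (cell * 'I_4) :=
  [seq f <- [seq (c, j) | c <- CA, j <- enum 'I_4] |
     `[< face (cell_tetra f.1) f.2 `<=` Gamma >]].

Lemma interface_facesP f : f \in interface_faces <->
  tetra (cell_tetra f.1) `<=` Oa /\ face (cell_tetra f.1) f.2 `<=` Gamma.
Proof.
rewrite mem_filter; split.
  move=> /andP[/asboolP + /allpairsP[[c j] /= [cC _ fE]]]; rewrite fE /=.
  by move=> h1; split => //; apply/CAE.
case: f => c j /= [/CAE cC h]; apply/andP; split; first exact/asboolP.
by apply/allpairsP; exists (c, j); rewrite /= mem_enum.
Qed.

Lemma interface_faces_uniq : uniq interface_faces.
Proof.
rewrite filter_uniq // allpairs_uniq ?enum_uniq //.
by move=> [a b] [c d] _ _ /= [-> ->].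
Qed.

Definition facet (f : cell * 'I_4) : 'M[R]_(3, 4) * 'I_4 := (cell_tetra f.1, f.2).

Lemma facet_inj : injective facet.
Proof.
move=> [c j] [c' j'] [e ->]; congr (_, _); apply: (@cell_disjoint R k k0).
by rewrite e setIid; exists (centroid (cell_tetra c')); apply/tetra_centroid/cell_nondegenerate.
Qed.

Variable Ps : seq (V * R).
Hypothesis PsC : forall c, c \in CA ++ CS -> {subset planes (cell_tetra c) <= Ps}.

Lemma PsCA c : c \in CA -> {subset planes (cell_tetra c) <= Ps}.
Proof. by move=> h; apply: PsC; rewrite mem_cat h. Qed.

Lemma PsCS c : c \in CS -> {subset planes (cell_tetra c) <= Ps}.
Proof. by move=> h; apply: PsC; rewrite mem_cat h orbT. Qed.

Section AtFace.
Variables (f : cell * 'I_4) (x n : V).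
Hypotheses (fI : f \in interface_faces) (gx : generic Ps x n)
  (fx : face (cell_tetra f.1) f.2 x).
Let m := interior_side (facet f).
Let nd := cell_nondegenerate R k0.

Lemma face_cellA : f.1 \in CA.
Proof. by apply/CAE; have [] := (interface_facesP _).1 fI. Qed.

Lemma face_Gamma : Gamma x.
Proof. by have [_] := (interface_facesP _).1 fI; apply. Qed.

Lemma face_side_in : [/\ side (tetra (cell_tetra f.1)) x m, m != 0,
  exists2 k, k != 0 & m = k *: n &
  forall i, i != f.2 -> 0 < aff (lam (cell_tetra f.1) i) x].
Proof.
have [h0 hj] := (faceP (nd _) _ _).1 fx.
have nt : ~ tetra (cell_tetra f.1) x.
  by move=> /(tetraP (nd _)) /(_ f.2); rewrite hj ltxx.
have [j [lj lpos sd kk]] := closure_tetra_cases (nd _) (PsCA face_cellA) gx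
  (face_closure (nd _) fx) nt.
have jE : j = f.2.
  by apply/eqP/negPn/negP => nj; have := lpos f.2; rewrite eq_sym nj hj ltxx => /(_ isT).
by rewrite jE in lj lpos sd kk; split => //; exact: (lam_neq0 (nd f.1)).
Qed.

(** A cell of [Os] on the inner side would overlap the cell [f.1] of [Oa]. *)
Lemma face_side_out c : c \in CS -> closure (tetra (cell_tetra c)) x ->
  side (tetra (cell_tetra c)) x (- m).
Proof.
move=> cS cx; have [s1 m0 [a a0 mE] _] := face_side_in.
have [_ nOs] := Gamma_notin face_Gamma.
have nt : ~ tetra (cell_tetra c) x by move=> /((CSE c).2 cS).
have [j [lj lpos sd [b b0 lE]]] := closure_tetra_cases (nd _) (PsCS cS) gx cx nt.
have E : (lam (cell_tetra c) j).1 = (b / a) *: m by rewrite lE mE scalerA divfK.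
have ba : b / a != 0 by rewrite mulf_neq0 // invr_eq0.
case: (ltgtP (b / a) 0) => [lt|gt|e]; last by rewrite e eqxx in ba.
- apply/(@sideZ _ _ x _ (- (b / a))); first by rewrite oppr_gt0.
  by rewrite scaleNr scalerN opprK -E.
- exfalso; move: sd; rewrite E => /(sideZ _ _ _ gt) sd.
  have /(cell_disjoint k0) e := side_meet m0 s1 sd.
  by apply: (@cells_excl c) => //; rewrite -e face_cellA.
Qed.

Lemma face_outer : exists c, [/\ c \in CS, closure (tetra (cell_tetra c)) x,
  side (tetra (cell_tetra c)) x (- m) &
  forall c', c' \in CS -> closure (tetra (cell_tetra c')) x -> c' = c].
Proof.
have [_ /CScl[c cS cx]] := face_Gamma.
have sc := face_side_out cS cx; exists c; split => // c' c'S c'x.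
have [_ m0 _ _] := face_side_in.
have mm0 : - m != 0 by rewrite oppr_eq0.
exact: cell_disjoint k0 _ _ (side_meet mm0 (face_side_out c'S c'x) sc).
Qed.

(** The closed cells on the two sides of the face already fill a neighbourhood
    of [x]. *)
Lemma face_sides : \forall z \near x,
  (Oa z <-> 0 < dot m (z - x)) /\ (Os z <-> dot m (z - x) < 0).
Proof.
have [s1 m0 _ _] := face_side_in; have [c [cS cx s2 _]] := face_outer.
have mm0 : - m != 0 by rewrite oppr_eq0.
have h1 := side_closure_near m0 s1; have h2 := side_closure_near mm0 s2.
have CAf := (CAE _).2 face_cellA; have CSc := (CSE _).2 cS.
apply: filterS (filterI (filterI h1 h2) (filterI s1 s2)) => z [[g1 g2] [g3 g4]].
rewrite dotNl oppr_ge0 in g2; rewrite dotNl oppr_gt0 in g4.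
split; split.
- by move=> az; rewrite ltNge; apply/negP => /g2 /(closure_subset CSc); exact: Oa_Os.
- by move=> /g3 /CAf.
- by move=> sz; rewrite ltNge; apply/negP => /g1 /(closure_subset CAf); exact: Os_Oa.
- by move=> /g4 /CSc.
Qed.

Lemma face_outer_interp c (v : Zv -> V) : c \in CS -> closure (tetra (cell_tetra c)) x ->
  interp k v (cell_tetra f.1) x = interp k v (cell_tetra c) x.
Proof.
move=> cS cx; have fx' := face_closure (nd _) fx.
have [] // := interp_agree k v (nd f.1) (nd c) fx'.
by move=> j; apply: cell_conforming.
Qed.

End AtFace.

(** A generic boundary point of [Oa] lies on a face of a cell of [Oa], and on
    a cell of [Os]. The cells are conforming, so the whole face lies on the
    interface. *)
Lemma interface_boundary_faces : boundary_faces Oa Ps (map facet interface_faces).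
Proof.
have nd := cell_nondegenerate R k0; split.
- by rewrite map_inj_uniq; [exact: interface_faces_uniq|exact: facet_inj].
- by move=> _ /mapP[f fI ->]; split; [exact: nd|exact: PsCA (face_cellA fI)].
- move=> _ x n /mapP[f fI ->] gx fx; have [nOa nOs] := Gamma_notin (face_Gamma fI fx).
  have h := face_sides fI gx fx; split => //.
    by apply: filterS h => z [[_ h1] _].
  by apply: filterS h => z [[h1 _] _]; rewrite dotNl oppr_gt0 => lt /h1 /(lt_trans lt); rewrite ltxx.
- move=> x n a gx a0 sd nOa.
  have an0 : a *: n != 0 by rewrite scaler_eq0 negb_or a0; case: gx.
  have [c cA sc] : exists2 c, c \in CA & side (tetra (cell_tetra c)) x (a *: n).
    apply: contrapT => hN.
    have hall c : c \in CA -> side (~` closure (tetra (cell_tetra c))) x (a *: n).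
      move=> cA; case: (generic_side (nd c) (PsCA cA) gx a0) => // h.
      by case: hN; exists c.
    have [z [za hz]] := side_meet an0 sd (side_all hall).
    have [c cA cz] := CAcl (subset_closure za).
    exact: hz c cA cz.
  have cOa := (CAE c).2 cA.
  have nt : ~ tetra (cell_tetra c) x by move=> /cOa.
  have cx := side_closure an0 sc.
  have [j [lj lpos sd' _]] := closure_tetra_cases (nd c) (PsCA cA) gx cx nt.
  have fx : face (cell_tetra c) j x.
    by apply/faceP => //; split => // i; exact: ((closure_tetraP (nd c) x).1 cx).
  have [c' c'S c'x] := CScl (boundary_Oa (closure_subset cOa cx) nOa).2.
  exists (facet (c, j)); last exact: fx.
  apply/map_f/interface_facesP; split => //= z fz; split.
    exact: closure_subset cOa _ (face_closure (nd c) fz).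
  apply: (closure_subset ((CSE c').2 c'S)).
  have [] // := shared_face k (fun=> 0) (nd c) (nd c') _ fz.
  by move=> i ij; apply: (cell_conforming k0 cx c'x); exact: lpos.
move=> x n _ _ gx /mapP[f fI ->] /mapP[f' f'I ->] fx f'x.
have [s1 m0 [a a0 mE] _] := face_side_in fI gx fx.
have [s2 m0' [b b0 mE'] _] := face_side_in f'I gx f'x.
have E : interior_side (facet f') = (b / a) *: interior_side (facet f).
  by rewrite mE mE' scalerA divfK.
have ba : b / a != 0 by rewrite mulf_neq0 // invr_eq0.
case: (ltgtP (b / a) 0) => [lt|gt|e]; last by rewrite e eqxx in ba.
(* With opposite normals the cell of [f'] would overlap the cell of [Os]
   behind [f]. *)
- exfalso; have [c [cS cx sc _]] := face_outer fI gx fx.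
  move: s2; rewrite E -[_ / _]opprK scaleNr -scalerN => /sideZ s2.
  have mm0 : - interior_side (facet f) != 0 by rewrite oppr_eq0.
  have /(cell_disjoint k0) e : tetra (cell_tetra c) `&` tetra (cell_tetra f'.1) !=set0.
    by apply: (side_meet mm0 sc); apply: s2; rewrite oppr_gt0.
  by apply: (@cells_excl c) => //; rewrite e (face_cellA f'I).
- move: s2; rewrite E => /(sideZ _ _ _ gt) s2.
  have /(cell_disjoint k0) e := side_meet m0 s1 s2.
  congr facet; case: f f' e fI f'I E {fx f'x s1 s2 m0 m0' mE mE'} => [c j] [c' j'] /= <- _ _ E.
  by have -> : j = j' by apply: (lam_not_parallel (nd c)); exact: E.
Qed.

Lemma cells_affine_family v (i : 'I_3) :
  affine_family Oa Ps [seq (cell_tetra c, interp_fun k v (cell_tetra c) i) | c <- CA].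
Proof.
have nd := cell_nondegenerate R k0; split.
- rewrite map_inj_in_uniq // => c c' _ _ /(congr1 fst) /= e; apply: (@cell_disjoint R k k0 c c').
  by rewrite e setIid; exists (centroid (cell_tetra c')); exact: tetra_centroid.
- by move=> _ /mapP[c cA ->] /=; split; [exact: nd|exact: PsCA|exact/CAE].
- by move=> _ _ /mapP[c cA ->] /mapP[c' c'A ->] /= /(cell_disjoint k0) ->.
- move=> x Ox; have [c cA cx] := CAcl (subset_closure Ox).
  by exists (cell_tetra c, interp_fun k v (cell_tetra c) i) => //; apply/mapP; exists c.
move=> x n _ _ _ _ /mapP[c cA ->] /mapP[c' c'A ->] /= cx c'x; rewrite !aff_interp_fun.
have [] // := interp_agree k v (nd c) (nd c') cx; last by move=> _ ->.
by move=> j; exact: cell_conforming.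
Qed.

End Interface.

(** * Bond volumes of one residue class *)

Section Connected.
Variable R : realType.
Notation V := 'cV[R]_3.

(** The unit interval is connected. *)
Lemma segment_boundary (A : set V) p q : open A -> A p -> ~ A q ->
  exists t : R, [/\ 0 <= t <= 1, closure A (p + t *: (q - p)) & ~ A (p + t *: (q - p))].
Proof.
move=> oA Ap nAq; apply: contrapT => hN.
pose g (t : R) : V := p + t *: (q - p).
have cg : continuous g.
  move=> t; apply: cvgD; first exact: cvg_cst.
  by apply: cvgZr_tmp; exact: cvg_id.
have hcl t : `[0, 1]%classic t -> closure A (g t) -> A (g t).
  move=> t01 ct; apply: contrapT => nt; apply: hN; exists t; split => //.
have E : `[0, 1]%classic `&` g @^-1` A = `[(0 : R), 1]%classic.
  apply: (@segment_connected R 0 1).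
  - exists 0; split; first by rewrite /= in_itv /= lexx ler01.
    by rewrite /= /g scale0r addr0.
  - by exists (g @^-1` A) => //; apply: open_comp.
  - exists (g @^-1` closure A); first by apply: preimage_closed => //; exact: closed_closure.
    apply/seteqP; split => t [t01 h]; split => //=; first exact: subset_closure.
    exact: hcl.
apply: nAq; have : `[(0 : R), 1]%classic 1 by rewrite /= in_itv /= lexx ler01.
by rewrite -E => -[_]; rewrite /= /g scale1r addrC subrK.
Qed.

Lemma interp_continuous k (y : 'cV[int]_3 -> V) T : continuous (interp k y T).
Proof.
move=> x; have h j : (aff (lam T j) z *: nodeval k y (col j T)) @[z --> x] -->
    aff (lam T j) x *: nodeval k y (col j T).
  by apply: (@cvgZr_tmp R V _ _ _ (aff (lam T j)) (aff (lam T j) x) _ (@aff_continuous R (lam T j) x)).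
rewrite /interp /continuous_at !big_ord_recl big_ord0.
under eq_fun do rewrite !big_ord_recl big_ord0.
exact: (cvgD (h _) (cvgD (h _) (cvgD (h _) (cvgD (h _) (cvg_cst _))))).
Qed.

(** The point [x] is a limit of points of [B], where both functions agree. *)
Lemma within_limit (A B : set V) (w g : V -> V) x :
  {within A, continuous w} -> continuous g -> A x -> closure B x -> B `<=` A ->
  (forall z, B z -> w z = g z) -> w x = g x.
Proof.
move=> /subspace_continuousP wA gc Ax Bx BA wg.
have PF : ProperFilter (within B (nbhs x)) by exact: within_nbhs_proper.
have h1 : w @ within B (nbhs x) --> w x.
  by apply: cvg_trans (wA _ Ax); apply: cvg_app; exact: within_subset.
have h2 : w @ within B (nbhs x) --> g x.
  have h3 : g @ within B (nbhs x) --> g x by apply: cvg_within_filter; exact: gc.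
  apply: cvg_trans h3; apply: near_eq_cvg.
  apply: (@filterS _ (nbhs x) _ setT); last exact: filterT.
  by move=> z _ Bz; rewrite wg.
exact: (@cvg_unique _ (@norm_hausdorff R V) _ _ _ _ h1 h2).
Qed.

End Connected.

Section Bonds.
Variables (R : realType) (k : nat) (M : 'I_3 -> nat) (Oa Os : set 'cV[R]_3).
Hypothesis k0 : (0 < k)%N.
Hypothesis reg : regions k M Oa Os.
Notation V := 'cV[R]_3.
Notation Zv := 'cV[int]_3.
Notation Gamma := (Gamma Oa Os).
Variable eta : Zv.
Hypothesis eta0 : forall i, eta i 0 != 0.
Notation B l := (bond_volume R k l eta).
Notation typeA l s := (typeA R k l eta s).
Notation theta l i := (theta R k l eta i).
Hypothesis far : forall l, closure (B l) `&` closure Oa !=set0 -> closure (B l) `<=` Omega R M.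
Variables (TB : Zv -> Zv -> seq 'M[R]_(3, 4)) (yB : (Zv -> V) -> Zv -> Zv -> V -> V).
Hypothesis bi : forall l, in_BGamma k Oa Os l eta ->
    [/\ tetra_decomposition (B l) (TB l eta),
        forall y, {within closure (B l) `\` Gamma, continuous (yB y l eta)},
        decomposition_kinds k Oa Os TB l eta,
        decomposition_compatible k Oa Os TB l eta
      & forall y T, T \in TB l eta -> affine_interpolant k y T (yB y l eta)].
Implicit Types (x : V) (l : Zv).

Definition inner_bond l : Prop := closure (B l) `<=` Oa.

(** The tetrahedra of a bond volume on the atomistic side; inner bond volumes,
    which carry no given interpolant, are type A decomposed. *)
Definition atomistic_tets l : seq 'M[R]_(3, 4) :=
  if `[< inner_bond l >] then [seq typeA l s | s <- enum {: 'S_3}]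
  else [seq T <- undup (TB l eta) | `[< tetra T `<=` Oa >]].

Definition relevant l : Prop := inner_bond l \/ in_BGamma k Oa Os l eta.

Lemma inner_bond_Gamma l : inner_bond l -> ~ in_BGamma k Oa Os l eta.
Proof.
move=> inn; have nG x : closure (B l) x -> ~ Gamma x.
  by move=> /inn ax /(Gamma_notin reg)[].
by case=> [[x [Bx Gx]]|[_ [x [Bx Gx]]]]; [move: (subset_closure Bx) Gx|move: Bx Gx];
   exact: nG.
Qed.

Lemma bond_planes_neq0 l P : P \in bond_planes R k l eta -> P.1 != 0.
Proof.
rewrite mem_cat => h; have nz i : (theta l i).1 != 0.
  rewrite scaler_eq0 negb_or invr_eq0 mulf_neq0 ?etaR_neq0 ?eps_neq0 //=.
  by apply/eqP => /matrixP/(_ i 0)/eqP; rewrite !mxE !eqxx oner_eq0.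
by case/orP: h => /mapP[i _ ->]; rewrite /= ?oppr_eq0; exact: nz.
Qed.

Lemma open_in_bond (A : set V) l : open A -> A `<=` closure (B l) -> A `<=` B l.
Proof.
move=> oA; rewrite (bond_polyhedron R k0 l eta0) closure_polyhedron; last first.
  by rewrite -bond_polyhedron //; exact: bond_neq0.
by apply: open_sub_polyhedron => // P; exact: bond_planes_neq0.
Qed.

Lemma TB_tets l T : in_BGamma k Oa Os l eta -> T \in TB l eta ->
  nondegenerate_tetra T /\ tetra T `<=` B l.
Proof.
move=> /bi[[nd _ clB] _ _ _ _] TT; have ndT := nd _ TT; split => //.
apply: open_in_bond; first exact: open_tetra.
by move=> x Tx; rewrite clB; exists T => //; exact: subset_closure.
Qed.

Lemma atomistic_tetsP l T : relevant l -> T \in atomistic_tets l ->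
  [/\ nondegenerate_tetra T, tetra T `<=` B l, tetra T `<=` Oa & lattice_vertices k T].
Proof.
rewrite /atomistic_tets => rl; case: asboolP => [inn /mapP[s _ ->]|ninn].
  split; [exact: typeA_nondegenerate|exact: typeA_sub| |exact: typeA_lattice].
  by move=> x /(typeA_sub k0 eta0)/subset_closure/inn.
have gl : in_BGamma k Oa Os l eta by case: rl.
rewrite mem_filter mem_undup => /andP[/asboolP TO TT].
have [ndT TBl] := TB_tets gl TT; have [_ _ kd _ _] := bi gl.
by split => //; have [_ _] := kd _ TT; apply.
Qed.

Lemma atomistic_tets_uniq l : uniq (atomistic_tets l).
Proof.
rewrite /atomistic_tets; case: asboolP => _; last by rewrite filter_uniq // undup_uniq.
rewrite map_inj_uniq ?enum_uniq // => s s' e.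
have [] // := @typeA_disjoint R k k0 l l eta s s' eta0.
  by move=> i; exists 0; rewrite mul0r addr0.
rewrite e setIid; exists (centroid (typeA l s')); apply/tetra_centroid.
exact: typeA_nondegenerate.
Qed.

Lemma atomistic_tets_disjoint l T T' : relevant l -> T \in atomistic_tets l ->
  T' \in atomistic_tets l -> tetra T `&` tetra T' !=set0 -> T = T'.
Proof.
rewrite /atomistic_tets => rl; case: asboolP => [inn /mapP[s _ ->] /mapP[s' _ ->]|ninn].
  move=> h; have [|_ -> //] := typeA_disjoint k0 eta0 _ h.
  by move=> i; exists 0; rewrite mul0r addr0.
have gl : in_BGamma k Oa Os l eta by case: rl.
rewrite !mem_filter !mem_undup => /andP[_ TT] /andP[_ TT'] [x Tx].
have [[_ dis _] _ _ _ _] := bi gl.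
apply/eqP/negPn/negP => ne.
by move: Tx; rewrite (dis _ _ TT TT' ne).
Qed.

Lemma atomistic_tets_cover l x : relevant l -> closure (B l) x -> Oa x ->
  exists2 T, T \in atomistic_tets l & closure (tetra T) x.
Proof.
rewrite /atomistic_tets => rl Bx Ox; case: asboolP => [inn|ninn].
  have [s sx] := typeA_cover k0 eta0 Bx.
  by exists (typeA l s) => //; apply/mapP; exists s; rewrite ?mem_enum.
have gl : in_BGamma k Oa Os l eta by case: rl.
have [[nd dis clB] _ kd _ _] := bi gl.
move: Bx; rewrite clB => -[T /= TT Tx]; exists T => //.
rewrite mem_filter mem_undup TT andbT; apply/asboolP.
have [[TS|//] _ _] := kd _ TT.
by case: (Oa_Os reg Ox); exact: closure_subset TS _ Tx.
Qed.

(** If it is not contained in [Oa], a segment inside the bond volume leaves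
    [Oa], through the interface. *)
Lemma meeting_bond l : B l `&` Oa !=set0 -> relevant l /\ lattice R k M l.
Proof.
move=> [p [Bp Op]]; have BO : closure (B l) `<=` Omega R M.
  by apply: far; exists p; split; exact: subset_closure.
split; last first.
  apply: BO; apply/(closure_bondP k0 l eta0) => i.
  by rewrite thetaE // nodeE mulrAC divff ?eps_neq0 // mul1r subrr mul0r lexx ler01.
case: (pselect (inner_bond l)) => inn; first by left.
right; case: (pselect (B l `<=` Oa)) => BOa; [right|left].
  split => //; apply: contrapT => hN; apply: inn => x Bx; apply: contrapT => nOx.
  apply: hN; exists x; split => //; apply: (boundary_Oa reg) nOx.
  exact: closure_subset BOa _ Bx.
have [q [Bq nOq]] : exists q, B l q /\ ~ Oa q.
  apply: contrapT => hN; apply: BOa => q Bq; apply: contrapT => nq.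
  by apply: hN; exists q.
have [t [/andP[t0 t1] ct nt]] := segment_boundary (open_Oa reg) Op nOq.
exists (p + t *: (q - p)); split; last exact: (boundary_Oa reg).
apply/(bond_volumeP k0 l eta0) => i.
have /(bond_volumeP k0 l eta0)/(_ i)/andP[p0 p1] := Bp.
have /(bond_volumeP k0 l eta0)/(_ i)/andP[q0 q1] := Bq.
rewrite affD dotZr -affB.
move: p0 p1 q0 q1; set a := aff _ p; set b := aff _ q => p0 p1 q0 q1.
have [->|t1'] := eqVneq t 1; first by apply/andP; split; lra.
have t2 : 0 < 1 - t by rewrite subr_gt0 lt_neqAle t1'.
have h1 := mulr_gt0 t2 p0; have h2 := mulr_ge0 t0 (ltW q0).
have h3 : 0 < (1 - t) * (1 - a) by rewrite mulr_gt0 // subr_gt0.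
have h4 : 0 <= t * (1 - b) by rewrite mulr_ge0 // subr_ge0 ltW.
apply/andP; split; lra.
Qed.

(** On an interface bond volume both values are limits of the given
    interpolant, which is continuous off the interface; on an inner one the
    type A decomposition is conforming. *)
Lemma atomistic_tets_continuous v l T T' x : relevant l -> T \in atomistic_tets l ->
  T' \in atomistic_tets l -> Oa x -> closure (tetra T) x -> closure (tetra T') x ->
  interp k v T x = interp k v T' x.
Proof.
move=> rl TT TT' Ox Tx T'x.
case: (pselect (inner_bond l)) => [inn|ninn].
  move: TT TT'; rewrite /atomistic_tets asboolT // => /mapP[s _ E] /mapP[s' _ E'].
  rewrite E E' in Tx T'x *.
  have nd u := typeA_nondegenerate R k0 l eta0 u.
  have [] // := interp_agree k v (nd s) (nd s') Tx.
  move=> j; apply: (typeA_conforming k0 eta0) => // i; exists 0.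
  by rewrite mul0r addr0.
have gl : in_BGamma k Oa Os l eta by case: rl.
have [_ cy _ _ ai] := bi gl.
have yBx T1 : T1 \in atomistic_tets l -> closure (tetra T1) x -> yB v l eta x = interp k v T1 x.
  move=> T1T T1x; have [nd T1B T1O lat] := atomistic_tetsP rl T1T.
  apply: (within_limit (cy v) (@interp_continuous R k v T1) _ T1x).
  - split; first exact: closure_subset T1B _ T1x.
    by move=> /(Gamma_notin reg)[].
  - move=> z Tz; split; first exact/subset_closure/T1B.
    by move=> /(Gamma_notin reg)[]; move/T1O: Tz.
  move=> z Tz; apply: interp_unique Tz => //; apply: ai.
  by move: T1T; rewrite /atomistic_tets asboolF // mem_filter mem_undup => /andP[].
by rewrite -(yBx T) // -(yBx T').
Qed.

Definition congruent l l' : Prop := forall i, exists d : int, l' i 0 = l i 0 + d * eta i 0.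

Variable Ps : seq (V * R).

Section Crossing.
Variables (l : Zv) (x n : V).
Hypotheses (lPs : {subset bond_planes R k l eta <= Ps}) (gx : generic Ps x n).

(** A facet of the bond volume through a generic point determines the normal
    [n]. *)
Lemma theta_normal i : aff (theta l i) x = 0 \/ aff (theta l i) x = 1 ->
  exists2 c : R, c != 0 & delta_mx i 0 = c *: n.
Proof.
move=> h.
have [P [PP PE P0]] : exists P, [/\ P \in Ps, P.1 = (theta l i).1 \/ P.1 = - (theta l i).1
    & aff P x = 0].
  case: h => h.
    exists (theta l i); split => //; last by left.
    by apply: lPs; rewrite mem_cat; apply/orP; left; apply: map_f; rewrite mem_enum.
  exists (- (theta l i).1, 1 - (theta l i).2); split; last by rewrite aff_opp_theta h subrr.
    by apply: lPs; rewrite mem_cat; apply/orP; right; apply/mapP; exists i; rewrite ?mem_enum.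
  by right.
have [c cE] := gx.2 _ PP P0.
have e0 : (eps R k * (eta i 0)%:~R) != 0 by rewrite mulf_neq0 ?etaR_neq0 ?eps_neq0.
have [c' E] : exists c' : R, delta_mx i 0 = c' *: n.
  case: PE => PE.
    exists (eps R k * (eta i 0)%:~R * c).
    by rewrite -scalerA -cE PE /= scalerA divff // scale1r.
  exists (- (eps R k * (eta i 0)%:~R * c)).
  by rewrite scaleNr -scalerA -cE PE /= scalerN opprK scalerA divff // scale1r.
exists c' => //; apply/eqP => c0; move: E; rewrite c0 scale0r => /matrixP/(_ i 0)/eqP.
by rewrite !mxE !eqxx oner_eq0.
Qed.

(** Two bond volumes meeting along an edge or a vertex would give two
    different normals at [x]; so they share a facet and are attached. *)
Lemma congruent_attached l' : congruent l l' -> l <> l' ->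
  closure (B l) x -> closure (B l') x ->
  exists i, [/\ aff (theta l i) x = 0 \/ aff (theta l i) x = 1,
    aff (theta l' i) x = 0 \/ aff (theta l' i) x = 1, attached eta l l' & forall z, closure (B l) z -> z i 0 = x i 0 -> closure (B l') z].
Proof.
move=> ll' ne /(closure_bondP k0 l eta0) b1 /(closure_bondP k0 l' eta0) b2.
have [d dE] := choice ll'.
have th i z := theta_shift k0 z eta0 (dE i).
have dR i : d i = 0 \/ (d i = 1 /\ aff (theta l i) x = 1) \/ (d i = -1 /\ aff (theta l i) x = 0).
  have := b1 i; have := b2 i; rewrite th // => /andP[h1 h2] /andP[h3 h4].
  have g1 : d i <= 1 by rewrite -(ler_int R) /= mulr1z; lra.
  have g2 : -1 <= d i by rewrite -(ler_int R) rmorphN /= mulr1z; lra.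
  have [e|[e|e]] : d i = 0 \/ d i = 1 \/ d i = -1 by lia.
  - by left.
  - by right; left; split => //; move: h1 h2; rewrite e mulr1z => h1 h2; lra.
  - by right; right; split => //; move: h1 h2; rewrite e rmorphN /= mulr1z => h1 h2; lra.
have [i di] : exists i, d i != 0.
  apply: contrapT => hN; apply: ne; apply/matrixP => i j; rewrite ord1 dE.
  have [->|h] := eqVneq (d i) 0; first by rewrite mul0r addr0.
  by case: hN; exists i.
have hi : aff (theta l i) x = 0 \/ aff (theta l i) x = 1.
  by case: (dR i) => [e|[[_ ->]|[_ ->]]]; [rewrite e eqxx in di|right|left].
have other i' : i' != i -> d i' = 0.
  move=> ii'; apply/eqP/negPn/negP => di'.
  have hi' : aff (theta l i') x = 0 \/ aff (theta l i') x = 1.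
    by case: (dR i') => [e|[[_ ->]|[_ ->]]]; [rewrite e eqxx in di'|right|left].
  have [c c0 cE] := theta_normal hi; have [c' c0' cE'] := theta_normal hi'.
  have := congr1 (fun u : V => u i' 0) cE; rewrite !mxE (negbTE ii') /= => /esym/eqP.
  rewrite mulf_eq0 (negbTE c0) /= => /eqP n0.
  have := congr1 (fun u : V => u i' 0) cE'; rewrite !mxE !eqxx /= n0 mulr0 => /eqP.
  by rewrite oner_eq0.
have l'E : l' = l + d i *: (eta i 0 *: delta_mx i 0).
  apply/matrixP => i' j; rewrite ord1 !mxE dE.
  have [->|ii'] := eqVneq i' i; first by rewrite !eqxx mulr1.
  by rewrite other // mul0r /= !mulr0.
exists i; split => //.
- rewrite th; case: (dR i) => [e|[[-> ->]|[-> ->]]]; first by rewrite e eqxx in di.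
    by left; rewrite mulr1z subrr.
  by right; rewrite rmorphN /= mulr1z sub0r opprK.
- exists i; rewrite l'E; case: (dR i) => [e|[[-> _]|[-> _]]]; first by rewrite e eqxx in di.
    by left; rewrite scale1r.
  by right; rewrite scaleN1r.
move=> z /(closure_bondP k0 l eta0) bz zi; apply/(closure_bondP k0 l' eta0) => i'.
rewrite th; have [->|ii'] := eqVneq i' i; last by rewrite other // subr0; exact: bz.
have -> : aff (theta l i) z = aff (theta l i) x by rewrite !thetaE // zi.
case: (dR i) => [e|[[-> ->]|[-> ->]]]; first by rewrite e eqxx in di.
  by rewrite mulr1z subrr lexx ler01.
by rewrite rmorphN /= mulr1z sub0r opprK lexx ler01.
Qed.

End Crossing.

(** Both tetrahedra touch [x] from the side of the bond volume; so they
    overlap. *)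
Lemma atomistic_tets_boundary l T T' i x n : relevant l ->
  {subset bond_planes R k l eta <= Ps} ->
  (forall T, T \in atomistic_tets l -> {subset planes T <= Ps}) -> generic Ps x n ->
  T \in atomistic_tets l -> T' \in atomistic_tets l ->
  closure (tetra T) x -> closure (tetra T') x ->
  aff (theta l i) x = 0 \/ aff (theta l i) x = 1 -> T = T'.
Proof.
move=> rl lPs TPs gx TT TT' Tx T'x hi.
have [nd TB1 _ _] := atomistic_tetsP rl TT; have [nd' TB2 _ _] := atomistic_tetsP rl TT'.
have nB : ~ B l x.
  move=> /(bond_volumeP k0 l eta0)/(_ i); case: hi => ->; first by rewrite ltxx.
  by rewrite ltxx andbF.
have nt : ~ tetra T x by move=> /TB1. have nt' : ~ tetra T' x by move=> /TB2.
have [j [_ _ sd [a a0 aE]]] := closure_tetra_cases nd (TPs _ TT) gx Tx nt.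
have [j' [_ _ sd' [b b0 bE]]] := closure_tetra_cases nd' (TPs _ TT') gx T'x nt'.
have E : (lam T' j').1 = (b / a) *: (lam T j).1 by rewrite bE aE scalerA divfK.
have ba : b / a != 0 by rewrite mulf_neq0 // invr_eq0.
have m0 := lam_neq0 nd j.
apply: (atomistic_tets_disjoint rl) => //.
case: (ltgtP (b / a) 0) => [lt|gt|e]; last by rewrite e eqxx in ba.
- exfalso; move: sd'; rewrite E -[_ / _]opprK scaleNr -scalerN => /sideZ sd'.
  have {}sd' : side (tetra T') x (- (lam T j).1) by apply: sd'; rewrite oppr_gt0.
  have BP : exists P : V * R, aff P x = 0 /\ B l `<=` [set z | 0 < aff P z].
    case: hi => hi; [exists (theta l i)|exists (- (theta l i).1, 1 - (theta l i).2)].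
      by split => // z /(bond_volumeP k0 l eta0)/(_ i)/andP[].
    split; first by rewrite aff_opp_theta hi subrr.
    by move=> z /(bond_volumeP k0 l eta0)/(_ i)/andP[_ h]; rewrite /= aff_opp_theta subr_gt0.
  have [P [P0 BP']] := BP.
  apply: (side_plane_excl m0 P0); first exact: sideS (subset_trans TB1 BP') sd.
  exact: sideS (subset_trans TB2 BP') sd'.
- by move: sd'; rewrite E => /(sideZ _ _ _ gt); exact: side_meet.
Qed.

(** The face of [T] through [x] lies on a facet of the bond volume. The
    compatibility condition makes it a face of a tetrahedron of the neighbour,
    which by [atomistic_tets_boundary] is [T']. *)
Lemma crossing_continuous v l l' T T' x n : in_BGamma k Oa Os l eta -> relevant l' ->
  congruent l l' -> l <> l' ->
  {subset bond_planes R k l eta <= Ps} -> {subset bond_planes R k l' eta <= Ps} ->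
  (forall T, T \in atomistic_tets l -> {subset planes T <= Ps}) ->
  (forall T, T \in atomistic_tets l' -> {subset planes T <= Ps}) ->
  generic Ps x n -> Oa x ->
  T \in atomistic_tets l -> T' \in atomistic_tets l' ->
  closure (tetra T) x -> closure (tetra T') x ->
  interp k v T x = interp k v T' x.
Proof.
move=> gl rl' ll' ne lPs l'Ps TPs TPs' gx Ox TT TT' Tx T'x.
have rl : relevant l by right.
have [nd TBl TO lat] := atomistic_tetsP rl TT.
have [nd' TBl' TO' lat'] := atomistic_tetsP rl' TT'.
have Bx := closure_subset TBl Tx; have B'x := closure_subset TBl' T'x.
have [i [hi hi' att clB']] := congruent_attached lPs gx ll' ne Bx B'x.
have nB (z : V) : z i 0 = x i 0 -> ~ B l z.
  move=> zi /(bond_volumeP k0 l eta0)/(_ i).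
  have -> : aff (theta l i) z = aff (theta l i) x by rewrite !thetaE // zi.
  by case: hi => ->; rewrite ltxx ?andbF.
have nt : ~ tetra T x by move=> /TBl; exact: nB.
have [j [lj lpos sd [a a0 aE]]] := closure_tetra_cases nd (TPs _ TT) gx Tx nt.
have [c c0 cE] := theta_normal lPs gx hi.
have fi z : face T j z -> z i 0 = x i 0.
  move=> /(faceP nd)[_ z0]; apply/eqP; rewrite -subr_eq0.
  have -> : z i 0 - x i 0 = dot (delta_mx i 0) (z - x) by rewrite dotC dot_delta !mxE.
  have -> : (delta_mx i 0 : V) = (c / a) *: (lam T j).1 by rewrite aE scalerA divfK.
  by rewrite dotZl -affB z0 lj subrr mulr0.
have fx : face T j x by apply/faceP => //; split => // i'; exact: ((closure_tetraP nd x).1 Tx).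
have TT2 : T \in TB l eta.
  have ninn : ~ inner_bond l by move=> /inner_bond_Gamma.
  by move: TT; rewrite /atomistic_tets asboolF // mem_filter mem_undup => /andP[].
have [_ _ kd cp _] := bi gl.
have f1 : face T j `<=` boundary (B l `&` Oa).
  move=> z fz; split.
    by apply: (@closure_subset _ (tetra T)); [move=> w Tw; split; [exact: TBl|exact: TO]|exact: face_closure fz].
  by move=> /interior_subset[Bz _]; apply: (nB z (fi z fz) Bz).
have f2 : ~ (face T j `<=` Gamma) by move=> /(_ _ fx)/(Gamma_notin reg)[].
have f3 : face T j `<=` closure (B l').
  by move=> z fz; apply: clB'; [exact: closure_subset TBl _ (face_closure nd fz)|exact: fi].
have [c1 c2] := cp T j TT2 TO f1 f2 l' att f3.
(* The tetrahedron of the neighbouring bond volume that has the same face,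
   in either case of the compatibility condition. *)
have [T2 [T2T hT2]] : exists T2, T2 \in atomistic_tets l' /\
    forall i, i != j -> exists j', col i T = col j' T2.
  have fv T2 j2 : same_face T j T2 j2 -> forall i, i != j -> exists j', col i T = col j' T2.
    move=> sf i' i'j; have : face_vertices T j (col i' T) by exists i'.
    by rewrite sf => -[j' _ e]; exists j'.
  case: (pselect (B l' `<=` Oa)) => [BO|nBO].
    have [[s [j2 /fv hs]] it] := c1 BO.
    case: (pselect (inner_bond l')) => [inn|ninn].
      exists (typeA l' s); split => //; rewrite /atomistic_tets asboolT //.
      by apply: map_f; rewrite mem_enum.
    have gl' : in_BGamma k Oa Os l' eta by case: rl'.
    have [_ /(_ s)[T2 T2T vT2]] := it gl'.
    have [nd2 T2B] := TB_tets gl' T2T.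
    exists T2; split.
      rewrite /atomistic_tets asboolF // mem_filter mem_undup T2T andbT.
      exact/asboolP/(subset_trans T2B).
    move=> i' /hs[j' ->]; exact: same_vertices (esym vT2).
  have gl' : in_BGamma k Oa Os l' eta.
    by case: rl' => // inn; case: nBO => z /subset_closure/inn.
  have [T2 [j2 [T2T /fv hs]]] := c2 nBO.
  exists T2; split => //.
  have [nd2 T2B] := TB_tets gl' T2T.
  have [T2x _] := shared_face k v nd nd2 hs fx.
  have ninn : ~ inner_bond l' by move=> /inner_bond_Gamma.
  rewrite /atomistic_tets asboolF // mem_filter mem_undup T2T andbT; apply/asboolP.
  have [_ _ kd' _ _] := bi gl'; have [[T2S|//] _ _] := kd' _ T2T.
  by case: (Oa_Os reg Ox); exact: closure_subset T2S _ T2x.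
have [nd2 _ _ _] := atomistic_tetsP rl' T2T.
have [T2x ->] := shared_face k v nd nd2 hT2 fx.
suff -> : T2 = T' by [].
by apply: (atomistic_tets_boundary rl' l'Ps TPs' gx T2T TT' T2x T'x hi').
Qed.

Definition congruentb (r l : Zv) : bool := [forall i, l i 0 - r i 0 \in dvdz (eta i 0)].

Lemma congruentbP r l l' : congruentb r l -> congruentb r l' -> congruent l l'.
Proof.
move=> /forallP h /forallP h' i.
have /dvdzP[a aE] := h i; have /dvdzP[b bE] := h' i.
by exists (b - a); rewrite mulrBl -aE -bE; ring.
Qed.

Variable L : seq Zv.
Hypotheses (uL : uniq L) (LE : forall l, l \in L <-> lattice R k M l /\ relevant l)
  (LPs : forall l, l \in L -> {subset bond_planes R k l eta <= Ps})
  (TPs : forall l T, l \in L -> T \in atomistic_tets l -> {subset planes T <= Ps}).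

Definition class_family r (v : Zv -> V) (i : 'I_3) : seq ('M[R]_(3, 4) * (V * R)) :=
  [seq (T, interp_fun k v T i) | l <- [seq l <- L | congruentb r l], T <- atomistic_tets l].

Lemma class_familyP r v i e : e \in class_family r v i -> exists l T,
  [/\ l \in L, congruentb r l, T \in atomistic_tets l & e = (T, interp_fun k v T i)].
Proof.
move=> /allpairsPdep[l [T [+ TT ->]]]; rewrite mem_filter => /andP[cl lL].
by exists l, T.
Qed.

(** The coordinates of [x] are rounded down in units of [eta]. *)
Lemma class_tiling (r : Zv) x : exists l, congruentb r l /\ closure (B l) x.
Proof.
pose t i : R := (x i 0 / eps R k - (r i 0)%:~R) / (eta i 0)%:~R.
pose l : Zv := \col_i (r i 0 + Num.floor (t i) * eta i 0).
exists l; split.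
  apply/forallP => i; rewrite mxE addrAC subrr add0r dvdz_mull //.
apply/(closure_bondP k0 l eta0) => i.
have e0 := etaR_neq0 R eta0 i.
have -> : aff (theta l i) x = t i - (Num.floor (t i))%:~R.
  by rewrite thetaE // mxE rmorphD rmorphM /= /t; field; rewrite e0 eps_neq0.
have /andP[h1 h2] := floor_itv (t i); rewrite rmorphD /= mulr1z in h2.
by apply/andP; split; lra.
Qed.

(** Here the assumptions on the decompositions combine: one residue class of
    bond volumes yields a continuous piecewise affine function on [Oa]. *)
Lemma class_affine_family r v i : affine_family Oa Ps (class_family r v i).
Proof.
have rel l : l \in L -> relevant l by move=> /LE[].
have same l l' T T' : l \in L -> l' \in L -> congruentb r l -> congruentb r l' ->
    T \in atomistic_tets l -> T' \in atomistic_tets l' -> tetra T `&` tetra T' !=set0 ->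
    l = l' /\ T = T'.
  move=> lL l'L rl rl' TT TT' [x [Tx T'x]].
  have [_ TBl _ _] := atomistic_tetsP (rel _ lL) TT.
  have [_ TBl' _ _] := atomistic_tetsP (rel _ l'L) TT'.
  have E : l = l'.
    apply: (bond_disjoint k0 eta0 (congruentbP rl rl')); exists x.
    by split; [exact: TBl|exact: TBl'].
  split => //; rewrite -E in TT'.
  by apply: (atomistic_tets_disjoint (rel _ lL)) => //; exists x.
split.
- apply: allpairs_uniq_dep => //; first exact: filter_uniq.
    by move=> l _; exact: atomistic_tets_uniq.
  move=> e e' /allpairsPdep[l [T [+ TT ->]]] /allpairsPdep[l' [T' [+ TT' ->]]] /=.
  rewrite !mem_filter => /andP[rl lL] /andP[rl' l'L] /(congr1 fst) /= e1.
  have [nd _ _ _] := atomistic_tetsP (rel _ lL) TT.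
  rewrite -e1 in TT' *.
  have [|<- _ //] := same l l' T T lL l'L rl rl' TT TT'.
  by rewrite setIid; exists (centroid T); exact: tetra_centroid.
- move=> _ /class_familyP[l [T [lL _ TT ->]]] /=.
  have [nd _ TO _] := atomistic_tetsP (rel _ lL) TT.
  by split => //; exact: TPs TT.
- move=> _ _ /class_familyP[l [T [lL rl TT ->]]] /class_familyP[l' [T' [l'L rl' TT' ->]]] /=.
  by move=> /(same _ _ _ _ lL l'L rl rl' TT TT')[_ ->].
- move=> x Ox; have [l [rl Bx]] := class_tiling r x.
  have hm : B l `&` Oa !=set0.
    by rewrite setIC; exact: open_meets_closure (open_Oa reg) Ox Bx.
  have [rel_l lat] := meeting_bond hm.
  have lL : l \in L by apply/LE.
  have [T TT Tx] := atomistic_tets_cover rel_l Bx Ox.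
  exists (T, interp_fun k v T i) => //.
  by apply/allpairsPdep; exists l, T; rewrite mem_filter rl lL.
move=> x n _ _ gx Ox /class_familyP[l [T [lL rl TT ->]]] /class_familyP[l' [T' [l'L rl' TT' ->]]] /=.
move=> Tx T'x; rewrite !aff_interp_fun; congr (fun_of_matrix _ _ _).
have [E|ne] := pselect (l = l').
  by rewrite -E in TT'; exact: (atomistic_tets_continuous v (rel _ lL) TT TT').
have cl := congruentbP rl rl'; have cl' := congruentbP rl' rl.
have TP := fun T => TPs (T := T) lL; have TP' := fun T => TPs (T := T) l'L.
case: (rel _ lL) => [inn|gl]; last first.
  exact: (crossing_continuous v gl (rel _ l'L) cl ne (LPs lL) (LPs l'L) TP TP' gx Ox).
case: (rel _ l'L) => [inn'|gl']; last first.
  symmetry; apply: (crossing_continuous v gl' (rel _ lL) cl' _ (LPs l'L) (LPs lL) TP' TP gx Ox) => //.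
  by move=> e; exact: ne.
move: TT TT'; rewrite /atomistic_tets !asboolT // => /mapP[s _ E] /mapP[s' _ E'].
rewrite E E' in Tx T'x *.
have nd u l1 := typeA_nondegenerate R k0 l1 eta0 u.
have [] // := interp_agree k v (nd s l) (nd s' l') Tx.
by move=> j; exact: (typeA_conforming k0 eta0 cl).
Qed.

End Bonds.

(** * Volumes and sums over one period *)

Section Indicators.
Context d (T : measurableType d) (R : realType) (mu : {measure set T -> \bar R}).

Lemma Rintegral_indic (A : set T) : measurable A -> (mu A < +oo)%E ->
  mu.-integrable setT (EFin \o (\1_A : T -> R)) /\ \int[mu]_x (\1_A x : R) = fine (mu A).
Proof.
move=> mA fA; have E : (\int[mu]_x (\1_A x)%:E = mu A)%E.
  by rewrite integral_indic // setIT.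
split; last by rewrite /Rintegral E.
apply/integrableP; split; first exact/measurable_EFinP/measurable_indic.
rewrite (eq_integral (fun x => (\1_A x)%:E)) ?E // => x _ /=.
by rewrite ger0_norm // indicE ler0n.
Qed.

End Indicators.

Section Volumes.
Variable R : realType.
Notation V := 'cV[R]_3.
Notation tet := 'M[R]_(3, 4).
Notation T1 := (measurableTypeR R).
Notation T2 := (T1 * T1)%type.
Notation T3 := (T1 * T1 * T1)%type.

Lemma planes_null (Ps : seq (V * R)) : (forall P, P \in Ps -> P.1 != 0) ->
  exists N : set T3, [/\ measurable N, leb3 R N = 0%E &
    forall p, ~ N p -> forall P, P \in Ps -> aff P (point3 p) != 0].
Proof.
move=> P0; have [|N [mN N0 hN]] :=
    @null_seq _ T3 R (leb3 R) _ Ps (fun P => [set p | aff P (point3 p) = 0]).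
  by move=> P /P0/plane_null.
exists N; split => // p np P PP; apply/eqP => h; apply: np.
exact: hN PP _ h.
Qed.

(** The planes of the tetrahedra are null sets. *)
Lemma integral3_cells (r : seq tet) (D : set V) (f : V -> R) (c : tet -> R) :
  uniq r -> (forall T, T \in r -> nondegenerate_tetra T) ->
  (forall T T', T \in r -> T' \in r -> tetra T `&` tetra T' !=set0 -> T = T') ->
  (forall T x, T \in r -> tetra T x -> D x /\ f x = c T) ->
  (forall x, D x -> (forall T j, T \in r -> aff (lam T j) x != 0) ->
     exists2 T, T \in r & tetra T x) ->
  integral3 D f = \sum_(T <- r) volume T * c T.
Proof.
move=> ur nd dis DT cov.
have [|N [mN N0 hN]] := @planes_null (flatten [seq planes T | T <- r]).
  by move=> P /flattenP[_ /mapP[T Tr ->] /mapP[j _ ->]]; exact: lam_neq0 (nd _ Tr) j.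
pose I (T : tet) : T3 -> R := \1_((@point3 R : T3 -> V) @^-1` tetra T).
have hI T : T \in r -> (leb3 R).-integrable setT (EFin \o I T) /\
    \int[leb3 R]_p I T p = volume T.
  by move=> /nd ndT; apply: Rintegral_indic; [exact: measurable_tetra|exact: volume_lt_top].
have IE T p : I T p = if `[< tetra T (point3 p) >] then 1 else 0.
  by rewrite /I indicE; case: asboolP => h; [rewrite mem_set|rewrite memNset].
rewrite /integral3 (@Rintegral_null_ext _ T3 R (leb3 R) N _ _ (fun p => \sum_(T <- r) c T * I T p)) //.
  have [|-> _] := @Rintegral_sum _ T3 R (leb3 R) _ r c I; first by move=> T /hI[].
  by rewrite !big_seq; apply: eq_bigr => T /hI[_ ->]; rewrite mulrC.
move=> p np; have hp := hN p np.
rewrite patchE; case: ifPn => [/set_mem Dp|/negP nDp].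
  have [T Tr Tp] : exists2 T, T \in r & tetra T (point3 p).
    apply: cov => // T j Tr; apply: hp; apply/flattenP; exists (planes T); last exact: mem_planes.
    exact: map_f.
  rewrite (bigD1_seq T) //= IE asboolT // mulr1 (DT _ _ Tr Tp).2 big_seq_cond big1 ?addr0 //.
  move=> T' /andP[T'r ne]; rewrite IE asboolF ?mulr0 // => T'p.
  by move/eqP: ne; apply; apply: dis => //; exists (point3 p).
rewrite big_seq big1 // => T Tr; rewrite IE asboolF ?mulr0 // => Tp.
by apply: nDp; apply/mem_set; exact: (DT _ _ Tr Tp).1.
Qed.

Lemma integral3_box (a b : V) : (forall i, a i 0 <= b i 0) ->
  integral3 [set x : V | forall i, a i 0 < x i 0 < b i 0] (fun=> 1) =
  \prod_i (b i 0 - a i 0).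
Proof.
move=> ab; pose I i : set T1 := `]a i 0, b i 0[%classic.
have E : (@point3 R : T3 -> V) @^-1` [set x : V | forall i, a i 0 < x i 0 < b i 0] =
    (I 0 `*` I 1) `*` I 2%:R.
  apply/seteqP; split => p; rewrite /I /= !in_itv /=.
    move=> h; have := h 0; have := h 1; have := h 2%:R.
    by rewrite point3_0 point3_1 point3_2.
  move=> [[h0 h1] h2] i.
  by have [->|->|->] := ord3_cases i; rewrite ?point3_0 ?point3_1 ?point3_2.
have mI i : measurable (I i) by exact: measurable_itv.
have lI i : leb1 R (I i) = (b i 0 - a i 0)%:E.
  rewrite lebesgue_measure_itv /= lte_fin; case: ifPn => // /negbTE nlt.
  have -> : b i 0 = a i 0 by apply/eqP; rewrite eq_le ab leNgt nlt.
  by rewrite subrr.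
rewrite /integral3 E Rintegral_cst; last by apply: measurableX => //; exact: measurableX.
have E3 : leb3 R ((I 0 `*` I 1) `*` I 2%:R) = (leb2 R (I 0%R `*` I 1%R) * leb1 R (I 2%:R%R))%E.
  by apply: product_measure1E => //; exact: measurableX.
have E2 : leb2 R (I 0 `*` I 1) = (leb1 R (I 0%R) * leb1 R (I 1%R))%E by exact: product_measure1E.
rewrite mul1r; transitivity (fine (leb2 R (I 0%R `*` I 1%R) * leb1 R (I 2%:R%R))%E).
  by congr fine; exact: E3.
have prod3 (g : 'I_3 -> R) : \prod_i g i = g 0 * g 1 * g 2%:R.
  rewrite !big_ord_recl big_ord0 mulr1 mulrA; congr (_ * g _ * g _); exact/val_inj.
by rewrite E2 !lI /= prod3.
Qed.

Lemma volume_translate (T : tet) u : nondegenerate_tetra T ->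
  volume (T + u *m (const_mx 1 : 'rV[R]_4)) = volume T.
Proof.
move=> nd; rewrite /volume -[in RHS](leb3_trans (- u 0 0) (- u 1 0) (- u 2%:R 0) (measurable_tetra nd)).
have qE (p : T3) : point3 (p.1.1 - u 0 0, p.1.2 - u 1 0, p.2 - u 2%:R 0) = point3 p - u.
  by apply: cV3_ext; rewrite ?point3_0 ?point3_1 ?point3_2 !mxE.
have h (a : 'cV[R]_4) : \sum_i a i 0 = 1 ->
    (T + u *m (const_mx 1 : 'rV[R]_4)) *m a = T *m a + u.
  move=> a1; rewrite mulmxDl -mulmxA; congr (_ + _).
  apply/matrixP => i j; rewrite ord1 mxE big_ord1 mxE; under eq_bigr do rewrite mxE mul1r.
  by rewrite a1 mulr1.
congr (fine (leb3 R _)); apply/seteqP; split => p; rewrite /preimage /= qE.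
  by move=> [a [a0 a1 pE]]; exists a; split => //; rewrite pE h // addrK.
by move=> [a [a0 a1 pE]]; exists a; split => //; rewrite h // -pE subrK.
Qed.

End Volumes.

Section BondVolume.
Variables (R : realType) (k : nat).
Hypothesis k0 : (0 < k)%N.
Notation V := 'cV[R]_3.
Notation Zv := 'cV[int]_3.
Notation eps := (eps R k).
Notation toR := (toR R).
Variable eta : Zv.
Hypothesis eta0 : forall i, eta i 0 != 0.

(** The type A tetrahedra decompose a box with edges [eps * |eta_i|]. *)
Lemma volume_bond l :
  \sum_(s : 'S_3) volume (typeA R k l eta s) = eps ^+ 3 * `|\prod_i toR eta i 0|.
Proof.
have nd s := typeA_nondegenerate R k0 l eta0 s.
have dis s s' : tetra (typeA R k l eta s) `&` tetra (typeA R k l eta s') !=set0 -> s = s'.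
  by move=> /(typeA_disjoint k0 eta0)[|//] i; exists 0; rewrite mul0r addr0.
have <- : integral3 (bond_volume R k l eta) (fun=> 1) = eps ^+ 3 * `|\prod_i toR eta i 0|.
  pose a : V := \col_i Num.min (node R k l i 0) (node R k (l + eta) i 0).
  pose b : V := \col_i Num.max (node R k l i 0) (node R k (l + eta) i 0).
  have -> : bond_volume R k l eta = [set x : V | forall i, a i 0 < x i 0 < b i 0].
    by apply/seteqP; split => x /= h i; have := h i; rewrite !mxE.
  rewrite integral3_box => [|i]; last by rewrite !mxE ge_min !le_max lexx.
  have -> : eps ^+ 3 * `|\prod_i toR eta i 0| = \prod_(i < 3) (eps * `|toR eta i 0|).
    by rewrite big_split /= normr_prod prodr_const card_ord.
  apply: eq_bigr => i _; rewrite [a _ _]mxE [b _ _]mxE [toR eta _ _]mxE.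
  have -> : eps * `|(eta i 0)%:~R| = `|node R k (l + eta) i 0 - node R k l i 0|.
    rewrite !nodeE -mulrBr mxE rmorphD /= addrAC subrr add0r normrM.
    by rewrite (ger0_norm (ltW (eps_gt0 R k0))).
  move: (node _ _ _ _ _) (node _ _ _ _ _) => y x.
  by case: (lerP x y).
rewrite (@integral3_cells R [seq typeA R k l eta s | s <- enum {: 'S_3}] _ _ (fun=> 1)).
- by rewrite big_map big_enum; apply: eq_bigr => s _; rewrite mulr1.
- rewrite map_inj_uniq ?enum_uniq // => s s' e; apply: dis.
  by rewrite e setIid; exists (centroid (typeA R k l eta s')); exact: tetra_centroid.
- by move=> _ /mapP[s _ ->].
- by move=> _ _ /mapP[s _ ->] /mapP[s' _ ->] /dis ->.
- by move=> _ x /mapP[s _ ->] Tx; split => //; exact: typeA_sub Tx.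
move=> x Bx hx; have [s sx] := typeA_cover k0 eta0 (subset_closure Bx).
have sT : typeA R k l eta s \in [seq typeA R k l eta s | s <- enum {: 'S_3}].
  by apply: map_f; rewrite mem_enum.
exists (typeA R k l eta s) => //; apply/tetraP => // j.
by rewrite lt_neqAle eq_sym hx //=; exact: ((closure_tetraP (nd s) x).1 sx).
Qed.

Lemma volume_cell_translate (c : Zv * 'S_3) :
  volume (cell_tetra R k c) = volume (cell_tetra R k (0, c.2)).
Proof.
rewrite -[RHS](volume_translate (node R k c.1) (cell_nondegenerate R k0 _)).
congr volume; apply/matrixP => i j; rewrite !mxE big_ord1 !mxE /= add0r mulr1.
by rewrite -mulrDr -intrD addrC.
Qed.

End BondVolume.

Section Gradients.
Variables (R : realType) (k : nat).
Hypothesis k0 : (0 < k)%N.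
Notation V := 'cV[R]_3.
Notation Zv := 'cV[int]_3.
Notation eps := (eps R k).
Notation toR := (toR R).

Lemma dinterp_edge (v : Zv -> V) T a b : nondegenerate_tetra T ->
  dinterp k v T (col a T - col b T) = nodeval k v (col a T) - nodeval k v (col b T).
Proof.
move=> nd; rewrite /dinterp; under eq_bigr do rewrite dot_lam_edge // scalerBl.
rewrite sumrB (bigD1 a) //= eqxx scale1r big1 ?addr0 => [|i /negbTE->]; last by rewrite scale0r.
by rewrite (bigD1 b) //= eqxx scale1r big1 ?addr0 // => i /negbTE->; rewrite scale0r.
Qed.

Lemma dinterp_sum (v : Zv -> V) T (I : finType) (f : I -> V) :
  dinterp k v T (\sum_i f i) = \sum_i dinterp k v T (f i).
Proof.
rewrite /dinterp exchange_big; apply: eq_bigr => j _ /=.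
by rewrite dot_sumr scaler_suml.
Qed.

(** The vector [eta] is the main diagonal of the bond volume, an edge of each
    type A tetrahedron. *)
Lemma dinterp_typeA (v : Zv -> V) (l eta : Zv) s : (forall i, eta i 0 != 0) ->
  dinterp k v (typeA R k l eta s) (toR eta) = Dbar k eta v l.
Proof.
move=> eta0; have nd := typeA_nondegenerate R k0 l eta0 s.
have E : toR eta = eps^-1 *: (col (o4 3) (typeA R k l eta s) - col (o4 0) (typeA R k l eta s)).
  apply/matrixP => i j; rewrite ord1 !mxE ltn_ord addr0 -/eps -mulrBr mulKf ?eps_neq0 //.
  by rewrite intrD addrAC subrr add0r.
rewrite E dinterpZ dinterp_edge // /Dbar; congr (_ *: (_ - _)); rewrite typeA_col nodevalE //;
  congr v; apply/matrixP => i j; rewrite ord1 !mxE ?ltn_ord ?addr0 //.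
Qed.

End Gradients.

Section Periodicity.
Variables (R : realType) (k : nat) (M : 'I_3 -> nat).
Hypotheses (k0 : (0 < k)%N) (M0 : forall i, (0 < M i)%N).
Notation V := 'cV[R]_3.
Notation Zv := 'cV[int]_3.
Variable v : Zv -> V.
Hypothesis vper : forall l i, v (l + period k M i *: delta_mx i 0) = v l.

Lemma periodic_mul l i (d : int) : v (l + (d * period k M i) *: delta_mx i 0) = v l.
Proof.
have pos (n : nat) l' : v (l' + (n%:Z * period k M i) *: delta_mx i 0) = v l'.
  elim: n => [|n IH] in l' *; first by rewrite mul0r scale0r addr0.
  by rewrite intS mulrDl mul1r scalerDl addrA IH vper.
case: d => n; first exact: pos.
rewrite NegzE -[RHS](pos n.+1) -[in LHS](pos n.+1) addrAC -addrA -scalerDl mulNr addrN.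
by rewrite scale0r addr0 pos.
Qed.

Lemma periodic_eq (l l' : Zv) : (forall i, exists d : int, l' i 0 = l i 0 + d * period k M i) ->
  v l' = v l.
Proof.
move=> /choice[d dE].
have -> : l' = ((l + (d 0 * period k M 0) *: delta_mx 0 0) + (d 1 * period k M 1) *: delta_mx 1 0)
     + (d 2%:R * period k M 2%:R) *: delta_mx 2%:R 0.
  apply/matrixP => i j; rewrite ord1 !mxE dE.
  by have [->|->|->] := ord3_cases i; rewrite /= ?mulr0 ?mulr1 ?addr0.
by rewrite !periodic_mul.
Qed.

Variable C : seq Zv.
Hypotheses (uC : uniq C) (CE : forall l, cell_range k M l <-> l \in C).

(** Translation followed by reduction modulo the periods permutes the points
    of one period. *)
Lemma periodic_sum (a : Zv) : \sum_(l <- C) v (l + a) = \sum_(l <- C) v l.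
Proof.
pose lo i : int := k%:Z * (1 - (M i)%:Z).
have p0 i : 0 < period k M i.
  by rewrite /period; have := M0 i; have := k0; case: (M i) => // m; nia.
(* The representative of [l + a] in the period. *)
pose h (l : Zv) : Zv := \col_i (lo i + modz (l i 0 + a i 0 - lo i) (period k M i)).
have hE l : v (h l) = v (l + a).
  apply: periodic_eq => i; exists (- divz (l i 0 + a i 0 - lo i) (period k M i)).
  rewrite /h !mxE; have := divz_eq (l i 0 + a i 0 - lo i) (period k M i).
  by move: (period k M i) (divz _ _) (modz _ _) => p q r; lra.
have rng l : cell_range k M l <-> forall i, lo i <= l i 0 < lo i + period k M i.
  by split => g i; have := g i; rewrite /lo /period; lia.
under eq_bigr do rewrite -hE; rewrite -(big_map h xpredT v).
apply: perm_big; have uh : uniq (map h C).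
  rewrite map_inj_in_uniq // => l l' /CE/rng g /CE/rng g' e; apply/matrixP => i j; rewrite ord1.
  have := congr1 (fun u : Zv => u i 0) e; rewrite !mxE => /addrI e'.
  have := divz_eq (l i 0 + a i 0 - lo i) (period k M i).
  have := divz_eq (l' i 0 + a i 0 - lo i) (period k M i).
  rewrite e'; have := p0 i; have := g i; have := g' i; move: (period _ _ _) (divz _ _) (divz _ _) (modz _ _).
  move=> p q q' r g1 g2 pp E1 E2.
  have h1 : q - q' < 1 by rewrite -(ltr_pM2r pp) mul1r; lra.
  have h2 : -1 < q - q' by rewrite -(ltr_pM2r pp) mulN1r; lra.
  have qq : q' = q by lia.
  by rewrite qq in E1; lra.
have sub : {subset map h C <= C}.
  move=> _ /mapP[l lC ->]; apply/CE/rng => i; rewrite mxE.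
  have := modz_ge0 (l i 0 + a i 0 - lo i) (lt0r_neq0 (p0 i)).
  have := ltz_pmod (l i 0 + a i 0 - lo i) (p0 i); lia.
apply: uniq_perm => //; apply: (uniq_min_size uh sub _).2.
by rewrite size_map.
Qed.

(** For a fixed permutation the derivatives along the axes are difference
    quotients along edges, which cancel by [periodic_sum]. *)
Lemma periodic_gradients (eta : Zv) (Cs : seq (Zv * 'S_3)) : uniq Cs ->
  (forall c, cell_range k M c.1 <-> c \in Cs) ->
  \sum_(c <- Cs) volume (cell_tetra R k c) *: dinterp k v (cell_tetra R k c) (toR R eta) = 0.
Proof.
move=> uCs CsE.
have -> : \sum_(c <- Cs) volume (cell_tetra R k c) *: dinterp k v (cell_tetra R k c) (toR R eta) =
    \sum_(c <- [seq (l, s) | l <- C, s <- enum {: 'S_3}])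
      volume (cell_tetra R k c) *: dinterp k v (cell_tetra R k c) (toR R eta).
  apply: perm_big; apply: uniq_perm => //.
    by rewrite allpairs_uniq ?enum_uniq // => -[? ?] [? ?].
  move=> c; apply/idP/allpairsP => [/CsE/CE h|[[l s] /= [/CE lC _ ->]]]; last exact/CsE.
  by exists c; rewrite h mem_enum; case: c h.
rewrite big_allpairs_dep exchange_big /= big1 // => s _.
under eq_bigr do rewrite volume_cell_translate //=.
rewrite -scaler_sumr.
pose vtx (j : nat) : Zv := \col_i (if (s i < j)%N then 1 else 0).
have h l i : dinterp k v (cell_tetra R k (l, s)) (delta_mx i 0) =
    (eps R k)^-1 *: (v (l + vtx (s i).+1) - v (l + vtx (s i))).
  have nd := cell_nondegenerate R k0 (l, s).
  have h3 : ((s i).+1 < 4)%N by rewrite ltnS ltn_ord.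
  have h4 : (s i < 4)%N by rewrite ltnW.
  have E : delta_mx i 0 = (eps R k)^-1 *: (col (Ordinal h3) (cell_tetra R k (l, s)) -
      col (Ordinal h4) (cell_tetra R k (l, s))) :> V.
    apply/matrixP => i' j; rewrite ord1 !mxE /= -mulrBr mulKf ?eps_neq0 //.
    rewrite !intrD opprD addrACA subrr add0r ltnS leq_eqVlt.
    have -> : (s i' == s i :> nat) = (i' == i) by rewrite val_eqE (inj_eq perm_inj).
    by have [->|_] := eqVneq i' i; [rewrite ltnn subr0|rewrite /= subrr].
  rewrite E dinterpZ dinterp_edge // !typeA_col !nodevalE //.
  by congr (_ *: (v _ - v _)); apply/matrixP => i' j; rewrite ord1 !mxE.
have E : toR R eta = \sum_i toR R eta i 0 *: delta_mx i 0.
  rewrite {1}[toR R eta]matrix_sum_delta; apply: eq_bigr => i _.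
  by rewrite big_ord1.
rewrite E; under eq_bigr do rewrite dinterp_sum.
rewrite exchange_big /= big1 ?scaler0 // => i _.
under eq_bigr do rewrite dinterpZ h scalerA.
by rewrite -scaler_sumr sumrB !periodic_sum subrr scaler0.
Qed.

End Periodicity.

(** * Derivatives, traces and face integrals *)

Section Derivatives.
Variable R : realType.
Notation V := 'cV[R]_3.

Lemma is_derive_bigsum (I : eqType) (r : seq I) (f : I -> R -> R) (d : I -> R) :
  (forall i, i \in r -> is_derive (0 : R) (1 : R) (f i) (d i)) ->
  is_derive (0 : R) (1 : R) (fun t => \sum_(i <- r) f i t) (\sum_(i <- r) d i).
Proof.
elim: r => [|i r IH] h.
  rewrite big_nil (_ : (fun t => _) = cst 0); first exact: is_derive_cst.
  by apply: funext => t; rewrite big_nil.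
rewrite big_cons (_ : (fun t => _) = f i + (fun t => \sum_(j <- r) f j t)).
  apply: is_deriveD; first by apply: h; exact: mem_head.
  by apply: IH => j jr; apply: h; rewrite inE jr orbT.
by apply: funext => t; rewrite big_cons.
Qed.

Lemma derive_gradient (f : V -> R) a b : differentiable f a ->
  'D_b f a = dot (gradient f a) b.
Proof.
move=> df; rewrite deriveE // [b in LHS]matrix_sum_delta.
rewrite linear_sum /dot; apply: eq_bigr => i _.
by rewrite big_ord1 (linearZ_LR ('d f a)) /= mxE deriveE // mulrC.
Qed.

Lemma is_derive_line (f : V -> R) a b : differentiable f a ->
  is_derive (0 : R) (1 : R) (fun t => f (a + t *: b)) (dot (gradient f a) b).
Proof.
move=> df; have E : (fun h : R => h^-1 *: (((fun t => f (a + t *: b)) \o shift 0) (h *: 1) -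
    f (a + 0 *: b))) = (fun h : R => h^-1 *: ((f \o shift a) (h *: b) - f a)).
  apply: funext => h /=; rewrite scale0r !addr0 [a + _]addrC.
  by rewrite [h%:A]mulr1.
split; first by rewrite /derivable E; exact: diff_derivable.
by rewrite /derive E -(derive_gradient _ df).
Qed.

Lemma is_derive_mulid (h : R -> R) : {for 0, continuous h} ->
  is_derive (0 : R) (1 : R) (fun t => t * h t) (h 0).
Proof.
move=> ch; have c : (fun s : R => s^-1 *: (((fun t => t * h t) \o shift 0) (s *: 1) -
    0 * h 0)) @ 0^' --> h 0.
  have h3 : h @ 0^' --> h 0 by apply: cvg_within_filter; exact: ch.
  apply: cvg_trans h3; apply: near_eq_cvg.
  apply: (@filterS _ (nbhs (0 : R)) _ setT); last exact: filterT.
  move=> s _ s0; rewrite /= mul0r subr0 addr0 [s *: 1]mulr1.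
  by rewrite [_ *: _]mulrA mulVf // mul1r.
split; first by apply/cvg_ex; exists (h 0).
exact: cvg_lim c.
Qed.

(** Only the value of the second factor at 0 survives, because of the factor
    [t]. *)
Lemma is_derive_jump (f : V -> R) a b J : C1 f ->
  is_derive (0 : R) (1 : R) (fun t => t * dot (gradient f (a + t *: b)) J)
    (dot (gradient f a) J).
Proof.
move=> [df cg].
have h := @is_derive_mulid (fun t => dot (gradient f (a + t *: b)) J).
rewrite -[a in X in is_derive _ _ _ X]addr0 -(scale0r b); apply: h.
have E : (fun t : R => dot (gradient f (a + t *: b)) J) =
    dot J \o (gradient f \o (fun t : R => a + t *: b)).
  by apply: funext => t; rewrite /= dotC.
have cl : {for (0 : R), continuous (fun t : R => a + t *: b)}.
  by apply: cvgD; [exact: cvg_cst|apply: cvgZr_tmp; exact: cvg_id].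
rewrite E; apply: continuous_comp; last exact: dot_continuous.
by apply: continuous_comp => //; exact: cg.
Qed.

(** The difference quotients of an affine map are constant. *)
Lemma derive_interp k (y : 'cV[int]_3 -> V) T (w : V -> V) x u :
  (\forall z \near x, w z = interp k y T z) -> 'D_u w x = dinterp k y T u.
Proof.
move=> h; rewrite (near_eq_derive _ h); apply: cvg_lim; first exact: norm_hausdorff.
have h3 : (fun _ : R => dinterp k y T u) @ 0^' --> dinterp k y T u by exact: cvg_cst.
apply: cvg_trans h3; apply: near_eq_cvg.
apply: (@filterS _ (nbhs (0 : R)) _ setT); last exact: filterT.
move=> s _ s0 /=; rewrite [s *: u + x]addrC interpD [_ - _]addrAC subrr add0r dinterpZ scalerA.
by rewrite mulVf // scale1r.
Qed.

Lemma trace_val (A : set V) (w g : V -> V) x : closure A x -> {for x, continuous g} ->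
  (\forall z \near x, A z -> w z = g z) -> trace A w x = g x.
Proof.
move=> Ax gc h; have PF : ProperFilter (within A (nbhs x)) by exact: within_nbhs_proper.
apply: cvg_lim; first exact: norm_hausdorff.
have h3 : g @ within A (nbhs x) --> g x by apply: cvg_within_filter; exact: gc.
apply: cvg_trans h3; apply: near_eq_cvg.
by apply: filterS h => z hz Az; rewrite hz.
Qed.

End Derivatives.

Section FaceIntegrable.
Variable R : realType.
Notation V := 'cV[R]_3.
Notation T1 := (measurableTypeR R).
Notation T2 := (T1 * T1)%type.

Definition face_part (f : 'M[R]_(3, 4) * 'I_4) (S : set V) : set T2 :=
  [set st : T2 | [/\ 0 <= st.1, 0 <= st.2, st.1 + st.2 <= 1 & S (face_point f.1 f.2 st)]].

Lemma measurable_aff_face f (Q : V * R) :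
  measurable_fun setT (fun st : T2 => aff Q (face_point f.1 f.2 st) : T1).
Proof.
have -> : (fun st : T2 => aff Q (face_point f.1 f.2 st) : T1) = (fun st : T2 =>
    dot Q.1 (face_edge f.1 f.2 1) * st.1 + dot Q.1 (face_edge f.1 f.2 2%:R) * st.2 +
    aff Q (col (lift f.2 0) f.1)).
  apply: funext => st; rewrite /face_point !affD !dotZr; ring.
exact: measurable_lin2.
Qed.

(** A bounded function on a polygon. *)
Lemma face_integrable f (S : set V) W Qs : nondegenerate_tetra f.1 ->
  (forall x, S x <-> cpolyhedron Qs x) ->
  (leb2 R).-integrable setT (EFin \o
     ((fun st : T2 => aff W (face_point f.1 f.2 st)) \_ (face_part f S))).
Proof.
move=> nd SQ; have [C hC] := aff_bound W nd.
have inc st : face_part f S st -> closure (tetra f.1) (face_point f.1 f.2 st).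
  by move=> [h1 h2 h3 _]; apply: (@face_closure _ _ f.2) => //; apply/face_point_face.
have hS : measurable (face_part f S).
  have -> : face_part f S = \bigcap_(P in [set` Qs]) [set st : T2 | 0 <= aff P (face_point f.1 f.2 st)]
     `&` ([set st : T2 | 0 <= st.1] `&` ([set st | 0 <= st.2] `&` [set st | 0 <= 1 - st.1 - st.2])).
    apply/seteqP; split => st.
      move=> [h1 h2 h3 /SQ h4]; split; first by move=> P PQ; exact: h4.
      by split => //; split => //=; lra.
    move=> [h4 [h1 [h2 /= h3]]]; split => //; first by lra.
    by apply/SQ => P PQ; exact: h4.
  have m1 Q : measurable [set st : T2 | 0 <= aff Q (face_point f.1 f.2 st)].
    rewrite (_ : [set st | _] = (fun st : T2 => aff Q (face_point f.1 f.2 st) : T1) @^-1` `[0, +oo[%classic).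
      by apply: measurable_preimage; [exact: measurable_aff_face|exact: measurable_itv].
    by apply/seteqP; split => st /=; rewrite in_itv /= andbT.
  have m2 a b c : measurable [set st : T2 | 0 <= a * st.1 + b * st.2 + c].
    rewrite (_ : [set st | _] = (fun st : T2 => a * st.1 + b * st.2 + c : T1) @^-1` `[0, +oo[%classic).
      by apply: measurable_preimage; [exact: measurable_lin2|exact: measurable_itv].
    by apply/seteqP; split => st /=; rewrite in_itv /= andbT.
  have m3 a b c (A : set T2) : (forall st : T2, A st <-> 0 <= a * st.1 + b * st.2 + c) -> measurable A.
    by move=> AE; rewrite (_ : A = [set st : T2 | 0 <= a * st.1 + b * st.2 + c]) //; apply/seteqP; split => st /AE.
  apply: measurableI; last apply: measurableI; last apply: measurableI.
  - by apply: fin_bigcap_measurable => //; exact: finite_seqP.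
  - by apply: (m3 1 0 0) => st /=; rewrite mul1r mul0r !addr0.
  - by apply: (m3 0 1 0) => st /=; rewrite mul1r mul0r add0r addr0.
  - by apply: (m3 (-1) (-1) 1) => st /=; split; lra.
have C0 : 0 <= C.
  by apply: le_trans (hC (centroid f.1) _); [|apply/subset_closure/tetra_centroid].
apply: (@leb2_integrable_bounded R _ 1 C).
- apply/(measurable_restrict _ hS) => //; rewrite setTI; apply: measurable_funTS; exact: measurable_aff_face.
- move=> st; rewrite patchE; case: ifPn => [/set_mem/inc/hC //|_]; by rewrite normr0.
- move=> st; rewrite patchE; case: ifPn => [/set_mem[h1 h2 h3 _] _|_]; last by rewrite eqxx.
  by rewrite !ger0_norm //; split; lra.
Qed.

End FaceIntegrable.

(** * Energy and balance for one interaction vector *)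

Section Evaluation.
Variables (R : realType) (k : nat) (M : 'I_3 -> nat) (Oa Os : set 'cV[R]_3).
Hypothesis k0 : (0 < k)%N.
Hypothesis reg : regions k M Oa Os.
Notation V := 'cV[R]_3.
Notation Zv := 'cV[int]_3.
Notation cell := (Zv * 'S_3)%type.
Notation cell_tetra := (cell_tetra R k).
Notation Gamma := (Gamma Oa Os).
Notation toR := (toR R).
Notation T1 := (measurableTypeR R).
Notation T2 := (T1 * T1)%type.
Variables CA CS : seq cell.
Hypotheses (CAE : forall c, tetra (cell_tetra c) `<=` Oa <-> c \in CA)
  (CSE : forall c, tetra (cell_tetra c) `<=` Os <-> c \in CS)
  (CAcl : forall x, closure Oa x -> exists2 c, c \in CA & closure (tetra (cell_tetra c)) x)
  (CScl : forall x, closure Os x -> exists2 c, c \in CS & closure (tetra (cell_tetra c)) x)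
  (uCA : uniq CA) (uCS : uniq CS).
Variable eta : Zv.
Hypothesis eta0 : forall i, eta i 0 != 0.
Notation B l := (bond_volume R k l eta).
Hypothesis far : forall l, closure (B l) `&` closure Oa !=set0 -> closure (B l) `<=` Omega R M.
Variables (TB : Zv -> Zv -> seq 'M[R]_(3, 4)) (yB : (Zv -> V) -> Zv -> Zv -> V -> V).
Hypothesis bi : forall l, in_BGamma k Oa Os l eta ->
    [/\ tetra_decomposition (B l) (TB l eta),
        forall y, {within closure (B l) `\` Gamma, continuous (yB y l eta)},
        decomposition_kinds k Oa Os TB l eta,
        decomposition_compatible k Oa Os TB l eta
      & forall y T, T \in TB l eta -> affine_interpolant k y T (yB y l eta)].
Notation tets l := (atomistic_tets k Oa eta TB l).
Notation relevant := (relevant k Oa Os eta).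
Notation inner_bond := (inner_bond k Oa eta).
Variable L : seq Zv.
Hypotheses (uL : uniq L) (LE : forall l, l \in L <-> lattice R k M l /\ relevant l).
Variable Ps : seq (V * R).
Hypotheses (Ps0 : forall P, P \in Ps -> P.1 != 0)
  (PsC : forall c, c \in CA ++ CS -> {subset planes (cell_tetra c) <= Ps})
  (LPs : forall l, l \in L -> {subset bond_planes R k l eta <= Ps})
  (TPs : forall l T, l \in L -> T \in tets l -> {subset planes T <= Ps}).
Variable ybar : (Zv -> V) -> V -> V.
Hypothesis cb : cb_interpolant k Os ybar.
Variable phi : Zv -> V -> R.
Variables (F : 'M[R]_3) (v : Zv -> V).

Notation faces := (interface_faces k Oa Os CA).
Notation facets := (map (facet R k) faces).
Notation bond_function := (bond_function k yB ybar).
Let nd := cell_nondegenerate R k0.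
Let bf : boundary_faces Oa Ps facets := interface_boundary_faces k0 reg CAE CSE CAcl CScl uCA PsC.
Let rel l : l \in L -> relevant l. Proof. by move=> /LE[]. Qed.
Let GL l : lattice R k M l -> in_BGamma k Oa Os l eta -> l \in L.
Proof. by move=> h1 h2; apply/LE; split => //; right. Qed.
Let tetsP l T (lL : l \in L) (TT : T \in tets l) := atomistic_tetsP k0 eta0 bi (rel lL) TT.

Definition deformed t : Zv -> V := fun l => F *m node R k l + t *: v l.

Lemma dinterp_deformed T t : nondegenerate_tetra T -> lattice_vertices k T ->
  dinterp k (deformed t) T (toR eta) = F *m toR eta + t *: dinterp k v T (toR eta).
Proof. by move=> ndT lat; exact: dinterp_yt. Qed.

Section AtFace.
Variables (f : cell * 'I_4) (x : V).
Hypothesis (fI : f \in faces).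
Notation m := (interior_side (facet R k f)).
Hypotheses (gx : generic Ps x m) (fx : face (cell_tetra f.1) f.2 x).

(** The region [Oa] is absent on the other side of the face. *)
Lemma tets_at_face l T : l \in L -> T \in tets l -> closure (tetra T) x ->
  side (tetra T) x m.
Proof.
move=> lL TT Tx; have [ndT _ TO _] := tetsP lL TT.
have [_ _ bfin _ _] := bf; have ff : facet R k f \in facets by exact: map_f.
have [nO sO snO] := bfin _ _ _ ff gx fx.
have nt : ~ tetra T x by move=> /TO.
have [j [_ _ sd [a a0 aE]]] := closure_tetra_cases ndT (TPs lL TT) gx Tx nt.
have m0 : m != 0 by case: gx.
rewrite aE in sd; case: (ltgtP a 0) => [lt|gt|e]; last by rewrite e eqxx in a0.
- exfalso; move: sd; rewrite -[a]opprK scaleNr -scalerN => /sideZ sd.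
  have {}sd : side (tetra T) x (- m) by apply: sd; rewrite oppr_gt0.
  have mm0 : - m != 0 by rewrite oppr_eq0.
  by have [z [/TO]] := side_meet mm0 sd snO.
- exact/(sideZ _ _ _ gt).
Qed.

Lemma tets_at_face_unique l T T' : l \in L -> T \in tets l -> T' \in tets l ->
  closure (tetra T) x -> closure (tetra T') x -> T' = T.
Proof.
move=> lL TT TT' Tx T'x; have m0 : m != 0 by case: gx.
apply: (atomistic_tets_disjoint k0 eta0 bi (rel lL) TT' TT).
exact: side_meet m0 (tets_at_face lL TT' T'x) (tets_at_face lL TT Tx).
Qed.

End AtFace.

Lemma bond_function_in y l T z : l \in L -> in_BGamma k Oa Os l eta -> T \in tets l ->
  tetra T z -> yB y l eta z = interp k y T z /\ bond_function l eta y z = interp k y T z.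
Proof.
move=> lL gl TT Tz; have [ndT TBl _ lat] := tetsP lL TT; have [_ _ _ _ ai] := bi gl.
have TT2 : T \in TB l eta.
  have ninn : ~ inner_bond l by move=> /(inner_bond_Gamma reg).
  by move: TT; rewrite /atomistic_tets asboolF // mem_filter mem_undup => /andP[].
have E : yB y l eta z = interp k y T z by apply: (interp_unique k0 ndT lat _ Tz); exact: ai.
by split => //; rewrite /bond_function /patch mem_set //; exact: TBl.
Qed.

(** Inside the bond volume [z] lies in a closed tetrahedron of its
    decomposition, which has to be the cell [c] since cells are disjoint. *)
Lemma bond_function_out y l c z : l \in L -> in_BGamma k Oa Os l eta -> c \in CS ->
  tetra (cell_tetra c) z -> bond_function l eta y z = interp k y (cell_tetra c) z.
Proof.
move=> lL gl cS cz; have cOs := (CSE c).2 cS; have zS := cOs _ cz.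
rewrite /bond_function /patch; case: ifPn => [/set_mem Bz|_]; last first.
  apply: (interp_unique k0 (nd c) (cell_lattice R k c) _ cz).
  by have [_] := cb y; apply.
have [[ndT _ clB] _ kd _ ai] := bi gl.
have := subset_closure Bz; rewrite clB => -[T /= TT Tz].
have TS : tetra T `<=` Os.
  have [[//|TO] _ _] := kd _ TT.
  by case: (Os_Oa reg zS); exact: closure_subset TO _ Tz.
have [_ /(_ TS)[c' vE] _] := kd _ TT.
have tE : tetra T = tetra (cell_tetra c') := same_vertices_tetra (ndT _ TT) (nd c') vE.
have cc : c' = c.
  have h : tetra (cell_tetra c) `&` tetra (cell_tetra c') !=set0.
    by rewrite -tE; exact: open_meets_closure (open_tetra (nd c)) cz Tz.
  by rewrite (cell_disjoint k0 h).
rewrite cc in vE tE; have Tz' : tetra T z by rewrite tE.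
have lat : lattice_vertices k T.
  move=> j; have [j' ->] := same_vertices j vE; exact: cell_lattice.
rewrite (interp_unique k0 (ndT _ TT) lat (ai y _ TT) Tz').
have [] // := interp_agree k y (ndT _ TT) (nd c) (subset_closure Tz').
by move=> j _; exact: same_vertices.
Qed.

(** Near a generic interface point each region is covered by a single
    tetrahedron, on which the function is affine. *)
Lemma surface_traces y f x l T c : f \in faces ->
  generic Ps x (interior_side (facet R k f)) -> face (cell_tetra f.1) f.2 x ->
  l \in L -> in_BGamma k Oa Os l eta -> T \in tets l -> closure (tetra T) x ->
  c \in CS -> closure (tetra (cell_tetra c)) x ->
  [/\ trace Oa (bond_function l eta y) x = interp k y T x,
      trace Os (bond_function l eta y) x = interp k y (cell_tetra c) x,
      trace Oa (fun z => 'D_(toR eta) (bond_function l eta y) z) x = dinterp k y T (toR eta) &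
      trace Os (fun z => 'D_(toR eta) (bond_function l eta y) z) x =
        dinterp k y (cell_tetra c) (toR eta)].
Proof.
move=> fI gx fx lL gl TT Tx cS cx.
have sT := tets_at_face fI gx fx lL TT Tx.
have sc : side (tetra (cell_tetra c)) x (- interior_side (facet R k f)).
  have [c' [c'S c'x s' u']] := face_outer k0 reg CAE CSE CScl PsC fI gx fx.
  by rewrite (u' c cS cx).
have sds := face_sides k0 reg CAE CSE CScl PsC fI gx fx.
have [aG sG] := face_Gamma CAE fI fx.
have [ndT _ _ _] := tetsP lL TT.
have nA : \forall z \near x, Oa z -> tetra T z.
  by apply: filterS (filterI sds sT) => z [[[h _] _] h2] /h.
have nS : \forall z \near x, Os z -> tetra (cell_tetra c) z.
  apply: filterS (filterI sds sc) => z [[_ [h _]] h2] /h hz; apply: h2.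
  by rewrite dotNl oppr_gt0.
have oT := open_tetra ndT; have oc := open_tetra (nd c).
split.
- apply: trace_val => //; first exact: interp_continuous.
  by apply: filterS nA => z h /h Tz; have [] := bond_function_in y lL gl TT Tz.
- apply: trace_val => //; first exact: interp_continuous.
  by apply: filterS nS => z h /h; exact: bond_function_out.
- apply: (@trace_val R _ _ (cst (dinterp k y T (toR eta)))) => //; first exact: cst_continuous.
  apply: filterS nA => z h /h Tz; apply: derive_interp.
  have hz : \forall w \near z, tetra T w by move: oT; rewrite openE => /(_ _ Tz).
  by apply: filterS hz => w Tw; have [] := bond_function_in y lL gl TT Tw.
- apply: (@trace_val R _ _ (cst (dinterp k y (cell_tetra c) (toR eta)))) => //; first exact: cst_continuous.
  apply: filterS nS => z h /h Tz; apply: derive_interp.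
  have hz : \forall w \near z, tetra (cell_tetra c) w by move: oc; rewrite openE => /(_ _ Tz).
  by apply: filterS hz => w; exact: bond_function_out.
Qed.

Lemma sum_unique_if (U : nmodType) (I : eqType) (r : seq I) (p : I -> Prop) (G : I -> U) e0 :
  uniq r -> e0 \in r -> p e0 -> (forall e, e \in r -> p e -> e = e0) ->
  \sum_(e <- r) (if `[< p e >] then G e else 0) = G e0.
Proof. by move=> ur er pe h; rewrite -big_mkcond; exact: sum_unique. Qed.

Definition interface_pairs l : seq ('M[R]_(3, 4) * cell) := [seq (T, c) | T <- tets l, c <- CS].

Definition trace_jump (e : 'M[R]_(3, 4) * cell) (i : 'I_3) : V * R :=
  interp_fun k v e.1 i - interp_fun k v (cell_tetra e.2) i.

Definition overlap (e : 'M[R]_(3, 4) * cell) : set V :=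
  closure (tetra e.1) `&` closure (tetra (cell_tetra e.2)).

(** The first order weight of a pair of tetrahedra in the surface energy: the
    flux of [eta] through their common part of the face, weighted by the jump
    of the interpolants of [v]. *)
Definition jump_flux (f : cell * 'I_4) (e : 'M[R]_(3, 4) * cell) : V :=
  \col_i (face_flux (facet R k f) (toR eta) *
    face_int (facet R k f) (overlap e) (trace_jump e i)).

Definition mean_gradient (e : 'M[R]_(3, 4) * cell) : V :=
  2%:R^-1 *: (dinterp k v e.1 (toR eta) + dinterp k v (cell_tetra e.2) (toR eta)).

Lemma aff_sub (P Q : V * R) x : aff (P - Q) x = aff P x - aff Q x.
Proof. by rewrite /aff /= [dot (_ - _) _]dotC dotBr ![dot x _]dotC; ring. Qed.

Lemma overlap_polyhedron l e : l \in L -> e \in interface_pairs l ->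
  forall x, overlap e x <-> cpolyhedron (planes e.1 ++ planes (cell_tetra e.2)) x.
Proof.
move=> lL /allpairsP[[T c] /= [TT cS ->]] x /=; have [ndT _ _ _] := tetsP lL TT.
split=> [[/(closure_tetraP ndT) h1 /(closure_tetraP (nd c)) h2] P|h].
  by rewrite mem_cat => /orP[/mapP[j _ ->]|/mapP[j _ ->]].
split; apply/closure_tetraP => // j; apply: h; rewrite mem_cat mem_planes ?orbT //.
Qed.

Lemma overlap_integrable l e (W : V * R) f : l \in L -> e \in interface_pairs l ->
  (leb2 R).-integrable setT (EFin \o
     ((fun st : T2 => aff W (face_point (facet R k f).1 (facet R k f).2 st)) \_
       (face_part (facet R k f) (overlap e)))).
Proof. by move=> lL /(overlap_polyhedron lL) h; exact: (@face_integrable R (facet R k f) (overlap e) W _ (nd f.1) h). Qed.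

Lemma closure_bond_Oa l x : l \in L -> closure (B l `&` Oa) x ->
  exists2 T, T \in tets l & closure (tetra T) x.
Proof.
move=> lL h.
have [|T TT] := @closure_bigU R _ (tets l) (fun T => closure (tetra T)) x.
  apply: closure_subset h => z [Bz Oz].
  have [T TT Tz] := atomistic_tets_cover k0 reg eta0 bi (rel lL) (subset_closure Bz) Oz.
  by exists T.
by rewrite -(closure_id _).1; [exists T|exact: closed_closure].
Qed.

(** At a generic point a single pair of tetrahedra contributes. The
    homogeneous deformation has no jump, hence the factor [t]. *)
Lemma surface_integrand l t f (st : T2) : l \in L -> in_BGamma k Oa Os l eta -> f \in faces ->
  generic Ps (face_point (facet R k f).1 (facet R k f).2 st) (interior_side (facet R k f)) ->
  ((fun st => dot (gradient (phi eta)
      (mean Oa Os (fun z => 'D_(toR eta) (bond_function l eta (deformed t)) z)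
         (face_point (facet R k f).1 (facet R k f).2 st)))
      (jump Oa Os (bond_function l eta (deformed t))
         (exterior_normal (facet R k f).1 (facet R k f).2) eta
         (face_point (facet R k f).1 (facet R k f).2 st)))
    \_ (face_part (facet R k f) (closure (B l `&` Oa)))) st =
  \sum_(e <- interface_pairs l) 1 * (\sum_(i <- index_enum 'I_3)
    (t * dot (exterior_normal (facet R k f).1 (facet R k f).2) (toR eta) *
     gradient (phi eta) (F *m toR eta + t *: mean_gradient e) i 0) *
    ((fun st : T2 => aff (trace_jump e i) (face_point (facet R k f).1 (facet R k f).2 st)) \_
       (face_part (facet R k f) (overlap e))) st).
Proof.
move=> lL gl fI gx; set x := face_point _ _ st in gx *.
set nu := exterior_normal _ _.
pose G e := t * dot nu (toR eta) * \sum_i gradient (phi eta) (F *m toR eta + t *: mean_gradient e) i 0 *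
  aff (trace_jump e i) x.
have simplex S : face_part (facet R k f) S st <->
    face (facet R k f).1 (facet R k f).2 x /\ S x.
  rewrite /x; split; first by move=> [h1 h2 h3 h4]; split => //; apply/face_point_face => //; exact: nd.
  by move=> [/face_point_face h hS]; have [] := h (nd _).
transitivity (\sum_(e <- interface_pairs l)
    (if `[< face_part (facet R k f) (overlap e) st >] then G e else 0)); last first.
  rewrite !big_seq; apply: eq_bigr => e eI; rewrite mul1r.
  case: asboolP => h.
    rewrite /G mulr_sumr; apply: eq_bigr => i _; rewrite patchE mem_set // mulrA.
    by congr (_ * _).
  by rewrite big1 // => i _; rewrite patchE memNset // mulr0.
have upairs : uniq (interface_pairs l).
  by rewrite allpairs_uniq ?atomistic_tets_uniq // => -[? ?] [? ?].
rewrite patchE; case: ifPn => [/set_mem/simplex[fx cx]|/negP h]; last first.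
  rewrite big_seq big1 // => e eI; rewrite asboolF // => /simplex[fx [h1 _]].
  apply: h; apply/mem_set/simplex; split => //.
  move: eI => /allpairsP[[T c] /= [TT cS eE]]; rewrite eE /= in h1.
  have [_ TBl TO _] := tetsP lL TT.
  by apply: closure_subset h1 => z Tz; split; [exact: TBl|exact: TO].
have [T TT Tx] := closure_bond_Oa lL cx.
have [c [cS c'x _ uc]] := face_outer k0 reg CAE CSE CScl PsC fI gx fx.
have eI : (T, c) \in interface_pairs l by apply/allpairsP; exists (T, c).
rewrite (@sum_unique_if _ _ _ _ G (T, c)) //; last first.
- move=> _ /allpairsP[[T' c'] /= [T'T c'S ->]] /simplex[_ [/= h1 h2]].
  by rewrite (uc c' c'S h2) (tets_at_face_unique fI gx fx lL TT T'T Tx h1).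
- by apply/simplex; split.
have [ndT _ _ lat] := tetsP lL TT; have latc := cell_lattice R k c.
have [e1 e2 e3 e4] := surface_traces (deformed t) fI gx fx lL gl TT Tx cS c'x.
rewrite /mean /jump -/x e1 e2 e3 e4 !dinterp_deformed // /G.
rewrite !interp_yt //.
rewrite dotNl scaleNr -scalerBr.
have -> : F *m x + t *: interp k v T x - (F *m x + t *: interp k v (cell_tetra c) x) =
    t *: (interp k v T x - interp k v (cell_tetra c) x).
  by rewrite opprD addrACA subrr add0r scalerBr.
have -> : 2%:R^-1 *: (F *m toR eta + t *: dinterp k v T (toR eta) +
    (F *m toR eta + t *: dinterp k v (cell_tetra c) (toR eta))) =
    F *m toR eta + t *: mean_gradient (T, c).
  by apply/matrixP => i j; rewrite !mxE; field.
rewrite !dotZr mulrA [dot nu _ * t]mulrC; congr (_ * _).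
by apply: eq_bigr => i _; rewrite /trace_jump aff_sub !aff_interp_fun /= !mxE.
Qed.

Lemma surface_energy l t : l \in L -> in_BGamma k Oa Os l eta ->
  Gamma_integral k Oa Os (closure (B l `&` Oa)) (fun nu x =>
    dot (gradient (phi eta)
           (mean Oa Os (fun z => 'D_(toR eta) (bond_function l eta (deformed t)) z) x))
        (jump Oa Os (bond_function l eta (deformed t)) nu eta x)) =
  \sum_(f <- faces) \sum_(e <- interface_pairs l)
    t * dot (gradient (phi eta) (F *m toR eta + t *: mean_gradient e)) (jump_flux f e).
Proof.
move=> lL gl; rewrite /Gamma_integral (fsbig_seqE _ (interface_faces_uniq k Oa Os uCA)); last first.
  by move=> f; split => /(interface_facesP Os CAE).
rewrite !big_seq; apply: eq_bigr => f fI.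
have ff : facet R k f \in facets by exact: map_f.
have [N [mN N0 hN]] := generic_face_points bf ff.
rewrite /face_integral.
have E := @Rintegral_null_ext _ _ R (leb2 R) N (face_part (facet R k f) (closure (B l `&` Oa)))
  _ _ mN N0 (fun st hst => surface_integrand t lL gl fI (hN st hst)).
transitivity (enorm (face_cross (cell_tetra f.1) f.2) *
  \int[leb2 R]_st (\sum_(e <- interface_pairs l) 1 * (\sum_(i <- index_enum 'I_3)
    (t * dot (exterior_normal (facet R k f).1 (facet R k f).2) (toR eta) *
     gradient (phi eta) (F *m toR eta + t *: mean_gradient e) i 0) *
    ((fun st : T2 => aff (trace_jump e i) (face_point (facet R k f).1 (facet R k f).2 st)) \_
       (face_part (facet R k f) (overlap e))) st))).
  by congr (_ * _); exact: E.
have S1 e : e \in interface_pairs l -> _ := fun eI => @Rintegral_sum _ _ R (leb2 R) _ (index_enum 'I_3)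
  (fun i => t * dot (exterior_normal (facet R k f).1 (facet R k f).2) (toR eta) *
     gradient (phi eta) (F *m toR eta + t *: mean_gradient e) i 0)
  (fun i => (fun st : T2 => aff (trace_jump e i) (face_point (facet R k f).1 (facet R k f).2 st)) \_
       (face_part (facet R k f) (overlap e))) (fun i _ => overlap_integrable (trace_jump e i) f lL eI).
have [|-> _] := @Rintegral_sum _ _ R (leb2 R) _ (interface_pairs l) (fun=> 1)
   (fun e st => \sum_(i <- index_enum 'I_3)
    (t * dot (exterior_normal (facet R k f).1 (facet R k f).2) (toR eta) *
     gradient (phi eta) (F *m toR eta + t *: mean_gradient e) i 0) *
    ((fun st : T2 => aff (trace_jump e i) (face_point (facet R k f).1 (facet R k f).2 st)) \_
       (face_part (facet R k f) (overlap e))) st).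
  by move=> e /S1[].
rewrite mulr_sumr !big_seq; apply: eq_bigr => e eI; rewrite mul1r (S1 e eI).1.
rewrite mulr_sumr [in RHS]/dot mulr_sumr; apply: eq_bigr => i _.
rewrite -Rintegral_mkcond [jump_flux f e i 0]mxE /face_flux -/(face_int (facet R k f) (overlap e) (trace_jump e i)) /=.
by move: (face_int _ _ _) => I; ring.
Qed.

Notation N := (`|\prod_i toR eta i 0|).

Lemma N_neq0 : N != 0.
Proof.
rewrite normr_eq0; apply/prodf_neq0 => i _; rewrite mxE.
exact: (etaR_neq0 R eta0 i).
Qed.

Lemma relevant_excl l : l \in L -> inner_bond l <-> ~ in_BGamma k Oa Os l eta.
Proof. by move=> /rel[h|h]; split => //; [move=> _; exact: (inner_bond_Gamma reg)|move=> /(inner_bond_Gamma reg)]. Qed.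

Lemma energy_acb_val t : energy_acb Os phi ybar eta (deformed t) =
  \sum_(c <- CS) volume (cell_tetra c) *
    phi eta (F *m toR eta + t *: dinterp k v (cell_tetra c) (toR eta)).
Proof.
rewrite /energy_acb (@integral3_cells R [seq cell_tetra c | c <- CS] _ _
  (fun T => phi eta (dinterp k (deformed t) T (toR eta)))).
- rewrite big_map; apply: eq_bigr => c _; rewrite dinterp_deformed //; exact: cell_lattice.
- rewrite map_inj_uniq // => c c' e; apply: (@cell_disjoint R k k0 c c').
  by rewrite e setIid; exists (centroid (cell_tetra c')); exact: tetra_centroid.
- by move=> _ /mapP[c _ ->].
- by move=> _ _ /mapP[c _ ->] /mapP[c' _ ->] /(cell_disjoint k0) ->.
- move=> _ x /mapP[c cS ->] cx; have cO := (CSE c).2 cS; split; first exact: cO.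
  congr (phi eta); apply: derive_interp.
  have oc := open_tetra (nd c).
  have hz : \forall w \near x, tetra (cell_tetra c) w by move: oc; rewrite openE => /(_ _ cx).
  apply: filterS hz => w; apply: interp_unique => //; first exact: cell_lattice.
  by have [_] := cb (deformed t); apply.
- move=> x Ox hx; have [c cS cx] := CScl (subset_closure Ox).
  have cT : cell_tetra c \in [seq cell_tetra c | c <- CS] by exact: map_f.
  exists (cell_tetra c) => //; apply/tetraP => // j.
  by rewrite lt_neqAle eq_sym hx //=; exact: ((closure_tetraP (nd c) x).1 cx).
Qed.

Lemma bond_volume_energy l t : l \in L -> in_BGamma k Oa Os l eta ->
  integral3 (B l `&` Oa) (fun x => phi eta ('D_(toR eta) (yB (deformed t) l eta) x)) =
  \sum_(T <- tets l) volume T * phi eta (F *m toR eta + t *: dinterp k v T (toR eta)).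
Proof.
move=> lL gl; rewrite (@integral3_cells R (tets l) _ _
  (fun T => phi eta (dinterp k (deformed t) T (toR eta)))).
- rewrite !big_seq; apply: eq_bigr => T TT; have [ndT _ _ lat] := tetsP lL TT.
  by rewrite dinterp_deformed.
- exact: atomistic_tets_uniq.
- by move=> T TT; have [] := tetsP lL TT.
- by move=> T T' TT TT'; exact: (atomistic_tets_disjoint k0 eta0 bi (rel lL) TT TT').
- move=> T x TT Tx; have [ndT TBl TO lat] := tetsP lL TT; split; first by split; [exact: TBl|exact: TO].
  congr (phi eta); apply: derive_interp; have oT := open_tetra ndT.
  have hz : \forall w \near x, tetra T w by move: oT; rewrite openE => /(_ _ Tx).
  by apply: filterS hz => w Tw; have [] := bond_function_in (deformed t) lL gl TT Tw.
- move=> x [Bx Ox] hx.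
  have [T TT Tx] := atomistic_tets_cover k0 reg eta0 bi (rel lL) (subset_closure Bx) Ox.
  have [ndT _ _ _] := tetsP lL TT.
  exists T => //; apply/tetraP => // j.
  by rewrite lt_neqAle eq_sym hx //=; exact: ((closure_tetraP ndT x).1 Tx).
Qed.

(** The six type A tetrahedra share the difference quotient along [eta]. *)
Lemma inner_bond_energy l t : l \in L -> inner_bond l ->
  \sum_(T <- tets l) volume T * phi eta (F *m toR eta + t *: dinterp k v T (toR eta)) =
  eps R k ^+ 3 * N * phi eta (Dbar k eta (deformed t) l).
Proof.
move=> lL inn; rewrite /atomistic_tets asboolT // big_map big_enum /=.
rewrite -(volume_bond R k0 eta0 l) mulr_suml; apply: eq_bigr => s _.
rewrite -dinterp_deformed ?dinterp_typeA //; first exact: typeA_nondegenerate.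
exact: typeA_lattice.
Qed.

(** The closed bond volume stays inside [Oa], away from the face. *)
Lemma jump_flux_inner l f e : l \in L -> inner_bond l -> f \in faces ->
  e \in interface_pairs l -> jump_flux f e = 0.
Proof.
move=> lL inn fI /allpairsP[[T c] /= [TT cS ->]].
have [_ TBl _ _] := tetsP lL TT.
apply/matrixP => i j; rewrite !mxE /face_int.
rewrite (_ : [set st : R * R | _] = set0) ?Rintegral_set0 ?mulr0 //.
apply/seteqP; split => // st [h1 h2 h3 [/= Tx _]].
have fx : face (cell_tetra f.1) f.2 (face_point (cell_tetra f.1) f.2 st) by apply/face_point_face.
have [aG _] := Gamma_notin reg (face_Gamma CAE fI fx).
by apply: aG; apply: inn; exact: closure_subset TBl _ Tx.
Qed.

(** Inner bond volumes are written like interface ones, with tetrahedra and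
    vanishing jumps. *)
Lemma energy_val t :
  energy_a k M Oa phi eta (deformed t) + energy_acb Os phi ybar eta (deformed t) +
  energy_Gamma k M Oa Os yB phi ybar eta (deformed t) =
  \sum_(c <- CS) volume (cell_tetra c) *
    phi eta (F *m toR eta + t *: dinterp k v (cell_tetra c) (toR eta)) +
  N^-1 * \sum_(l <- L) (\sum_(T <- tets l) volume T *
    phi eta (F *m toR eta + t *: dinterp k v T (toR eta)) -
    \sum_(f <- faces) \sum_(e <- interface_pairs l)
      t * dot (gradient (phi eta) (F *m toR eta + t *: mean_gradient e)) (jump_flux f e)).
Proof.
rewrite energy_acb_val [X in X + _]addrC -addrA; congr (_ + _).
pose bG l := `[< in_BGamma k Oa Os l eta >].
have ba l : l \in L -> ~~ bG l = `[< inner_bond l >].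
  by move=> /relevant_excl h; rewrite -asbool_neg; apply/asboolP/asboolP => /h.
rewrite mulr_sumr (bigID bG) /= addrC; congr (_ + _); last first.
  rewrite /energy_a (@fsbig_seqE _ _ _ [seq l <- L | ~~ bG l]); last 2 first.
  - exact: filter_uniq.
  - move=> l; rewrite mem_filter; split=> [[lat inn]|/andP[]].
      have lL : l \in L by apply/LE; split => //; left.
      by rewrite ba // lL andbT; exact/asboolP.
    by move=> + lL; rewrite ba // => /asboolP inn; split => //; case: ((LE l).1 lL).
  rewrite big_filter mulr_sumr big_seq_cond [RHS]big_seq_cond; apply: eq_bigr => l /andP[lL].
  rewrite ba // => /asboolP inn; rewrite inner_bond_energy //.
  rewrite (_ : \sum_(f <- faces) _ = 0); last first.
    rewrite big_seq; apply: big1 => f fI; rewrite big_seq; apply: big1 => e eI.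
    by rewrite (jump_flux_inner lL inn fI eI) dot0r mulr0.
  by rewrite subr0; have := N_neq0; move: N => n n0; field.
rewrite /energy_Gamma (@fsbig_seqE _ _ _ [seq l <- L | bG l]); last 2 first.
- exact: filter_uniq.
- move=> l; rewrite mem_filter; split=> [[lat gl]|/andP[/asboolP gl lL]].
    by rewrite (GL lat gl) andbT; exact/asboolP.
  by split => //; case: ((LE l).1 lL).
rewrite big_filter big_seq_cond [RHS]big_seq_cond; apply: eq_bigr => l /andP[lL /asboolP gl].
by rewrite /energy_Gamma_bond bond_volume_energy // surface_energy.
Qed.

(** All first order terms carry the gradient of the potential at the same
    vector [F eta]. *)
Lemma energy_derivative : C1 (phi eta) ->
  is_derive (0 : R) (1 : R) (fun t => energy_a k M Oa phi eta (deformed t) +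
    energy_acb Os phi ybar eta (deformed t) + energy_Gamma k M Oa Os yB phi ybar eta (deformed t))
  (dot (gradient (phi eta) (F *m toR eta))
    (\sum_(c <- CS) volume (cell_tetra c) *: dinterp k v (cell_tetra c) (toR eta) +
     N^-1 *: \sum_(l <- L) (\sum_(T <- tets l) volume T *: dinterp k v T (toR eta) -
       \sum_(f <- faces) \sum_(e <- interface_pairs l) jump_flux f e))).
Proof.
move=> C1phi; have [dphi _] := C1phi.
rewrite (_ : (fun t => _) = (fun t => \sum_(c <- CS) volume (cell_tetra c) *
    phi eta (F *m toR eta + t *: dinterp k v (cell_tetra c) (toR eta))) +
  (fun t => N^-1 * \sum_(l <- L) (\sum_(T <- tets l) volume T *
    phi eta (F *m toR eta + t *: dinterp k v T (toR eta)) -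
    \sum_(f <- faces) \sum_(e <- interface_pairs l)
      t * dot (gradient (phi eta) (F *m toR eta + t *: mean_gradient e)) (jump_flux f e)))); last first.
  by apply: funext => t; rewrite energy_val.
rewrite dotDr dot_sumr; apply: is_deriveD.
  apply: is_derive_bigsum => c _; rewrite dotZr.
  by apply: is_deriveZ; exact: is_derive_line.
rewrite dotZr dot_sumr; apply: is_deriveZ; apply: is_derive_bigsum => l _.
rewrite dotBr !dot_sumr; apply: is_deriveB.
  apply: is_derive_bigsum => T _; rewrite dotZr.
  by apply: is_deriveZ; exact: is_derive_line.
apply: is_derive_bigsum => f _; rewrite dot_sumr; apply: is_derive_bigsum => e _.
exact: is_derive_jump.
Qed.

Lemma face_intB f (S : set V) P Q : 
  (forall W, (leb2 R).-integrable setT (EFin \o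
     ((fun st : T2 => aff W (face_point f.1 f.2 st)) \_ (face_part f S)))) ->
  face_int f S (P - Q) = face_int f S P - face_int f S Q.
Proof.
move=> hi; rewrite /face_int -/(face_part f S) !(Rintegral_mkcond _ (face_part f S)).
rewrite -RintegralB //; apply: eq_Rintegral => st _.
by rewrite !patchE; case: ifP => _; rewrite ?aff_sub ?subr0.
Qed.

Section Flux.
Variables (f : cell * 'I_4) (i : 'I_3).
Hypothesis fI : f \in faces.
Let ff : facet R k f \in facets. Proof. exact: map_f. Qed.
Notation fp st := (face_point (facet R k f).1 (facet R k f).2 st).

Lemma face_of_simplex (st : R * R) : 0 <= st.1 -> 0 <= st.2 -> st.1 + st.2 <= 1 ->
  face (cell_tetra f.1) f.2 (fp st).
Proof. by move=> h1 h2 h3; apply/face_point_face. Qed.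

(** A generic point of the face lies in exactly one closed cell of [Os]. *)
Lemma overlap_partition l T W : l \in L -> T \in tets l ->
  \sum_(c <- CS) face_int (facet R k f) (overlap (T, c)) W =
  face_int (facet R k f) (closure (tetra T)) W.
Proof.
move=> lL TT; have [N [mN N0 hN]] := generic_face_points bf ff.
apply: (@face_int_partition R _ CS (facet R k f) (fun c => overlap (T, c)) _ (fun=> W) W N) => //.
  by move=> c cS; apply: (overlap_integrable W f lL); apply/allpairsP; exists (T, c).
move=> st nst h1 h2 h3; have gx := hN st nst; have fx := face_of_simplex h1 h2 h3.
have [c [cS cx _ uc]] := face_outer k0 reg CAE CSE CScl PsC fI gx fx.
case: asboolP => Tx; last by rewrite sum_none // => e _ [].
rewrite (@sum_unique _ _ _ (fun c => overlap (T, c) (fp st)) (fun=> aff W (fp st)) c) //.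
by move=> e eS [_ /=]; exact: uc.
Qed.

(** A generic point of the face lies in exactly one closed cell of [Oa]. *)
Lemma cells_partition : \sum_(c <- CA) face_int (facet R k f) (closure (tetra (cell_tetra c)))
    (interp_fun k v (cell_tetra c) i) =
  face_int (facet R k f) setT (interp_fun k v (cell_tetra f.1) i).
Proof.
have [N [mN N0 hN]] := generic_face_points bf ff.
apply: (@face_int_partition R _ CA (facet R k f) (fun c => closure (tetra (cell_tetra c))) _
   (fun c => interp_fun k v (cell_tetra c) i) _ N) => //.
  move=> c cA; apply: (@face_integrable R (facet R k f) _ _ (planes (cell_tetra c)) (nd f.1)) => x.
  split=> [/(closure_tetraP (nd c)) h P /mapP[j _ ->] //|h].
  by apply/(closure_tetraP (nd c)) => j; apply: h; exact: mem_planes.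
move=> st nst h1 h2 h3; have gx := hN st nst; have fx := face_of_simplex h1 h2 h3.
rewrite asboolT //.
have fam := cells_affine_family k0 CAE CAcl uCA PsC v i.
have [e [_ _ _ ue]] := face_touch fam bf ff gx fx.
have mem c : c \in CA -> (cell_tetra c, interp_fun k v (cell_tetra c) i) \in
    [seq (cell_tetra c, interp_fun k v (cell_tetra c) i) | c <- CA].
  by move=> cA; apply/mapP; exists c.
have f1A := face_cellA CAE fI; have f1x := face_closure (nd f.1) fx.
rewrite (@sum_unique _ _ _ (fun c => closure (tetra (cell_tetra c)) (fp st))
  (fun c => aff (interp_fun k v (cell_tetra c) i) (fp st)) f.1) //.
move=> c cA cx; apply: (@cell_disjoint R k k0 c f.1).
have := ue _ (mem _ cA) cx; rewrite -(ue _ (mem _ f1A) f1x) => /(congr1 fst) /= ->.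
by rewrite setIid; exists (centroid (cell_tetra f.1)); exact: tetra_centroid.
Qed.

(** A generic point of the face lies in exactly one atomistic tetrahedron of
    the class and in one cell of [Os], whose interpolant agrees on the face
    with that of the cell [f.1]. *)
Lemma class_partition r : \sum_(l <- L | congruentb eta r l) \sum_(e <- interface_pairs l)
    face_int (facet R k f) (overlap e) (interp_fun k v (cell_tetra e.2) i) =
  face_int (facet R k f) setT (interp_fun k v (cell_tetra f.1) i).
Proof.
pose fam := class_family k Oa eta TB L r v i.
(* The members of the family are determined by their first components, so
   this list has no repetitions. *)
pose rs := [seq (e.1, c) | e <- fam, c <- CS].
have famH : affine_family Oa Ps fam.
  exact: (class_affine_family k0 reg eta0 far bi uL LE LPs TPs r v i).
have -> : \sum_(l <- L | congruentb eta r l) \sum_(e <- interface_pairs l)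
    face_int (facet R k f) (overlap e) (interp_fun k v (cell_tetra e.2) i) =
   \sum_(e <- rs) face_int (facet R k f) (overlap e) (interp_fun k v (cell_tetra e.2) i).
  rewrite big_allpairs_dep big_allpairs_dep big_filter; apply: eq_bigr => l _.
  by rewrite big_allpairs_dep.
have [N [mN N0 hN]] := generic_face_points bf ff.
have rsP e : e \in rs -> exists l, [/\ l \in L, e \in interface_pairs l &
    (e.1, interp_fun k v e.1 i) \in fam].
  move=> /allpairsP[[e' c] /= [e'f cS ->]].
  have [l [T [lL _ TT eE]]] := class_familyP e'f; exists l; rewrite lL; split => //.
    by apply/allpairsP; exists (T, c); rewrite eE.
  by rewrite eE in e'f *.
apply: (@face_int_partition R _ rs (facet R k f) overlap _
   (fun e => interp_fun k v (cell_tetra e.2) i) _ N) => //.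
  by move=> e /rsP[l [lL eI _]]; exact: (overlap_integrable _ f lL eI).
move=> st nst h1 h2 h3; have gx := hN st nst; have fx := face_of_simplex h1 h2 h3.
rewrite asboolT //.
have [c [cS cx _ uc]] := face_outer k0 reg CAE CSE CScl PsC fI gx fx.
have [e [ef ex _ ue]] := face_touch famH bf ff gx fx.
have urs : uniq rs.
  rewrite allpairs_uniq //; first by case: famH.
  move=> [a b] [c' d] /allpairsP[[a1 b1] /= [+ _ [-> ->]]] /allpairsP[[c1 d1] /= [+ _ [-> ->]]].
  move=> /class_familyP[l [T [_ _ _ ->]]] /class_familyP[l' [T' [_ _ _ ->]]] /=.
  by move=> [-> ->].
rewrite (@sum_unique _ _ _ (fun e => overlap e (fp st))
  (fun e => aff (interp_fun k v (cell_tetra e.2) i) (fp st)) (e.1, c)) //.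
- rewrite !aff_interp_fun /=; congr (fun_of_matrix _ _ _); symmetry.
  exact: (face_outer_interp k0 fx v cS cx).
- by apply/allpairsP; exists (e, c).
move=> e' e'rs [h4 h5]; have [l [lL e'I e'f]] := rsP _ e'rs.
move: e'I => /allpairsP[[T' c'] /= [T'T c'S eE]].
rewrite -(ue _ e'f h4) /=; move: h5; rewrite eE /= => h5.
by rewrite (uc _ c'S h5).
Qed.

End Flux.

Lemma jump_fluxE l f e i : l \in L -> e \in interface_pairs l ->
  jump_flux f e i 0 = face_flux (facet R k f) (toR eta) *
    (face_int (facet R k f) (overlap e) (interp_fun k v e.1 i) -
     face_int (facet R k f) (overlap e) (interp_fun k v (cell_tetra e.2) i)).
Proof.
move=> lL eI; rewrite mxE -face_intB // => W; exact: (overlap_integrable W f lL eI).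
Qed.

Lemma toR_eta2 : toR eta 2%:R 0 != 0.
Proof. by rewrite mxE; exact: (etaR_neq0 R eta0). Qed.

Lemma cells_flux i : \sum_(c <- CA) volume (cell_tetra c) * dinterp k v (cell_tetra c) (toR eta) i 0 =
  \sum_(f <- faces) face_flux (facet R k f) (toR eta) *
     face_int (facet R k f) setT (interp_fun k v (cell_tetra f.1) i).
Proof.
have := divergence_theorem (open_Oa reg) Ps0 bf (cells_affine_family k0 CAE CAcl uCA PsC v i) toR_eta2.
rewrite big_map => h; transitivity (\sum_(c <- CA) volume (cell_tetra c) *
    dot (interp_fun k v (cell_tetra c) i).1 (toR eta)).
  by apply: eq_bigr => c _; rewrite dot_interp_fun.
rewrite [LHS]h big_map !big_seq; apply: eq_bigr => f fI.
by rewrite -cells_partition // big_map.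
Qed.

Lemma pairs_flux l f i : l \in L -> f \in faces ->
  \sum_(e <- interface_pairs l) jump_flux f e i 0 = face_flux (facet R k f) (toR eta) *
    (\sum_(T <- tets l) face_int (facet R k f) (closure (tetra T)) (interp_fun k v T i) -
     \sum_(e <- interface_pairs l)
        face_int (facet R k f) (overlap e) (interp_fun k v (cell_tetra e.2) i)).
Proof.
move=> lL fI; transitivity (\sum_(e <- interface_pairs l) face_flux (facet R k f) (toR eta) *
    (face_int (facet R k f) (overlap e) (interp_fun k v e.1 i) -
     face_int (facet R k f) (overlap e) (interp_fun k v (cell_tetra e.2) i))).
  by rewrite !big_seq; apply: eq_bigr => e eI; exact: jump_fluxE lL eI.
rewrite -mulr_sumr sumrB; congr (_ * (_ - _)); rewrite big_allpairs_dep.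
rewrite big_seq [RHS]big_seq; apply: eq_bigr => T TT.
by rewrite -(overlap_partition fI (interp_fun k v T i) lL TT).
Qed.

(** The class and the cells give two continuous piecewise affine functions on
    [Oa]; their fluxes through the interface differ by the fluxes of the
    jumps. *)
Lemma class_balance r i : \sum_(l <- L | congruentb eta r l)
    (\sum_(T <- tets l) volume T * dinterp k v T (toR eta) i 0 -
     \sum_(f <- faces) \sum_(e <- interface_pairs l) jump_flux f e i 0) =
  \sum_(c <- CA) volume (cell_tetra c) * dinterp k v (cell_tetra c) (toR eta) i 0.
Proof.
have famH := class_affine_family k0 reg eta0 far bi uL LE LPs TPs r v i.
have h : \sum_(l <- L | congruentb eta r l) \sum_(T <- tets l)
      volume T * dinterp k v T (toR eta) i 0 =
    \sum_(f <- faces) face_flux (facet R k f) (toR eta) * \sum_(l <- L | congruentb eta r l)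
      \sum_(T <- tets l) face_int (facet R k f) (closure (tetra T)) (interp_fun k v T i).
  have := divergence_theorem (open_Oa reg) Ps0 bf famH toR_eta2.
  rewrite big_allpairs_dep big_filter => h1.
  transitivity (\sum_(l <- L | congruentb eta r l) \sum_(T <- tets l)
      volume T * dot (interp_fun k v T i).1 (toR eta)).
    by apply: eq_bigr => l _; apply: eq_bigr => T _; rewrite dot_interp_fun.
  rewrite [LHS]h1 big_map; apply: eq_bigr => f _.
  by rewrite big_allpairs_dep big_filter.
rewrite sumrB h exchange_big cells_flux -sumrB.
rewrite big_seq [RHS]big_seq; apply: eq_bigr => f fI.
have -> : \sum_(l <- L | congruentb eta r l) \sum_(e <- interface_pairs l) jump_flux f e i 0 =
    face_flux (facet R k f) (toR eta) * (\sum_(l <- L | congruentb eta r l)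
      \sum_(T <- tets l) face_int (facet R k f) (closure (tetra T)) (interp_fun k v T i) -
      face_int (facet R k f) setT (interp_fun k v (cell_tetra f.1) i)).
  rewrite -(class_partition i fI r) -sumrB mulr_sumr big_seq_cond [RHS]big_seq_cond.
  by apply: eq_bigr => l /andP[lL _]; exact: pairs_flux.
by rewrite -mulrBr opprB addrC subrK.
Qed.

Definition residue (p : nat * nat * nat) : Zv :=
  \col_i (nth 0%N [:: p.1.1; p.1.2; p.2] i)%:Z.

Definition abs_eta i : nat := absz (eta i 0).

Definition residues : seq (nat * nat * nat) :=
  [seq (q, c) | q <- [seq (a, b) | a <- iota 0 (abs_eta 0), b <- iota 0 (abs_eta 1)],
                c <- iota 0 (abs_eta 2%:R)].

Lemma residues_size : (size residues)%:R = N :> R.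
Proof.
rewrite !size_allpairs !size_iota !natrM normr_prod.
have E i : (abs_eta i)%:R = `|toR eta i 0| by rewrite mxE natr_absz intr_norm.
rewrite !E !big_ord_recl big_ord0 mulr1 mulrA.
by congr (_ * `|toR eta _ _| * `|toR eta _ _|); exact/val_inj.
Qed.

(** The remainders of the coordinates modulo [eta] single out one residue
    class. *)
Lemma residues_unique (G : Zv -> R) :
  \sum_(p <- residues) \sum_(l <- L | congruentb eta (residue p) l) G l = \sum_(l <- L) G l.
Proof.
rewrite (exchange_big_dep xpredT) //=; apply: eq_bigr => l _.
pose q i := absz (modz (l i 0) (eta i 0)).
pose p0 := ((q 0, q 1), q 2%:R).
have qE i : (q i)%:Z = modz (l i 0) (eta i 0) by rewrite /q gez0_abs // modz_ge0.
have qlt i : (q i < abs_eta i)%N.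
  by rewrite -ltz_nat qE /abs_eta; have := ltz_mod (l i 0) (eta0 i); lia.
have resE i : residue p0 i 0 = (q i)%:Z.
  by rewrite mxE; have [->|->|->] := ord3_cases i.
have cp0 : congruentb eta (residue p0) l.
  apply/forallP => i; rewrite resE qE; apply/dvdzP; exists (divz (l i 0) (eta i 0)).
  by rewrite {1}(divz_eq (l i 0) (eta i 0)) addrK.
have p0r : p0 \in residues.
  apply/allpairsP; exists ((q 0, q 1), q 2%:R); split => //; last by rewrite mem_iota qlt.
  by apply/allpairsP; exists (q 0, q 1); rewrite !mem_iota !qlt.
have ures : uniq residues.
  rewrite !allpairs_uniq ?iota_uniq //; first by move=> [? ?] [? ?] _ _ /= [-> ->].
  by move=> [? ?] [? ?] _ _ /= [-> ->].
rewrite -big_filter (_ : [seq p <- residues | congruentb eta (residue p) l] = [:: p0]) ?big_seq1 //.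
apply: perm_small_eq => //; apply: uniq_perm => //; first exact: filter_uniq.
move=> p; rewrite mem_filter inE; apply/andP/eqP => [[cp pr]|->//].
have pE (i : 'I_3) : (nth 0%N [:: p.1.1; p.1.2; p.2] i) = q i.
  have lt : (nth 0%N [:: p.1.1; p.1.2; p.2] i < abs_eta i)%N.
    move: pr => /allpairsP[[pq c] /= [/allpairsP[[a b] /= [+ + ->]] + ->]].
    by rewrite !mem_iota /=; have [->|->|->] := ord3_cases i.
  have /eqP E : modz (l i 0) (eta i 0) == modz (residue p i 0) (eta i 0).
    by rewrite eqz_mod_dvd; exact: (forallP cp i).
  apply/eqP; rewrite -eqz_nat qE E mxE -modz_abs modz_small //.
by move: p {cp pr} pE => [[a b] c] pE; rewrite /p0 -(pE 0) -(pE 1) -(pE 2%:R).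
Qed.

(** By [class_balance] each residue class carries the total gradient of the
    cells of [Oa]. The number of classes cancels the normalizing factor, and
    with the cells of [Os] the gradients run over one period. *)
Lemma total_balance : (forall l i, v (l + period k M i *: delta_mx i 0) = v l) ->
  (forall i, (0 < M i)%N) ->
  \sum_(c <- CS) volume (cell_tetra c) *: dinterp k v (cell_tetra c) (toR eta) +
     N^-1 *: \sum_(l <- L) (\sum_(T <- tets l) volume T *: dinterp k v T (toR eta) -
       \sum_(f <- faces) \sum_(e <- interface_pairs l) jump_flux f e) = 0.
Proof.
move=> vper M0; apply/matrixP => i j; rewrite ord1 [RHS]mxE.
have [Cb [uCb CbE]] : exists C : seq Zv, uniq C /\ forall l, cell_range k M l <-> l \in C.
  apply: finite_set_seq; apply: (@sub_finite_set _ _ [set l : Zv | forall i,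
      k%:Z * (1 - (M i)%:Z) <= l i 0 <= k%:Z * (M i)%:Z]); last exact: finite_int_box.
  by move=> l h i'; have /andP[-> /ltW ->] := h i'.
have uAS : uniq (CA ++ CS).
  rewrite cat_uniq uCA uCS andbT; apply/hasPn => c cS; apply/negP => cA.
  exact: (cells_excl k0 reg CAE CSE cA cS).
have per := periodic_gradients k0 M0 vper uCb CbE eta uAS (cells_union k0 reg CAE CSE CAcl CScl).
have sumE (I : Type) (r : seq I) (g : I -> V) : (\sum_(e <- r) g e) i 0 = \sum_(e <- r) g e i 0.
  by rewrite summxE.
have := congr1 (fun u : V => u i 0) per.
rewrite big_cat [in LHS]mxE [in RHS]mxE !sumE.
have volE (r : seq cell) : \sum_(c <- r) (volume (cell_tetra c) *: dinterp k v (cell_tetra c) (toR eta)) i 0 =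
    \sum_(c <- r) volume (cell_tetra c) * dinterp k v (cell_tetra c) (toR eta) i 0.
  by apply: eq_bigr => c _; rewrite mxE.
rewrite !volE => per_i.
have cls : \sum_(l <- L) (\sum_(T <- tets l) volume T * dinterp k v T (toR eta) i 0 -
     \sum_(f <- faces) \sum_(e <- interface_pairs l) jump_flux f e i 0) =
   N * \sum_(c <- CA) volume (cell_tetra c) * dinterp k v (cell_tetra c) (toR eta) i 0.
  rewrite -residues_unique -residues_size.
  under eq_bigr do rewrite class_balance.
  by rewrite big_const_seq count_predT iter_addr_0 mulr_natl.
rewrite mxE [X in _ + X]mxE !sumE volE.
under [X in _ * X]eq_bigr => l _.
  rewrite mxE [X in _ + X]mxE !sumE.
  under eq_bigr do rewrite mxE.
  under [X in _ - X]eq_bigr do rewrite sumE.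
  over.
by rewrite cls mulrA mulVf ?N_neq0 // mul1r addrC.
Qed.

End Evaluation.

(** * Absence of ghost forces *)

Section OneInteractionVector.
Variables (R : realType) (k : nat) (M : 'I_3 -> nat) (Oa Os : set 'cV[R]_3).
Notation V := 'cV[R]_3.
Notation Zv := 'cV[int]_3.

Lemma no_ghost_force (eta : Zv) (phi : Zv -> V -> R) (ybar : (Zv -> V) -> V -> V)
    (TB : Zv -> Zv -> seq 'M[R]_(3, 4)) (yB : (Zv -> V) -> Zv -> Zv -> V -> V)
    (F : 'M[R]_3) (v : Zv -> V) :
  (0 < k)%N -> (forall i, (0 < M i)%N) -> (forall i, eta i 0 != 0) -> C1 (phi eta) ->
  regions k M Oa Os ->
  (forall l, closure (bond_volume R k l eta) `&` closure Oa !=set0 ->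
     closure (bond_volume R k l eta) `<=` Omega R M) ->
  cb_interpolant k Os ybar ->
  (forall l, in_BGamma k Oa Os l eta ->
    [/\ tetra_decomposition (bond_volume R k l eta) (TB l eta),
        forall y, {within closure (bond_volume R k l eta) `\` Gamma Oa Os,
                     continuous (yB y l eta)},
        decomposition_kinds k Oa Os TB l eta,
        decomposition_compatible k Oa Os TB l eta
      & forall y T, T \in TB l eta -> affine_interpolant k y T (yB y l eta)]) ->
  (forall l i, v (l + period k M i *: delta_mx i 0) = v l) ->
  is_derive (0 : R) (1 : R) (fun t : R =>
    let y := fun l => F *m node R k l + t *: v l in
    energy_a k M Oa phi eta y + energy_acb Os phi ybar eta y +
    energy_Gamma k M Oa Os yB phi ybar eta y) (0 : R).
Proof.
move=> k0 M0 eta0 C1phi reg far cb bi vper.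
have [[ra rs] _ _ _ _] := reg.
have [CA [uCA CAE CAcl]] := region_cells k0 ra.
have [CS [uCS CSE CScl]] := region_cells k0 rs.
have [L [uL LE]] : exists L : seq Zv, uniq L /\
    forall l, (lattice R k M l /\ relevant k Oa Os eta l) <-> l \in L.
  apply: finite_set_seq; apply: (@sub_finite_set _ _ [set l : Zv | forall i,
      k%:Z * (1 - (M i)%:Z) <= l i 0 <= k%:Z * (M i)%:Z]); last exact: finite_int_box.
  by move=> l [lat _] i; rewrite -(Omega_nodeP R k0); exact: lat.
have {}LE l : l \in L <-> lattice R k M l /\ relevant k Oa Os eta l.
  by split => /LE.
pose tets l := atomistic_tets k Oa eta TB l.
(* The planes that define the generic points: those of all cells, bond
   volumes and atomistic tetrahedra. *)
pose Ps := flatten [seq planes (cell_tetra R k c) | c <- CA ++ CS] ++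
  (flatten [seq bond_planes R k l eta | l <- L] ++
   flatten [seq flatten [seq planes T | T <- tets l] | l <- L]).
have PsC c : c \in CA ++ CS -> {subset planes (cell_tetra R k c) <= Ps}.
  move=> cC P Pc; rewrite mem_cat; apply/orP; left; apply/flattenP.
  by exists (planes (cell_tetra R k c)) => //; exact: map_f.
have LPs l : l \in L -> {subset bond_planes R k l eta <= Ps}.
  move=> lL P Pl; rewrite !mem_cat; apply/orP; right; apply/orP; left; apply/flattenP.
  by exists (bond_planes R k l eta) => //; exact: map_f.
have TPs l T : l \in L -> T \in tets l -> {subset planes T <= Ps}.
  move=> lL TT P Pl; rewrite !mem_cat; apply/orP; right; apply/orP; right; apply/flattenP.
  exists (flatten [seq planes T | T <- tets l]); first exact: map_f.
  by apply/flattenP; exists (planes T) => //; exact: map_f.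
have Ps0 P : P \in Ps -> P.1 != 0.
  rewrite !mem_cat => /orP[/flattenP[_ /mapP[c _ ->] /mapP[j _ ->]]|].
    exact: lam_neq0 (cell_nondegenerate R k0 c) j.
  move=> /orP[/flattenP[_ /mapP[l _ ->]]|]; first exact: bond_planes_neq0.
  move=> /flattenP[_ /mapP[l lL ->] /flattenP[_ /mapP[T TT ->] /mapP[j _ ->]]].
  have [_ rl] := (LE l).1 lL.
  have [ndT _ _ _] := atomistic_tetsP k0 eta0 bi rl TT.
  exact: lam_neq0 ndT j.
have h := energy_derivative k0 reg CAE CSE CAcl CScl uCA uCS eta0 bi uL LE PsC TPs cb F v C1phi.
have b := total_balance k0 reg CAE CSE CAcl CScl uCA uCS eta0 far bi uL LE Ps0 PsC LPs TPs vper M0.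
by move: h; rewrite b dot0r.
Qed.

End OneInteractionVector.

Theorem proposition5p1 (R : realType) (k : nat) (M : 'I_3 -> nat)
    (RI : set 'cV[int]_3) (phi : 'cV[int]_3 -> 'cV[R]_3 -> R)
    (Oa Os : set 'cV[R]_3)
    (ybar : ('cV[int]_3 -> 'cV[R]_3) -> 'cV[R]_3 -> 'cV[R]_3)
    (TB : 'cV[int]_3 -> 'cV[int]_3 -> seq 'M[R]_(3, 4))
    (yB : ('cV[int]_3 -> 'cV[R]_3) -> 'cV[int]_3 -> 'cV[int]_3 ->
          'cV[R]_3 -> 'cV[R]_3)
    (F : 'M[R]_3) :
  (0 < k)%N -> (forall i, (0 < M i)%N) ->
  finite_set RI -> (forall eta i, RI eta -> eta i 0 != 0) ->
  (forall eta, RI eta -> C1 (phi eta)) ->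
  regions k M Oa Os ->
  distant_from_boundary k M Oa RI ->
  cb_interpolant k Os ybar ->
  bond_interpolants k Oa Os TB yB RI ->
  0 < \det F ->
  forall v : 'cV[int]_3 -> 'cV[R]_3, periodic_zero_average k M v ->
    is_derive (0 : R) (1 : R)
      (fun t : R => energy_bv k M Oa Os yB phi ybar RI
                      (fun l => F *m node R k l + t *: v l))
      (0 : R).
Proof.
move=> k0 M0 finRI eta0 C1phi reg far cb bi _ v [vper _].
have [r [ur rE]] := finite_set_seq finRI.
rewrite /energy_bv; under eq_fun do rewrite (fsbig_seqE _ ur rE).
have h eta : eta \in r -> is_derive (0 : R) (1 : R) (fun t : R =>
    energy_a k M Oa phi eta (fun l => F *m node R k l + t *: v l) +
    energy_acb Os phi ybar eta (fun l => F *m node R k l + t *: v l) +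
    energy_Gamma k M Oa Os yB phi ybar eta (fun l => F *m node R k l + t *: v l)) (0 : R).
  move=> /rE etaRI; apply: (@no_ghost_force R k M Oa Os eta phi ybar TB yB F v) => //.
  - by move=> i; exact: eta0.
  - exact: C1phi.
  - by move=> l; exact: far.
  - by move=> l; exact: bi.
by have := is_derive_bigsum h; rewrite [X in is_derive _ _ _ X]big1.
Qed.
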